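(* Let $H:\mathbb{R}^d\times\mathbb{R}^d\to\mathbb{C}$ be measurable and locally bounded in both variables $(q,p)$, and assume that $H(q,\cdot)$ is a continuous negative definite function for every $q\in\mathbb{R}^d$. Assume moreover that 1. there is $\kappa>0$ such that $\sup_{q\in\mathbb{R}^d}|H(q,p)|\le\kappa(1+|p|^2)$ for all $p\in\mathbb{R}^d$; 2. $p\mapsto H(q,p)$ is continuous at $p=0$ uniformly with respect to $q\in\mathbb{R}^d$; 3. $q\mapsto H(q,p)$ is continuous for all $p\in\mathbb{R}^d$. Let $H(\cdot,D)$ be the pseudo-differential operator with symbol $H$, and assume that (A)(i) $-H(\cdot,D)$ is closable and its closure is the generator of a strongly continuous semigroup $(T_t)_{t\ge0}$ on $C_\infty(\mathbb{R}^d)$; (A)(ii) $C_c^\infty(\mathbb{R}^d)$ is an operator core for this generator. For $t\ge 0$ let $F(t)$ be the pseudo-differential operator with symbol $e^{-tH(q,p)}$, i.e. $F(t)\varphi(q)=(2\pi)^{-d/2}\int_{\mathbb{R}^d}e^{ip\cdot q}e^{-tH(q,p)}\widehat\varphi(p)\,dp$ for $\varphi\in C_c^\infty(\mathbb{R}^d)$, extended by continuity to a contraction on $C_\infty(\mathbb{R}^d)$. Then the family $(F(t))_{t\ge0}$ is Chernoff equivalent to the semigroup $(T_t)_{t\ge0}$, and the Hamiltonian Feynman formula $T_t=\lim_{n\to\infty}\left[F(t/n)\right]^n$ holds in the strong operator topology on $C_\infty(\mathbb{R}^d)$, locally uniformly with respect to $t\ge0$.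
   Context: $C_\infty(\mathbb{R}^d)$ is the Banach space of continuous functions on $\mathbb{R}^d$ vanishing at infinity, with the supremum norm $\|\cdot\|_\infty$. The Fourier transform is $\widehat f(p)=(2\pi)^{-d/2}\int_{\mathbb{R}^d}e^{-ip\cdot q}f(q)\,dq$. A function $\psi:\mathbb{R}^d\to\mathbb{C}$ is a continuous negative definite function if it has a Lévy–Khintchine representation $$\psi(p)=a+i\ell\cdot p+p\cdot Qp+\int_{y\ne0}\Bigl(1-e^{iy\cdot p}+\frac{iy\cdot p}{1+|y|^2}\Bigr)N(dy)$$ with $a\ge0$, $\ell\in\mathbb{R}^d$, $Q$ a positive semidefinite $d\times d$ real matrix, and $N$ a Radon measure on $\mathbb{R}^d\setminus\{0\}$ with $\int_{y\ne0}\frac{|y|^2}{1+|y|^2}N(dy)<\infty$. (Equivalently, $\psi$ is continuous and for all $m$, $p_1,\dots,p_m\in\mathbb{R}^d$ the matrix $(\psi(p_j)+\overline{\psi(p_k)}-\psi(p_j-p_k))_{j,k}$ is positive semidefinite Hermitian.) The pseudo-differential operator with symbol $H$ is $H(q,D)\varphi(q)=(2\pi)^{-d/2}\int_{\mathbb{R}^d}e^{ip\cdot q}H(q,p)\widehat\varphi(p)\,dp$, $\varphi\in C_c^\infty(\mathbb{R}^d)$. Under the hypotheses 1–3, each $F(t)$ maps $C_c^\infty(\mathbb{R}^d)$ into $C_\infty(\mathbb{R}^d)$ and extends to a contraction on $C_\infty(\mathbb{R}^d)$. Chernoff equivalence: let $X$ be a Banach space and $(T_t)_{t\ge0}$ a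 strongly continuous semigroup on $X$ with generator $(A,D(A))$. A family $(F(t))_{t\ge0}$ of bounded linear operators on $X$ is Chernoff equivalent to $(T_t)_{t\ge0}$ if $t\mapsto F(t)$ is strongly continuous, $F(0)=\mathrm{Id}$, $\|F(t)\|\le e^{at}$ for some $a\in[0,\infty)$ and all $t\ge0$, and there is a linear subspace $D$ of $D(F'(0))$ such that the restriction of $F'(0)$ to $D$ is closable with closure $(A,D(A))$. Here $F'(0)g=\lim_{t\searrow0}\frac{F(t)g-F(0)g}{t}$, with $D(F'(0))$ the set of all $g\in X$ for which the limit exists. *)

(* Defs.v *)
From HB Require Import structures.
From mathcomp Require Import all_boot all_order all_algebra complex.
From mathcomp Require Import all_classical all_reals all_analysis.

Set Implicit Arguments.
Unset Strict Implicit.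
Unset Printing Implicit Defensive.

Import Order.TTheory GRing.Theory Num.Theory.
Import numFieldNormedType.Exports.

Local Open Scope classical_set_scope.
Local Open Scope ring_scope.
Local Open Scope complex_scope.

Local Notation Re := complex.Re.
Local Notation Im := complex.Im.

#[warning="-redundant-canonical-projection"]
HB.instance Definition _ (R : realType) := NormedModule.copy R[i] R[i]^o.

Section complex_facts.
Context {R : realType}.
Implicit Types (z : R[i]) (e : R[i]).

Lemma ReC_norm z : (Re `|z|)%:C = `|z|.
Proof. by rewrite normc_def. Qed.

Lemma normC_ltE z (e : R) : (`|z| < e%:C) = (Re `|z| < e).
Proof. by rewrite -{1}ReC_norm ltcR. Qed.

Lemma normC_leE z (e : R) : (`|z| <= e%:C) = (Re `|z| <= e).
Proof. by rewrite -{1}ReC_norm lecR. Qed.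

Lemma Re_norm_ge0 z : 0 <= Re `|z|.
Proof. by rewrite -lecR ReC_norm normr_ge0. Qed.

Lemma gt0_RReP e : 0 < e -> exists2 r : R, 0 < r & e = r%:C.
Proof.
case: e => a b; rewrite ltcE /= => /andP[/eqP -> a0]; by exists a.
Qed.

Lemma Re_normD z w : Re `|z + w| <= Re `|z| + Re `|w|.
Proof. by rewrite -lecR rmorphD /= !ReC_norm ler_normD. Qed.

Lemma Re_normM z w : Re `|z * w| = Re `|z| * Re `|w|.
Proof. by apply: complexI; rewrite rmorphM /= !ReC_norm normrM. Qed.

End complex_facts.

Section Cinfty_def.
Variables (R : realType) (d : nat).
Implicit Types f g : 'rV[R]_d -> R[i].

Definition vanishing_at_infinity f :=
  forall e : R, 0 < e ->
    exists2 K : set 'rV[R]_d, compact K & forall x, ~ K x -> `|f x| < e%:C.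

Definition Cinfty_pred : {pred 'rV[R]_d -> R[i]} :=
  [pred f | `[< continuous f /\ vanishing_at_infinity f >]].

Lemma Cinfty_submod_closed : GRing.submod_closed Cinfty_pred.
Proof.
split=> [|a f g /asboolP[cf vf] /asboolP[cg vg]]; apply/asboolP; split.
- exact: (@cst_continuous 'rV[R]_d R[i] 0).
- by move=> e e0; exists set0 => [|x _]; [exact: compact0|rewrite normr0 ltcR].
- by move=> x; exact: (cvgD (cvgZl_tmp (cf x)) (cg x)).
- move=> e e0; have a0 := Re_norm_ge0 a.
  have h0 : 0 < e / 2 / (Re `|a| + 1) by rewrite !divr_gt0// ltr_wpDl.
  have [K1 cK1 fK1] := vf _ h0.
  have h2 : 0 < e / 2 by rewrite divr_gt0.
  have [K2 cK2 fK2] := vg _ h2.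
  exists (K1 `|` K2); first exact: compactU.
  move=> x nK; rewrite normC_ltE.
  have /fK1 : ~ K1 x by move=> ?; apply: nK; left.
  have /fK2 : ~ K2 x by move=> ?; apply: nK; right.
  rewrite !normC_ltE => g2 f2.
  apply: (le_lt_trans (Re_normD _ _)); rewrite [e]splitr ltr_leD// ?ltW//.
  rewrite Re_normM; apply: (@le_lt_trans _ _ ((Re `|a| + 1) * Re `|f x|)).
    by rewrite ler_wpM2r ?Re_norm_ge0// lerDl.
  by rewrite mulrC -ltr_pdivlMr// ltr_wpDl.
Qed.

HB.instance Definition _ :=
  GRing.isSubmodClosed.Build R[i] ('rV[R]_d -> R[i]) Cinfty_pred
    Cinfty_submod_closed.

(** The complex space C_oo(R^d). *)
Record Cinfty := MkCinfty {
  Cinfty_fun :> 'rV[R]_d -> R[i];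
  Cinfty_funP : Cinfty_fun \in Cinfty_pred }.

HB.instance Definition _ := [isSub for Cinfty_fun].
HB.instance Definition _ := [Choice of Cinfty by <:].
HB.instance Definition _ := [SubChoice_isSubLmodule of Cinfty by <:].

End Cinfty_def.

Section Cinfty_norm.
Variables (R : realType) (d : nat).
Implicit Types f g : Cinfty R d.

Lemma Cinfty_continuous f : continuous f.
Proof. by have /asboolP[] := Cinfty_funP f. Qed.

Lemma Cinfty_vanishing f : vanishing_at_infinity f.
Proof. by have /asboolP[] := Cinfty_funP f. Qed.

Definition supnorm f : R := sup (range (fun x => Re `|f x|)).

Let Re_norm_dist (z w : R[i]) : `|Re `|z| - Re `|w| | <= Re `|z - w|.
Proof.
rewrite ler_norml lerBlDr lerNl opprB lerBlDr; apply/andP; split.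
  by have := Re_normD (w - z) z; rewrite subrK distrC.
by have := Re_normD (z - w) w; rewrite subrK.
Qed.

Lemma Cinfty_has_sup f : has_sup (range (fun x => Re `|f x|)).
Proof.
split; first by exists (Re `|f 0|), 0.
have [K cK fK] := Cinfty_vanishing f ltr01.
have : compact ((fun x => Re `|f x|) @` K).
  apply: continuous_compact => //; apply: continuous_subspaceT => x.
  apply/(@cvgrPdist_lt _ _ _ (nbhs (x : 'rV[R]_d))) => e e0; near=> y.
  have : `|f x - f y| < e%:C.
    by near: y; apply: cvgr_dist_lt; [exact: Cinfty_continuous|rewrite ltcR].
  by rewrite normC_ltE; apply: le_lt_trans; exact: Re_norm_dist.
move=> /compact_bounded[M [Mr HM]].
have {}HM x : K x -> Re `|f x| <= M + 1.
  move=> Kx; apply: (le_trans (ler_norm _)); apply: (HM (M + 1)).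
    by rewrite ltrDl.
  by exists x.
exists (Num.max (M + 1) 1) => _ [x _ <-]; rewrite le_max.
have [Kx|/fK] := pselect (K x); first by rewrite HM.
by rewrite normC_ltE => /ltW ->; rewrite orbT.
Unshelve. all: by end_near. Qed.

Lemma supnorm_ge f x : Re `|f x| <= supnorm f.
Proof. by apply: sup_ubound; [exact: (Cinfty_has_sup f).2|exists x]. Qed.

Lemma supnorm_le f (M : R) : (forall x, Re `|f x| <= M) -> supnorm f <= M.
Proof.
move=> H; apply: ge_sup; first exact: (Cinfty_has_sup f).1.
by move=> _ [x _ <-].
Qed.

Lemma supnorm_ge0 f : 0 <= supnorm f.
Proof. exact: le_trans (Re_norm_ge0 _) (supnorm_ge f 0). Qed.

Let norm f : R[i] := (supnorm f)%:C.

Let ler_normD f g : norm (f + g) <= norm f + norm g.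
Proof.
rewrite /norm -rmorphD /= lecR; apply: supnorm_le => x.
by apply: (le_trans (Re_normD _ _)); rewrite lerD// supnorm_ge.
Qed.

Let supnormZ_le (a : R[i]) f : supnorm (a *: f) <= Re `|a| * supnorm f.
Proof.
apply: supnorm_le => x; rewrite [(a *: f) x]/(a * f x) Re_normM.
by rewrite ler_wpM2l ?Re_norm_ge0// supnorm_ge.
Qed.

Let normrZ (a : R[i]) f : norm (a *: f) = `|a| * norm f.
Proof.
rewrite /norm -(ReC_norm a) -rmorphM; congr (_%:C).
apply/eqP; rewrite eq_le supnormZ_le andTb.
have [a0|a0] := eqVneq a 0.
  have -> : `|a| = 0 by apply/eqP; rewrite normr_eq0 a0.
  by rewrite mul0r supnorm_ge0.
have na0 : 0 < Re `|a| by rewrite -ltcR ReC_norm normr_gt0.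
rewrite mulrC -ler_pdivlMr// mulrC.
have -> : (Re `|a|)^-1 = Re `|a^-1|.
  by apply: complexI; rewrite fmorphV /= !ReC_norm normfV.
apply: le_trans (supnormZ_le a^-1 (a *: f)).
by rewrite scalerA mulVf// scale1r.
Qed.

Let normr0_eq0 f : norm f = 0 -> f = 0.
Proof.
move=> [f0]; apply/val_inj/funext => x /=.
have : Re `|f x| <= 0 by rewrite -f0 supnorm_ge.
rewrite -lecR ReC_norm normr_le0 => /eqP ->.
by [].
Qed.

HB.instance Definition _ :=
  Lmodule_isNormed.Build R[i] (Cinfty R d) ler_normD normrZ normr0_eq0.

Lemma Cinfty_normE f : `|f| = (supnorm f)%:C.
Proof. by []. Qed.

End Cinfty_norm.

Section Cinfty_complete.
Variables (R : realType) (d : nat).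
Local Notation X := (Cinfty R d).

Let Re_le_norm (z : R[i]) : `|Re z| <= Re `|z|.
Proof. by rewrite -lecR ReC_norm normc_ge_Re. Qed.

Let Im_le_norm (z : R[i]) : `|Im z| <= Re `|z|.
Proof.
case: z => a b; rewrite normc_def [Im _]/= [Re _%:C]/= -sqrtr_sqr ler_sqrt.
  by rewrite lerDr sqr_ge0.
by rewrite addr_ge0// sqr_ge0.
Qed.

Let norm_le_ReIm (z : R[i]) : Re `|z| <= `|Re z| + `|Im z|.
Proof.
case: z => a b; rewrite normc_def [Re _%:C]/= [Im _]/= [Re (_ +i* _)]/=.
rewrite -[leRHS]ger0_norm ?addr_ge0// -sqrtr_sqr ler_sqrt ?sqr_ge0//.
by rewrite sqrrD addrAC !real_normK ?num_real// lerDl mulrn_wge0// mulr_ge0.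
Qed.

Lemma Cinfty_cauchy_cvg (F : set_system X) :
  ProperFilter F -> cauchy F -> cvg F.
Proof.
move=> FF /cauchy_ballP Fc.
have {}Fc (e : R) : 0 < e ->
    \forall f \near F, \forall g \near F, forall x, Re `|(f : X) x - (g : X) x| < e.
  move=> e0; have e0' : 0 < e%:C by rewrite ltcR.
  apply: nearP_dep; apply: filterS (Fc _ e0') => -[f g] /=.
  rewrite -ball_normE /ball_ /= Cinfty_normE ltcR => fg x.
  exact: le_lt_trans (supnorm_ge (f - g) x) fg.
have cvgR (p : R[i] -> R) (pB : forall z w, p (z - w) = p z - p w)
    (ple : forall z, `|p z| <= Re `|z|) x :
    exists l : R, p ((f : X) x) @[f --> F] --> l.
  apply/cvg_ex; apply: R_complete.
  apply/cauchy_ballP => e e0.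
  have [f Ff] : exists f : X, \forall g \near F, forall x, Re `|f x - (g : X) x| < e / 2.
    by apply: (@filter_ex _ F) => //; apply: Fc; rewrite divr_gt0.
  exists (ball (p (f x)) (e / 2), ball (p (f x)) (e / 2)).
    split; apply: filterS Ff => g /(_ x) fg;
    by rewrite /= /ball /= -pB (le_lt_trans (ple _)).
  move=> [u v] /= [fu fv]; rewrite [e]splitr.
  by apply: ball_triangle fv; exact: ball_sym.
have /choice[lr lrE] := cvgR (@Re R) (fun z w => raddfB (@Re R) z w) Re_le_norm.
have /choice[li liE] := cvgR (@Im R) (fun z w => raddfB (@Im R) z w) Im_le_norm.
pose l x := lr x +i* li x.
have lE (e : R) : 0 < e -> \forall f \near F, forall x, Re `|(f : X) x - l x| <= e.
  move=> e0; have e20 : 0 < e / 2 by rewrite divr_gt0.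
  have e40 : 0 < e / 2 / 2 by rewrite divr_gt0.
  apply: filterS (Fc _ e20) => f Ff x; near F => g.
  rewrite -(subrK (g x) (f x)) -addrA (le_trans (Re_normD _ _))//.
  rewrite [leRHS]splitr lerD//; first by apply: ltW; near: g; exact: filterS Ff.
  rewrite (le_trans (norm_le_ReIm _))// [leRHS]splitr lerD//.
    rewrite (raddfB (@Re R)) distrC; near: g.
    by have /cvgrPdist_le := lrE x; exact.
  rewrite (raddfB (@Im R)) distrC; near: g.
  by have /cvgrPdist_le := liE x; exact.
have lP : l \in @Cinfty_pred R d.
  apply/asboolP; split.
    move=> x; apply/(@cvgrPdist_lt _ R[i] _ (nbhs (x : 'rV[R]_d))) => _ /gt0_RReP[e e0 ->].
    have e40 : 0 < e / 2 / 2 by rewrite !divr_gt0.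
    have [f fl] := filter_ex (lE _ e40); near=> y; rewrite normC_ltE.
    have -> : l x - l y = (l x - f x) + (f x - f y) + (f y - l y).
      by rewrite -!addrA !addKr.
    rewrite (le_lt_trans (Re_normD _ _))// [e]splitr ltr_leD//; last first.
      by rewrite (le_trans (fl y))// [leRHS]splitr lerDl ltW.
    rewrite (le_lt_trans (Re_normD _ _))// [e / 2]splitr ler_ltD//.
      by rewrite distrC fl.
    rewrite -normC_ltE; near: y; apply: cvgr_dist_lt; last by rewrite ltcR.
    exact: Cinfty_continuous.
  move=> e e0; have e20 : 0 < e / 2 by rewrite divr_gt0.
  have [f fl] := filter_ex (lE _ e20).
  have [K cK fK] := Cinfty_vanishing f e20.
  exists K => // x /fK; rewrite !normC_ltE => fx.
  rewrite -(subrK (f x) (l x)) (le_lt_trans (Re_normD _ _))//.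
  by rewrite [e]splitr ler_ltD// distrC fl.
apply/cvg_ex; exists (MkCinfty lP).
apply/cvgrPdist_le => _ /gt0_RReP[e e0 ->].
apply: filterS (lE _ e0) => f fl.
rewrite Cinfty_normE lecR; apply: supnorm_le => x.
by rewrite distrC; exact: fl.
Unshelve. all: by end_near. Qed.

HB.instance Definition _ := Uniform_isComplete.Build (Cinfty R d) Cinfty_cauchy_cvg.

End Cinfty_complete.

Definition measure_rV_display (disp : measure_display) : measure_display.
Proof. exact: disp. Qed.

(** Coordinate sigma-algebra on R^n; for real coordinates it is the Borel one. *)
Section measurable_rV.
Context {disp : measure_display} {T : sigmaRingType disp}.
Variable n : nat.

Let coord (i : 'I_n) (x : 'rV[T]_n) : T := x ord0 i.

Let rV_set0 : g_sigma_preimage coord set0.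
Proof. exact: sigma_algebra0. Qed.

Let rV_setC A : g_sigma_preimage coord A -> g_sigma_preimage coord (~` A).
Proof. exact: sigma_algebraC. Qed.

Let rV_bigcup (F : _^nat) : (forall i, g_sigma_preimage coord (F i)) ->
  g_sigma_preimage coord (\bigcup_i (F i)).
Proof. exact: sigma_algebra_bigcup. Qed.

HB.instance Definition _ := @isMeasurable.Build (measure_rV_display disp)
  'rV[T]_n (g_sigma_preimage coord) rV_set0 rV_setC rV_bigcup.

End measurable_rV.

Section measurable_fun_rV.
Context {d1 d2 : measure_display} {T1 : measurableType d1}
  {T2 : measurableType d2}.

Lemma measurable_coord n (i : 'I_n) :
  measurable_fun [set: 'rV[T2]_n] (fun x => x ord0 i).
Proof.
move=> _ Y mY; rewrite setTI; apply: sub_sigma_algebra => /=.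
rewrite -bigcup_seq/=; exists i => /=; first by rewrite mem_index_enum.
by exists Y => //; rewrite setTI.
Qed.

Lemma measurable_fun_coordP n (f : T1 -> 'rV[T2]_n) :
  (forall i, measurable_fun [set: T1] (fun x => f x ord0 i)) ->
  measurable_fun [set: T1] f.
Proof.
move=> mf _ A mA.
suff : g_sigma_preimage (fun i => (fun x : 'rV[T2]_n => x ord0 i) \o f)
    `<=` measurable.
  by rewrite g_sigma_preimage_comp; apply; exists A.
apply: smallest_sub; first exact: sigma_algebra_measurable.
case: n => [|n] in f mf A mA *; first by rewrite big_ord0.
rewrite -bigcup_mkord_ord; apply: bigcup_sub => i Ii.
by move=> B [C mC <-]; exact: mf.
Qed.

End measurable_fun_rV.

Section lebesgue_rV.
Context {R : realType}.

Definition rV_cons n (z : measurableTypeR R * 'rV[R]_n) : 'rV[R]_n.+1 :=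
  \row_i oapp (z.2 ord0) z.1 (unlift ord0 i).

Definition rV_uncons n (x : 'rV[R]_n.+1) : measurableTypeR R * 'rV[R]_n :=
  (x ord0 ord0, \row_j x ord0 (lift ord0 j)).

Lemma rV_consK n : cancel (@rV_cons n) (@rV_uncons n).
Proof.
case=> a x; rewrite /rV_uncons mxE unlift_none; congr pair.
by apply/rowP => j; rewrite !mxE liftK.
Qed.

Lemma rV_unconsK n : cancel (@rV_uncons n) (@rV_cons n).
Proof.
move=> x; apply/rowP => i; rewrite mxE.
by case: unliftP => [j|] -> //=; rewrite mxE.
Qed.

Lemma measurable_rV_uncons n : measurable_fun setT (@rV_uncons n).
Proof.
apply/measurable_fun_pair.
  exact: (@measurable_coord _ R).
apply: measurable_fun_coordP => i.
rewrite (_ : (fun _ => _) = (fun x : 'rV[R]_n.+1 => x ord0 (lift ord0 i))).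
  exact: measurable_coord.
by apply/funext => x; rewrite mxE.
Qed.

Lemma measurable_rV_cons n : measurable_fun setT (@rV_cons n).
Proof.
apply: measurable_fun_coordP => i.
case: (unliftP ord0 i) => [j ij|i0].
  rewrite (_ : (fun _ => _) = (fun x : 'rV[R]_n => x ord0 j) \o snd).
    exact: measurableT_comp (measurable_coord j) _.
  by apply/funext => z; rewrite mxE ij liftK.
rewrite (_ : (fun _ => _) = fst)//.
by apply/funext => z; rewrite mxE i0 unlift_none.
Qed.

Section step.
Variables (n : nat) (mu : {sigma_finite_measure set 'rV[R]_n -> \bar R}).

Definition lebesgue_rV_step : set 'rV[R]_n.+1 -> \bar R :=
  pushforward (lebesgue_measure \x mu)%E (@rV_cons n).

Let step0 : lebesgue_rV_step set0 = 0%E.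
Proof. by rewrite /lebesgue_rV_step /pushforward preimage_set0 measure0. Qed.

Let step_ge0 A : (0 <= lebesgue_rV_step A)%E.
Proof. exact: (measure_ge0 (lebesgue_measure \x mu)%E). Qed.

Let step_sigma_additive : semi_sigma_additive lebesgue_rV_step.
Proof.
move=> F mF tF mUF; rewrite /lebesgue_rV_step /pushforward preimage_bigcup.
apply: measure_semi_sigma_additive.
- by move=> k; rewrite -[X in measurable X]setTI; exact: measurable_rV_cons.
- apply/trivIsetP => /= i j _ _ ij; rewrite -preimage_setI.
  by move/trivIsetP : tF => /(_ _ _ _ _ ij) ->//; rewrite preimage_set0.
- rewrite -preimage_bigcup -[X in measurable X]setTI.
  exact: measurable_rV_cons.
Qed.

HB.instance Definition _ := isMeasure.Build _ _ _ lebesgue_rV_step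
  step0 step_ge0 step_sigma_additive.

Let step_sigma_finite : sigma_finite setT lebesgue_rV_step.
Proof.
have /sigma_finiteP[F [TF ndF Foo]] := sigma_finiteT (@lebesgue_measure R).
have /sigma_finiteP[G [TG ndG Goo]] := sigma_finiteT mu.
exists (fun k => @rV_uncons n @^-1` (F k `*` G k)).
  apply/esym; rewrite -subTset => x _.
  have [i _ Fi] : (\bigcup_i F i) (rV_uncons x).1 by rewrite -TF.
  have [j _ Gj] : (\bigcup_i G i) (rV_uncons x).2 by rewrite -TG.
  exists (maxn i j) => //; split.
  - by move: Fi; exact/subsetPset/ndF/leq_maxl.
  - by move: Gj; exact/subsetPset/ndG/leq_maxr.
move=> k; have [? ?] := Foo k; have [? ?] := Goo k; split.
  rewrite -[X in measurable X]setTI; apply: measurable_rV_uncons => //.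
  exact: measurableX.
rewrite /lebesgue_rV_step /pushforward -comp_preimage.
rewrite (_ : _ \o _ = id); last by apply/funext => z /=; rewrite rV_consK.
by rewrite preimage_id product_measure1E// lte_mul_pinfty// ge0_fin_numE.
Qed.

HB.instance Definition _ := Measure_isSigmaFinite.Build _ _ _ lebesgue_rV_step
  step_sigma_finite.

End step.

(** Lebesgue measure on R^n, as the n-fold product of the one on R. *)
Fixpoint lebesgue_rV (n : nat) : {sigma_finite_measure set 'rV[R]_n -> \bar R} :=
  if n is m.+1 return {sigma_finite_measure set 'rV[R]_n -> \bar R}
  then lebesgue_rV_step (lebesgue_rV m) else \d_(0 : 'rV[R]_0).

End lebesgue_rV.

Section unbounded_operators.
Context {R : realType} {X : completeNormedModType R[i]}.

(** A possibly unbounded operator A on X is represented by its graph, the set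
    of the pairs (f, A f) with f in D(A). *)
Implicit Types (A : set (X * X)) (D : set X) (F T : R -> X -> X).

Definition operator_domain A : set X := [set f | exists g, A (f, g)].

Definition operator_restrict A D : set (X * X) := [set z | A z /\ D z.1].

Definition closable A :=
  forall f g h, closure A (f, g) -> closure A (f, h) -> g = h.

Definition operator_core A D :=
  D `<=` operator_domain A /\ closure (operator_restrict A D) = A.

Definition linear_subspace D :=
  D 0 /\ forall (a : R[i]) f g, D f -> D g -> D (a *: f + g).

Definition bounded_operator (B : X -> X) :=
  linear B /\ exists M : R, forall f, `|B f| <= M%:C * `|f|.

Definition strongly_continuous_semigroup T :=
  [/\ forall t, 0 <= t -> bounded_operator (T t),
      T 0 = id,
      forall s t, 0 <= s -> 0 <= t -> T (s + t) = T s \o T t &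
      forall f, T t f @[t --> 0^'+] --> f].

Definition derivative_at_zero F : set (X * X) :=
  [set z | (t^-1)%:C *: (F t z.1 - F 0 z.1) @[t --> 0^'+] --> z.2].

Definition generator T : set (X * X) :=
  [set z | (t^-1)%:C *: (T t z.1 - z.1) @[t --> 0^'+] --> z.2].

Definition chernoff_equivalent F T :=
  [/\ forall t, 0 <= t -> bounded_operator (F t),
      forall f, {within `[0, +oo[, continuous (fun t => F t f)},
      F 0 = id,
      exists2 a : R, 0 <= a &
        forall t, 0 <= t -> forall f, `|F t f| <= (expR (a * t))%:C * `|f| &
      exists D : set X,
        [/\ linear_subspace D,
            D `<=` operator_domain (derivative_at_zero F),
            closable (operator_restrict (derivative_at_zero F) D) &
            closure (operator_restrict (derivative_at_zero F) D)
              = generator T]].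

End unbounded_operators.

Section complex_calculus.
Context {R : realType}.

Definition expC (z : R[i]) : R[i] :=
  (expR (Re z))%:C * (cos (Im z) +i* sin (Im z)).

Definition Cintegral (disp : measure_display) (T : measurableType disp)
    (mu : {measure set T -> \bar R}) (D : set T) (f : T -> R[i]) : R[i] :=
  Rintegral mu D (fun x => Re (f x)) +i* Rintegral mu D (fun x => Im (f x)).

End complex_calculus.

Section pseudo_differential.
Context {R : realType} {d : nat}.
Local Notation Rd := 'rV[R]_d.

Definition dotp (x y : Rd) : R := \sum_(i < d) x ord0 i * y ord0 i.

(** Squared Euclidean norm (the library norm on row vectors is the max norm). *)
Definition sqnorm (x : Rd) : R := dotp x x.

Fixpoint Ck (k : nat) (f : Rd -> R) : Prop :=
  if k is k'.+1 then
    continuous f /\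
    forall i : 'I_d, (forall x, derivable f x (delta_mx ord0 i)) /\
                     Ck k' (fun x => 'D_(delta_mx ord0 i) f x)
  else continuous f.

Definition Cc_smooth (phi : Rd -> R[i]) :=
  (forall k, Ck k (fun x => Re (phi x)) /\ Ck k (fun x => Im (phi x))) /\
  compact (closure [set x | phi x != 0]).

Definition fourier_const : R[i] := ((2 * pi) `^ (- (d%:R / 2)))%:C.

Definition fourier (f : Rd -> R[i]) (p : Rd) : R[i] :=
  fourier_const * Cintegral (lebesgue_rV d) setT
    (fun q => expC (- ('i%C * (dotp p q)%:C)) * f q).

(** The pseudo-differential operator with symbol [H], applied to [phi]. *)
Definition pdo (H : Rd -> Rd -> R[i]) (phi : Rd -> R[i]) (q : Rd) : R[i] :=
  fourier_const * Cintegral (lebesgue_rV d) setT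
    (fun p => expC ('i%C * (dotp p q)%:C) * H q p * fourier phi p).

(** [N] is a measure on R^d, of which only the restriction to R^d \ {0}
    is used. *)
Definition continuous_negative_definite (psi : Rd -> R[i]) :=
  exists (a : R) (l : Rd) (Q : 'M[R]_d) (N : {measure set Rd -> \bar R}),
    [/\ 0 <= a,
        Q^T = Q /\ (forall x : Rd, 0 <= dotp x (x *m Q)),
        (forall K : set Rd, compact K -> K `<=` [set y | y != 0] ->
           (N K < +oo)%E),
        (\int[N]_(y in [set y | y != 0%R])
           (sqnorm y / (1 + sqnorm y))%:E < +oo)%E &
        forall p, psi p =
          a%:C + 'i%C * (dotp l p)%:C + (dotp p (p *m Q))%:C +
          Cintegral N [set y | y != 0]
            (fun y => 1 - expC ('i%C * (dotp y p)%:C)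
                      + 'i%C * (dotp y p / (1 + sqnorm y))%:C)].

Definition Ccinfty : set (Cinfty R d) := [set f | Cc_smooth f].

(** Graph of -H(.,D) as an operator on C_oo(R^d) with domain C_c^oo(R^d). *)
Definition opp_pdo_graph (H : Rd -> Rd -> R[i]) :
    set (Cinfty R d * Cinfty R d) :=
  [set z : Cinfty R d * Cinfty R d |
    Ccinfty z.1 /\ forall q, z.2 q = - pdo H z.1 q].

(** [B] is an extension to a linear contraction on C_oo(R^d) of the
    pseudo-differential operator with symbol [H] on C_c^oo(R^d). *)
Definition contraction_extension (H : Rd -> Rd -> R[i])
    (B : Cinfty R d -> Cinfty R d) :=
  [/\ linear B,
      forall f, `|B f| <= `|f| &
      forall phi, Ccinfty phi -> forall q, B phi q = pdo H phi q].

End pseudo_differential.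

(* Main.v *)
Require Import Defs.
From HB Require Import structures.
From mathcomp Require Import all_boot all_order all_algebra complex.
From mathcomp Require Import all_classical all_reals all_analysis.
From mathcomp Require Import measurable_realfun ring lra.
Import Order.TTheory GRing.Theory Num.Theory.
Import numFieldNormedType.Exports.
Local Open Scope classical_set_scope.
Local Open Scope ring_scope.
Local Open Scope complex_scope.

(** For a test function phi, the bounds |e^-tH - 1 + tH| <= 4 t^2 |H|^2 (valid
    as Re H >= 0) and |H(q,p)| <= kappa (1 + |p|^2), together with the fast decay
    of the Fourier transform of phi and Fourier inversion, give
    |F(t) phi - phi + t H(.,D) phi| <= C t^2 uniformly in q. Hence F'(0) coincides
    with -H(.,D) on the space D of the test functions phi such that H(.,D) phi is
    in C_oo, and the closure of this restriction is the generator A of T. In the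
    same way t |-> F(t) phi is Lipschitz, and strong continuity follows since D,
    whose graph is dense in the one of A, is dense.

    The product formula is Chernoff's theorem. With A_h = (F(h) - 1) / h and
    J_h = (1 - A_h)^-1, the core hypothesis gives J_h -> (1 - A)^-1 strongly. For f
    in D(A^2), u(s) = J_h T_s (f - A f) stays close to T_s f and satisfies
    |u(s+h) - F(h) u(s)| = o(h), so that telescoping along s = 0, h, 2h, ... yields
    F(h)^n f -> T_t f for h = t / n; the general case follows by density. *)

Set Implicit Arguments.
Unset Strict Implicit.
Unset Printing Implicit Defensive.

(** * The product formula *)

(** Neither a vector-valued integral nor the resolvent of [T] is constructed: means of orbits are
    limits of Riemann sums, and [(1 - A)^-1] is only applied to vectors [v - g] with [(v, g)] in the
    graph of the generator. The definition of a semigroup gives no growth bound, so a bound on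
    compact time intervals is first extracted from completeness. On the other side, the contraction
    property of [F] makes [J_h] a contraction. All Fourier integrals are reduced to real cosine
    integrals with a phase: a shift by [pi / 2] turns cosine into sine, so that one real identity
    serves for both parts of a complex one. The summation weight is a product of exponentials
    [exp (- |p_i|)] rather than a Gaussian, because its transform is an elementary product of Cauchy
    densities, and this product is also the standard integrable majorant. The square in [|H|^2]
    fixes the decay asked of the transform of [phi]: two powers of [1 + |p|^2] for the symbol and
    [n] more for the majorant. *)

Section real_norm.
Context {R : realType} {X : completeNormedModType R[i]}.
Implicit Types (x y : X) (a : R).

(** The norm takes its values in [R[i]]; its real part carries the same information and lives in the
    ordered field [R]. *)
Definition nrm x : R := complex.Re `|x|.

Lemma nrmE x : `|x| = (nrm x)%:C.
Proof.
have := normr_ge0 x; rewrite /nrm; case: `|x| => u v.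
by rewrite lecE /= => /andP[/eqP -> _].
Qed.

Lemma nrm_ge0 x : 0 <= nrm x.
Proof. by rewrite -lecR -nrmE; exact: normr_ge0. Qed.

Lemma nrm0 : nrm 0 = 0.
Proof. by rewrite /nrm normr0. Qed.

Lemma nrmN x : nrm (- x) = nrm x.
Proof. by rewrite /nrm normrN. Qed.

Lemma nrmBC x y : nrm (x - y) = nrm (y - x).
Proof. by rewrite /nrm distrC. Qed.

Lemma nrmD x y : nrm (x + y) <= nrm x + nrm y.
Proof. by rewrite -lecR rmorphD /= -!nrmE ler_normD. Qed.

Lemma nrmB x y : nrm (x - y) <= nrm x + nrm y.
Proof. by rewrite -(nrmN y) nrmD. Qed.

Lemma nrm_tri y x z : nrm (x - z) <= nrm (x - y) + nrm (y - z).
Proof. by apply: le_trans (nrmD _ _); rewrite addrA subrK. Qed.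

Lemma nrmZ a x : nrm (a%:C *: x) = `|a| * nrm x.
Proof.
apply: complexI; rewrite -nrmE normrZ rmorphM /= -nrmE; congr (_ * _).
by rewrite normc_def /= expr0n /= addr0 sqrtr_sqr.
Qed.

Lemma nrm_sum (I : Type) (r : seq I) (P : pred I) (f : I -> X) :
  nrm (\sum_(i <- r | P i) f i) <= \sum_(i <- r | P i) nrm (f i).
Proof.
elim/big_ind2 : _ => [|x a y b xa yb|//]; first by rewrite nrm0.
by rewrite (le_trans (nrmD _ _))// lerD.
Qed.

Lemma nrm0_eq0 x : nrm x = 0 -> x = 0.
Proof. by move=> x0; apply/normr0_eq0; rewrite nrmE x0. Qed.

Lemma nrm_cvgP (T : Type) (F : set_system T) (u : T -> X) x : Filter F ->
  (u @ F --> x) <-> (forall e, 0 < e -> \forall t \near F, nrm (x - u t) < e).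
Proof.
move=> FF; split=> [/cvgrPdist_lt ux e e0|ux].
  have /ux : 0 < e%:C by rewrite ltcR.
  by apply: filterS => t; rewrite nrmE ltcR.
apply/cvgrPdist_lt => _ /gt0_RReP[e e0 ->].
by apply: filterS (ux e e0) => t; rewrite nrmE ltcR.
Qed.

Lemma nrm_nbhsP x (A : set X) :
  nbhs x A <-> exists2 e, 0 < e & forall y, nrm (x - y) < e -> A y.
Proof.
split=> [/nbhs_ballP[_ /gt0_RReP[e e0 ->] xA]|[e e0 xA]].
  by exists e => // y xy; apply: xA; rewrite -ball_normE /ball_ /= nrmE ltcR.
apply/nbhs_ballP; exists e%:C; first by rewrite /= ltcR.
by move=> y; rewrite -ball_normE /ball_ /= nrmE ltcR; exact: xA.
Qed.

Lemma nrm_cauchy_cvg (u : nat -> X) :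
  (forall e, 0 < e -> exists N, forall m n, (N <= m)%N -> (N <= n)%N ->
     nrm (u m - u n) < e) -> exists x, u @ \oo --> x.
Proof.
move=> cu; apply/cvg_ex; apply: cauchy_cvg; apply: cauchy_exP.
move=> _ /gt0_RReP[e e0 ->]; have [N uN] := cu e e0.
exists (u N); exists N => // n /= Nn.
by rewrite -ball_normE /ball_ /= nrmE ltcR uN.
Qed.

Lemma nrm_cvg_le (T : Type) (F : set_system T) (u : T -> X) x y (c : R) :
  ProperFilter F -> u @ F --> x ->
  (\forall t \near F, nrm (u t - y) <= c) -> nrm (x - y) <= c.
Proof.
move=> FF /nrm_cvgP ux uc; apply/ler_addgt0Pl => e e0.
have [t [xt tc]] := filter_ex (filterI (ux e e0) uc).
by rewrite (le_trans (nrm_tri (u t) _ _))// lerD// ltW.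
Qed.

Lemma nrm_cvg_unique (T : Type) (F : set_system T) (u : T -> X) x y :
  ProperFilter F -> u @ F --> x -> u @ F --> y -> x = y.
Proof.
move=> FF ux /nrm_cvgP uy; apply/eqP; rewrite -subr_eq0; apply/eqP/nrm0_eq0.
apply/eqP; rewrite eq_le nrm_ge0 andbT; apply/ler_addgt0Pl => e e0.
rewrite addr0; apply: (nrm_cvg_le _ ux).
by apply: filterS (uy e e0) => t; rewrite nrmBC => /ltW.
Qed.

Lemma nrm_closureP (A : set (X * X)) x y : closure A (x, y) <->
  forall e, 0 < e -> exists x' y', [/\ A (x', y'), nrm (x - x') < e & nrm (y - y') < e].
Proof.
split=> [cA e e0|cA B].
  have /cA[[x' y'] [Az [/= xx yy]]] : nbhs (x, y)
      ([set z | nrm (x - z.1) < e /\ nrm (y - z.2) < e]).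
    exists ([set z | nrm (x - z) < e], [set z | nrm (y - z) < e]) => //=.
    by split; apply/nrm_nbhsP; exists e.
  by exists x', y'.
move=> [[U V] /= [/nrm_nbhsP[e e0 xU] /nrm_nbhsP[e' e'0 yV]] UVB].
have [|x' [y' [Az xx yy]]] := cA (Num.min e e'); first by rewrite lt_min e0.
exists (x', y'); split => //; apply: UVB; split => /=.
  by apply: xU; rewrite (lt_le_trans xx)// ge_min lexx.
by apply: yV; rewrite (lt_le_trans yy)// ge_min lexx orbT.
Qed.

Lemma near0P (P : R -> Prop) : (\forall t \near 0^'+, P t) <->
  exists2 d : R, 0 < d & forall t, 0 < t -> t < d -> P t.
Proof.
split=> [[d /= d0 dP]|[d d0 dP]].
  exists d => // t t0 td; apply: dP => //; rewrite /ball_ /=.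
  by rewrite sub0r normrN gtr0_norm.
exists d => //= t; rewrite /ball /= sub0r normrN => td t0; apply: dP => //.
exact: le_lt_trans (ler_norm _) td.
Qed.

End real_norm.

Section linear_maps.
Context {R : realType} {X : completeNormedModType R[i]}.
Variables (B : X -> X) (lB : linear B).

Let pB : {linear X -> X} := HB.pack B (GRing.isLinear.Build _ _ _ _ _ lB).

Lemma lin0 : B 0 = 0. Proof. exact: (linear0 pB). Qed.
Lemma linD x y : B (x + y) = B x + B y. Proof. exact: (linearD pB). Qed.
Lemma linB x y : B (x - y) = B x - B y. Proof. exact: (linearB pB). Qed.
Lemma linZ a x : B (a *: x) = a *: B x. Proof. exact: (linearZ_LR pB). Qed.

Lemma lin_sum (I : Type) (r : seq I) (P : pred I) (f : I -> X) :
  B (\sum_(i <- r | P i) f i) = \sum_(i <- r | P i) B (f i).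
Proof. exact: (linear_sum pB). Qed.

End linear_maps.

(** * Strongly continuous semigroups: local bounds, orbits and generator *)

Section semigroup.
Context {R : realType} {X : completeNormedModType R[i]}.
Variables (T : R -> X -> X) (hT : strongly_continuous_semigroup T).

Lemma sg_lin t : 0 <= t -> linear (T t).
Proof. by case: hT => + _ _ _ t0 => /(_ t t0)[]. Qed.

Lemma sg0 f : T 0 f = f.
Proof. by case: hT => _ ->. Qed.

Lemma sgD s t f : 0 <= s -> 0 <= t -> T (s + t) f = T s (T t f).
Proof. by case: hT => _ _ + _ s0 t0 => /(_ s t s0 t0) ->. Qed.

Lemma sg_bounded t : 0 <= t ->
  exists2 K : R, 0 <= K & forall f, nrm (T t f) <= K * nrm f.
Proof.
case: hT => + _ _ _ t0 => /(_ t t0)[_ [M TM]].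
exists `|M| => // f; apply: (@le_trans _ _ (M * nrm f)).
  by have := TM f; rewrite !nrmE -rmorphM /= lecR.
by rewrite ler_wpM2r ?nrm_ge0// ler_norm.
Qed.

Lemma sg_right0 f e : 0 < e -> exists2 d : R, 0 < d &
  forall t : R, 0 <= t -> t < d -> nrm (T t f - f) < e.
Proof.
case: hT => _ _ _ /(_ f)/nrm_cvgP + e0 => /(_ e e0)/near0P[d d0 dT].
exists d => // t; rewrite le_eqVlt => /predU1P[<- _|t0 td].
  by rewrite sg0 subrr nrm0.
by rewrite nrmBC dT.
Qed.

(* Otherwise there are nested balls with [n <= nrm (T t_n y)] on the n-th one and
   [t_n <= 1 / (n + 1)]; their common point contradicts continuity at 0. *)
Lemma sg_locally_bounded0 : exists d M : R, [/\ 0 < d, 0 <= M &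
  forall t : R, 0 <= t -> t <= d -> forall f, nrm (T t f) <= M * nrm f].
Proof.
apply/not_existsP => noM.
have step (z : nat * (X * R)) : exists z' : X * R, 0 < z.2.2 ->
    [/\ 0 < z'.2, z'.2 <= z.2.2 / 2, nrm (z.2.1 - z'.1) <= z.2.2 / 2 &
    exists t : R, [/\ 0 <= t, t <= z.1.+1%:R^-1 &
      forall y, nrm (z'.1 - y) <= z'.2 -> z.1%:R <= nrm (T t y)]].
  case: z => n [x r] /=.
  have [r0|] := ltP 0 r; last by exists (x, r).
  (* The refuted constant is such that the offending vector, rescaled to norm [r / 2], is sent to
     norm above [n + 1]. *)
  have M0 : 0 <= n.+1%:R * 2 / r by rewrite divr_ge0// ?mulr_ge0// ltW.
  have [t [f [t0 td tf]]] : exists t f,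
      [/\ 0 <= t, t <= n.+1%:R^-1 & n.+1%:R * 2 / r * nrm f < nrm (T t f)].
    apply: contrapT => no; apply: (noM n.+1%:R^-1); exists (n.+1%:R * 2 / r).
    split => // t t0 td f.
    rewrite leNgt; apply/negP => tf; apply: no.
    by exists t, f.
  have f0 : 0 < nrm f.
    rewrite lt_neqAle nrm_ge0 andbT; apply/eqP => /esym f0.
    by move: tf; rewrite f0 (nrm0_eq0 f0) (lin0 (sg_lin t0)) nrm0 mulr0 ltxx.
  pose z := (r / 2 / nrm f)%:C *: f.
  have zr : nrm z = r / 2.
    by rewrite nrmZ ger0_norm ?divfK ?gt_eqF// !divr_ge0// ltW.
  have Tz : n.+1%:R < nrm (T t z).
    rewrite (linZ (sg_lin t0)) nrmZ ger0_norm; last by rewrite !divr_ge0// ltW.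
    have := tf; rewrite -(ltr_pM2l (x := r / 2 / nrm f)) ?divr_gt0//.
    congr (_ < _); field.
    by rewrite !gt_eqF.
  have [K K0 TK] := sg_bounded t0.
  (* As [2 z] is the difference of [x + z] and [x - z], at least one of these two points is sent to
     norm above [n + 1]. *)
  have [x' xx' Tx'] : exists2 x', nrm (x - x') = r / 2 & n.+1%:R < nrm (T t x').
    have [Tp|Tp] := ltP n.+1%:R (nrm (T t (x + z))).
      by exists (x + z) => //; rewrite opprD addrA subrr sub0r nrmN.
    exists (x - z); first by rewrite opprB addrC subrK.
    rewrite ltNge; apply/negP => Tm.
    have : nrm (T t (x + z) - T t (x - z)) <= n.+1%:R + n.+1%:R.
      by rewrite (le_trans (nrmB _ _))// lerD.
    rewrite -(linB (sg_lin t0)) opprB [z - x]addrC addrACA subrr add0r -mulr2n -scaler_nat.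
    rewrite -(rmorph_nat (real_complex R)) (linZ (sg_lin t0)) nrmZ normr_nat.
    by apply/negP; rewrite -ltNge mulr_natl mulr2n ltrD.
  (* Radius [r / 2] keeps the new ball inside the old one; within radius [1 / (K + 1)] the values of
     [T t] vary by at most 1, which lowers [n + 1] to [n]. *)
  exists (x', Num.min (r / 2) (K + 1)^-1); split => //=.
  - by rewrite lt_min divr_gt0//= invr_gt0 ltr_wpDl.
  - by rewrite ge_min lexx.
  - by rewrite xx'.
  exists t; split => // y; rewrite le_min => /andP[_ yK].
  have : nrm (T t (x' - y)) <= 1.
    rewrite (le_trans (TK _))// (@le_trans _ _ ((K + 1) * nrm (x' - y)))//.
      by rewrite ler_wpM2r ?nrm_ge0// lerDl.
    by rewrite -ler_pdivlMl ?mulr1// ltr_wpDl.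
  rewrite (linB (sg_lin t0)) => Ty.
  have := nrm_tri (T t y) (T t x') 0; rewrite !subr0 => TT.
  have := lt_le_trans Tx' (le_trans TT (lerD Ty (lexx _))).
  by rewrite -natr1 addrC ltrD2l => /ltW.
have [g gP] := choice step.
pose fix ar n := if n is p.+1 then g (p, ar p) else (0 : X, 1 : R).
have r0 n : 0 < (ar n).2.
  elim: n => //= n IH; by have [] := gP (n, ar n) IH.
have rn n : (ar n).2 <= (1 / 2) ^+ n.
  elim: n => [|n IH]; first by rewrite expr0.
  have [_ /= rr _ _] := gP (n, ar n) (r0 n).
  by rewrite exprSr (le_trans rr)// mulrA mulr1 ler_wpM2r ?invr_ge0.
have xx n k : nrm ((ar n).1 - (ar (k + n)%N).1) + (ar (k + n)%N).2 <= (ar n).2.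
  elim: k => [|k IH]; first by rewrite add0n subrr nrm0 add0r.
  have [_ /= rr xr _] := gP ((k + n)%N, ar (k + n)%N) (r0 (k + n)%N).
  apply: le_trans IH.
  have := nrm_tri (ar (k + n)%N).1 (ar n).1 (g ((k + n)%N, ar (k + n)%N)).1.
  lra.
have xr n m : (n <= m)%N -> nrm ((ar n).1 - (ar m).1) <= (ar n).2.
  by move=> nm; have := xx n (m - n)%N; rewrite subnK//; have := r0 m; lra.
have [e e0|x xl] := @nrm_cauchy_cvg _ X (fun n => (ar n).1).
  have [N _ NP] : \forall n \near \oo, (1 / 2 : R) ^+ n < e / 2.
    have h : `|1 / 2 : R| < 1 by rewrite ger0_norm; lra.
    have e20 : 0 < e / 2 by rewrite divr_gt0.
    have /cvgrPdist_lt/(_ _ e20) := cvg_expr h.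
    by apply: filterS => n; rewrite sub0r normrN ger0_norm// exprn_ge0; lra.
  exists N => m n Nm Nn; rewrite (le_lt_trans (nrm_tri (ar N).1 _ _))//.
  have := xr _ _ Nm; have := xr _ _ Nn; rewrite (nrmBC (ar m).1).
  by have := rn N; have := NP N (leqnn _); rewrite /=; lra.
have xb n : nrm ((ar n).1 - x) <= (ar n).2.
  rewrite nrmBC; apply: (nrm_cvg_le _ xl).
  by exists n => // m /= nm; rewrite nrmBC xr.
have [d d0 dT] := sg_right0 x ltr01.
(* For this [n] the time [t_n] lies where [T t x] stays within 1 of [x], whereas [n] exceeds
   [nrm x + 1]. *)
have [n [nx nd]] : exists n, nrm x + 1 < n%:R /\ n.+1%:R^-1 < d.
  exists (Num.truncn (nrm x + 1 + d^-1)).+1.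
  have h := truncnS_gt (nrm x + 1 + d^-1).
  have d1 : 0 < d^-1 by rewrite invr_gt0.
  split; first by lra.
  rewrite -[X in _ < X]invrK ltf_pV2 ?posrE//.
  by rewrite -natr1; have := nrm_ge0 x; lra.
have [_ _ _ [t [t0 td tn]]] := gP (n, ar n) (r0 n).
have := tn x (xb n.+1); have := dT t t0 (le_lt_trans td nd).
by have := nrm_tri x (T t x) 0; rewrite !subr0 /=; lra.
Qed.

(** The bound near 0 propagates by the semigroup law, one step of length [d] at a time. *)
Lemma sg_locally_bounded t0 : exists2 M : R, 0 <= M &
  forall t : R, 0 <= t -> t <= t0 -> forall f, nrm (T t f) <= M * nrm f.
Proof.
have [d [M [d0 M0 TM]]] := sg_locally_bounded0.
suff [N NP] : exists N : nat, t0 <= N%:R * d.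
  elim: N t0 NP => [|N IH] t0 t0N.
    exists 1 => // t ht t1 f.
    have -> : t = 0 by move: t0N; rewrite mul0r; lra.
    by rewrite sg0 mul1r.
  have [M' M'0 TM'] := IH (N%:R * d) (lexx _).
  exists (M * M' + M'); first by rewrite addr_ge0// mulr_ge0.
  move=> t ht t1 f; have [tN|tN] := leP t (N%:R * d).
    rewrite (le_trans (TM' _ ht tN _))// ler_wpM2r ?nrm_ge0// lerDr.
    by rewrite mulr_ge0.
  have Nd : 0 <= N%:R * d by rewrite mulr_ge0// ltW.
  have -> : t = (t - N%:R * d) + N%:R * d by rewrite subrK.
  rewrite sgD//; last by lra.
  rewrite (le_trans (TM _ _ _ _))//; first by lra.
    by move: t0N; rewrite -natr1; lra.
  rewrite (@le_trans _ _ (M * (M' * nrm f)))// ?ler_wpM2l// ?TM'//.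
  by rewrite mulrA ler_wpM2r ?nrm_ge0// lerDl.
exists (Num.truncn (t0 / d)).+1; rewrite -ler_pdivrMr//.
exact/ltW/truncnS_gt.
Qed.

(** Since [T s f - T t f = T s (f - T (t - s) f)] for [s <= t], the local bound reduces uniform
    continuity to continuity at 0. *)
Lemma sg_unif_cont f t0 e : 0 < e -> exists2 d : R, 0 < d &
  forall s t, 0 <= s -> s <= t0 -> 0 <= t -> t <= t0 -> `|s - t| < d ->
    nrm (T s f - T t f) < e.
Proof.
move=> e0; have [M M0 TM] := sg_locally_bounded t0.
have [|d d0 dT] := @sg_right0 f (e / (M + 1)).
  by rewrite divr_gt0// ltr_wpDl.
exists d => //.
suff wl s t : 0 <= s -> s <= t -> t <= t0 -> t - s < d ->
    nrm (T s f - T t f) < e.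
  move=> s t s0 st tt tt0; have [st'|st'] := leP s t.
    by rewrite ler0_norm ?subr_le0// opprB; exact: wl.
  by rewrite ger0_norm ?subr_ge0 1?ltW// nrmBC => ?; apply: wl => //; exact: ltW.
move=> s0 st tt std.
have -> : t = s + (t - s) by rewrite addrC subrK.
rewrite sgD ?subr_ge0// -(linB (sg_lin s0)).
rewrite (le_lt_trans (TM _ _ _ _))// ?(le_trans st)// nrmBC.
rewrite (@le_lt_trans _ _ ((M + 1) * nrm (T (t - s) f - f)))//.
  by rewrite ler_wpM2r ?nrm_ge0// lerDl.
by rewrite -ltr_pdivlMl ?ltr_wpDl// mulrC dT ?subr_ge0.
Qed.

(** Clearing the denominator turns the limit of difference quotients into an [o(t)] estimate, which
    bounded linear maps transport. The criterion makes sense for any family and is applied to [F] as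
    well. *)
Lemma genP f g : generator T (f, g) <-> forall e, 0 < e ->
  exists2 d : R, 0 < d & forall t, 0 < t -> t < d ->
    nrm (T t f - f - t%:C *: g) <= e * t.
Proof.
have key t : 0 < t -> t%:C *: (g - (t^-1)%:C *: (T t f - f)) =
    - (T t f - f - t%:C *: g).
  move=> t0; rewrite scalerBr scalerA -rmorphM /= divff ?gt_eqF// scale1r.
  by rewrite [in RHS]opprB.
split=> [/nrm_cvgP gg e e0|gg].
  have /near0P[d d0 dP] := gg e e0; exists d => // t t0 td.
  have := dP _ t0 td => /ltW; rewrite -(ler_pM2l t0) -{1}(gtr0_norm t0) -nrmZ.
  by rewrite key// nrmN mulrC.
apply/nrm_cvgP => e e0; apply/near0P.
have e20 : 0 < e / 2 by rewrite divr_gt0.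
have [d d0 dP] := gg _ e20; exists d => // t t0 td.
rewrite -(ltr_pM2l t0) -{1}(gtr0_norm t0) -nrmZ /= key// nrmN.
rewrite (le_lt_trans (dP _ t0 td))// mulrC ltr_pM2l//; lra.
Qed.

Lemma gen_sg f g s : 0 <= s -> generator T (f, g) ->
  generator T (T s f, T s g).
Proof.
move=> s0 /genP fg; apply/genP => e e0.
have [K K0 TK] := sg_bounded s0.
have [|d d0 dP] := fg (e / (K + 1)); first by rewrite divr_gt0// ltr_wpDl.
exists d => // t t0 td.
rewrite -(sgD _ (ltW t0) s0) (addrC t) sgD ?(ltW t0)// -(linZ (sg_lin s0)).
rewrite -!(linB (sg_lin s0)) (le_trans (TK _))//.
rewrite (@le_trans _ _ ((K + 1) * nrm (T t f - f - t%:C *: g)))//.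
  by rewrite ler_wpM2r ?nrm_ge0// lerDl.
by rewrite -ler_pdivlMl ?ltr_wpDl// mulrA (mulrC _ e) dP.
Qed.

Lemma gen_lin (a : R) f g f' g' : generator T (f, g) -> generator T (f', g') ->
  generator T (a%:C *: f + f', a%:C *: g + g').
Proof.
move=> /genP fg /genP fg'; apply/genP => e e0.
have a0 : 0 < `|a| + 1 by rewrite ltr_wpDl.
have [|d d0 dP] := fg (e / 2 / (`|a| + 1)); first by rewrite !divr_gt0.
have [|d' d'0 dP'] := fg' (e / 2); first by rewrite !divr_gt0.
exists (Num.min d d'); first by rewrite lt_min d0.
move=> t t0; rewrite lt_min => /andP[td td'].
have -> : T t (a%:C *: f + f') - (a%:C *: f + f') - t%:C *: (a%:C *: g + g') =
   a%:C *: (T t f - f - t%:C *: g) + (T t f' - f' - t%:C *: g').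
  rewrite (linD (sg_lin (ltW t0))) (linZ (sg_lin (ltW t0))).
  rewrite !scalerBr scalerDr !opprD !scalerA (mulrC t%:C) !addrA.
  by rewrite [LHS](ACl (1*3*5*2*4*6)).
rewrite (le_trans (nrmD _ _))// nrmZ.
have := dP t t0 td; have := dP' t t0 td' => h1 h2.
have : `|a| * nrm (T t f - f - t%:C *: g) <= e / 2 * t.
  rewrite (@le_trans _ _ ((`|a| + 1) * nrm (T t f - f - t%:C *: g)))//.
    by rewrite ler_wpM2r ?nrm_ge0// lerDl.
  by rewrite -ler_pdivlMl// mulrA (mulrC _ (e / 2)).
move: h1; set u := nrm _; set v := _ * nrm _; move=> h1 h3.
have -> : e * t = e / 2 * t + e / 2 * t by field.
exact: lerD.
Qed.

End semigroup.

(** * Density of the domain of the generator and of its square *)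

Section semigroup_density.
Context {R : realType} {X : completeNormedModType R[i]}.
Variables (T : R -> X -> X) (hT : strongly_continuous_semigroup T).

Let avg (N : nat) (a : nat -> X) : X :=
  (N%:R^-1)%:C *: \sum_(0 <= k < N) a k.

Lemma avg_le (N : nat) (a : nat -> X) (c : R) : (0 < N)%N ->
  (forall k, (k < N)%N -> nrm (a k) <= c) -> nrm (avg N a) <= c.
Proof.
move=> N0 ac; have N0' : 0 < N%:R :> R by rewrite ltr0n.
rewrite nrmZ ger0_norm ?invr_ge0// ler_pdivrMl//.
rewrite (le_trans (nrm_sum _ _ _))// big_mkord mulr_natl.
apply: (@le_trans _ _ (\sum_(i < N) c)); first by apply: ler_sum => i _; exact: ac.
by rewrite sumr_const card_ord.
Qed.

Lemma avg_cst (N : nat) x : (0 < N)%N -> avg N (fun=> x) = x.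
Proof.
move=> N0; rewrite /avg big_mkord sumr_const card_ord -[x *+ N]scaler_nat.
rewrite -[N%:R in X in _ *: X](rmorph_nat (real_complex R)) scalerA -rmorphM /= mulVf ?scale1r//.
by rewrite pnatr_eq0 -lt0n.
Qed.

Lemma avgB (N : nat) a b : avg N (fun k => a k - b k) = avg N a - avg N b.
Proof. by rewrite /avg sumrB scalerBr. Qed.

(** Discrete form of the exchange that replaces the integral over [[i, i + N]] minus the one over
    [[0, N]] by the integral over [[N, N + i]] minus the one over [[0, i]]. *)
Lemma shifted_sum (a : nat -> X) N i :
  \sum_(0 <= k < N) a (k + i)%N - \sum_(0 <= k < N) a k =
  \sum_(0 <= k < i) (a (k + N)%N - a k).
Proof.
elim: N => [|N IH].
  rewrite [X in X - _]big_geq// [X in _ - X]big_geq// subrr big1// => k _.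
  by rewrite addn0 subrr.
rewrite !big_nat_recr//= opprD addrACA IH (addnC N i).
have -> : a (i + N)%N - a N = \sum_(0 <= k < i) (a (k + N).+1 - a (k + N)%N).
  by rewrite (@telescope_sumr _ 0 i (fun k => a (k + N)%N)).
rewrite -big_split /=; apply: eq_bigr => k _.
by rewrite addnS addrC addrA subrK.
Qed.

Let mean tau f N := avg N (fun k => T (k%:R * (tau / N%:R)) f).

(** The refined mean splits into [N] blocks; the [i]-th one is [T (i tau / N)] applied to a mean of
    [T s f] over [s <= tau / N], which is within [c] of [f]. *)
Lemma mean_refine tau f N M K c : 0 < tau -> (0 < N)%N -> (0 < M)%N ->
  0 <= K -> (forall t, 0 <= t -> t <= tau -> forall x, nrm (T t x) <= K * nrm x) ->
  (forall s, 0 <= s -> s <= tau / N%:R -> nrm (T s f - f) <= c) ->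
  nrm (mean tau f (N * M) - mean tau f N) <= K * c.
Proof.
move=> tau0 N0 M0 K0 TK Tc.
have N0' : 0 < N%:R :> R by rewrite ltr0n.
have M0' : 0 < M%:R :> R by rewrite ltr0n.
have pos k : 0 <= k%:R * (tau / N%:R) by rewrite mulr_ge0// divr_ge0 ?ltW.
have pos' k : 0 <= k%:R * (tau / (N * M)%:R).
  by rewrite mulr_ge0// divr_ge0// ltW.
have -> : mean tau f (N * M) = avg N (fun i => T (i%:R * (tau / N%:R))
    (avg M (fun j => T (j%:R * (tau / (N * M)%:R)) f))).
  rewrite /mean /avg big_nat_mul.
  have -> : ((N * M)%:R^-1)%:C = (N%:R^-1)%:C * (M%:R^-1)%:C :> R[i].
    by rewrite natrM invfM rmorphM.
  rewrite -scalerA scaler_sumr.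
  congr (_ *: _); apply: eq_bigr => i _.
  rewrite (linZ (sg_lin hT (pos i))) (lin_sum (sg_lin hT (pos i))).
  congr (_ *: _); rewrite mulSn addnC -{1}[(i * M)%N]add0n big_addn addKn.
  apply: eq_bigr => j _; rewrite -(sgD hT)//; congr (T _ f).
  rewrite natrD !natrM; field.
  by rewrite !gt_eqF.
rewrite /mean -avgB; apply: avg_le => // i iN.
rewrite -(linB (sg_lin hT (pos i))) (le_trans (TK _ _ _ _))//.
  rewrite mulrA ler_pdivrMr// mulrC ler_wpM2l ?(ltW tau0)//.
  by rewrite ler_nat ltnW.
rewrite ler_wpM2l// -{2}[f](@avg_cst M)// -avgB; apply: avg_le => // j jM.
apply: Tc => //.
have -> : j%:R * (tau / (N * M)%:R) = tau / N%:R * (j%:R / M%:R).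
  by rewrite natrM; field; rewrite !gt_eqF.
rewrite ler_piMr ?divr_ge0 ?(ltW tau0)//.
by rewrite ler_pdivrMr// mul1r ler_nat ltnW.
Qed.

(* [V] is the mean of [T s f] over [0, tau], as a limit of Riemann sums. *)
Lemma sg_average f tau : 0 < tau -> exists2 V,
  generator T (V, (tau^-1)%:C *: (T tau f - f)) &
  forall c, (forall s, 0 <= s -> s <= tau -> nrm (T s f - f) <= c) ->
    nrm (V - f) <= c.
Proof.
move=> tau0; have [K K0 TK] := sg_locally_bounded hT tau.
have posh N : 0 <= tau / N%:R by rewrite divr_ge0// ltW.
have [e e0|V VP] := @nrm_cauchy_cvg _ _ (fun n => mean tau f n.+1).
  have [|d d0 dT] := @sg_right0 _ _ _ hT f (e / 4 / (K + 1)).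
    by rewrite !divr_gt0// ltr_wpDl.
  exists (Num.truncn (tau / d)).
  suff key n m : (Num.truncn (tau / d) <= n)%N ->
      nrm (mean tau f (n.+1 * m.+1) - mean tau f n.+1) <= e / 4.
    (* Two means are compared through their common refinement. *)
    move=> m n Nm Nn; rewrite (le_lt_trans (nrm_tri (mean tau f (n.+1 * m.+1)) _ _))//.
    have := key _ m Nn; have := key _ n Nm.
    by rewrite [in nrm (mean _ _ m.+1 - _)]nrmBC mulnC; lra.
  move=> Nn; rewrite (@le_trans _ _ (K * (e / 4 / (K + 1))))//; last first.
    rewrite mulrA ler_pdivrMr ?ltr_wpDl// mulrC ler_wpM2l ?divr_ge0 1?ltW//.
    by rewrite ltrDl.
  apply: mean_refine => // s s0 sn; apply/ltW/dT => //.
  rewrite (le_lt_trans sn)// ltr_pdivrMr// mulrC -ltr_pdivrMr//.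
  by rewrite (lt_le_trans (truncnS_gt _))// ler_nat.
have meanc c n : (forall s, 0 <= s -> s <= tau -> nrm (T s f - f) <= c) ->
    nrm (mean tau f n.+1 - f) <= c.
  move=> Tc; rewrite -[X in _ - X](@avg_cst n.+1)// -avgB.
  apply: avg_le => // k kn; apply: Tc; first by rewrite mulr_ge0.
  by rewrite mulrA ler_pdivrMr// mulrC ler_wpM2l ?(ltW tau0)// ler_nat ltnW.
exists V; last first.
  by move=> c Tc; apply: (nrm_cvg_le _ VP); exists 0%N => // n _; exact: meanc.
pose g := T tau f - f.
(* For [s = i h] on the grid, [shifted_sum] writes the increment of the Riemann sum as [1 / N] times
   the sum of the [T (k h) g], [k < i], each within [eta] of [g]. A general [s] is rounded down to
   the grid. *)
have key s eta : 0 < s -> s < tau ->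
    (forall t, 0 <= t -> t <= s -> nrm (T t g - g) <= eta) ->
    nrm (T s V - V - (s / tau)%:C *: g) <= s / tau * eta.
  move=> s0 st geta; apply/ler_addgt0Pr => e e0.
  have e40 : 0 < e / 4 by rewrite divr_gt0.
  have [d d0 dT] := @sg_unif_cont _ _ _ hT V tau _ e40.
  have [N [N0 Nd NV Ng]] : exists N, [/\ (0 < N)%N, tau / N%:R < d,
      (K + 1) * nrm (V - mean tau f N) < e / 4 & nrm g / N%:R < e / 4].
    have e' : 0 < e / 4 / (K + 1) by rewrite !divr_gt0// ltr_wpDl.
    have /nrm_cvgP/(_ _ e')[n0 _ n0P] := VP.
    pose n1 := Num.truncn (tau / d); pose n2 := Num.truncn (nrm g / (e / 4)).
    exists (n0 + n1 + n2).+1; split => //.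
    - rewrite ltr_pdivrMr// mulrC -ltr_pdivrMr// (lt_le_trans (truncnS_gt _))//.
      by rewrite ler_nat ltnS -/n1 addnAC leq_addl.
    - rewrite -ltr_pdivlMl ?ltr_wpDl// mulrC; apply: n0P => /=.
      by rewrite -addnA leq_addr.
    - rewrite ltr_pdivrMr// mulrC -ltr_pdivrMr ?divr_gt0//.
      by rewrite (lt_le_trans (truncnS_gt _))// ler_nat ltnS -/n2 leq_addl.
  have N0' : 0 < N%:R :> R by rewrite ltr0n.
  pose i := Num.truncn (s * N%:R / tau); pose h := tau / N%:R.
  have h0 : 0 < h by rewrite divr_gt0.
  have sN0 : 0 <= s * N%:R / tau by rewrite divr_ge0 ?mulr_ge0// ltW.
  have ile : i%:R <= s * N%:R / tau by rewrite truncn_le.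
  have igt : s * N%:R / tau < i%:R + 1 by rewrite natr1 truncnS_gt.
  have sh : s * N%:R / tau = s / h.
    by rewrite /h; field; rewrite !gt_eqF.
  have ihs : i%:R * h <= s by rewrite -ler_pdivlMr// -sh.
  have sih : s - i%:R * h < h.
    by rewrite ltrBlDr -{1}[h]mul1r -mulrDl -ltr_pdivrMr// -sh addrC.
  have ih0 : 0 <= i%:R * h by rewrite mulr_ge0// ltW.
  pose x := T (i%:R * h) (mean tau f N) - mean tau f N - (i%:R / N%:R)%:C *: g.
  have xle : nrm x <= s / tau * eta.
    have eta0 : 0 <= eta by apply: le_trans (geta 0 _ _); rewrite ?nrm_ge0// ltW.
    have -> : x = (N%:R^-1)%:C *: \sum_(0 <= k < i) (T (k%:R * h) g - g).
      rewrite /x /mean /avg (linZ (sg_lin hT ih0)) (lin_sum (sg_lin hT ih0)).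
      rewrite -scalerBr [i%:R / _]mulrC rmorphM /= -scalerA -scalerBr; congr (_ *: _).
      rewrite (eq_bigr (fun k => T ((k + i)%N%:R * h) f)); last first.
        move=> k _; rewrite -(sgD hT)//; last by rewrite mulr_ge0// ltW.
        by rewrite natrD mulrDl addrC.
      rewrite (shifted_sum (fun k => T (k%:R * h) f)) [in RHS]sumrB; congr (_ - _).
        apply: eq_bigr => k _; have k0 : 0 <= k%:R * h by rewrite mulr_ge0// ltW.
        rewrite /g (linB (sg_lin hT k0)) -(sgD hT)//; last exact: ltW.
        congr (T _ f - _); rewrite natrD mulrDl; congr (_ + _).
        by rewrite /h mulrC divfK ?gt_eqF.
      by rewrite big_mkord sumr_const card_ord (rmorph_nat (real_complex R)) scaler_nat.
    rewrite nrmZ ger0_norm ?invr_ge0// ler_pdivrMl//.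
    rewrite (le_trans (nrm_sum _ _ _))// big_mkord.
    apply: (@le_trans _ _ (\sum_(k < i) eta)).
      apply: ler_sum => k _; apply: geta; first by rewrite mulr_ge0// ltW.
      by rewrite (le_trans _ ihs)// ler_wpM2r ?(ltW h0)// ler_nat ltnW.
    rewrite sumr_const card_ord -[eta *+ i]mulr_natl mulrA ler_wpM2r//.
    by rewrite (le_trans ile)// mulrCA mulrA.
  (* Besides [x] there are four errors, of total at most [3 e / 4]: rounding [s] in the orbit of
     [V], replacing [V] by a Riemann sum twice, and rounding [s / tau]. *)
  have -> : T s V - V - (s / tau)%:C *: g =
      ((T s V - T (i%:R * h) V) + T (i%:R * h) (V - mean tau f N)) - (V - mean tau f N)
      - (s / tau - i%:R / N%:R)%:C *: g + x.
    rewrite (linB (sg_lin hT ih0)) rmorphB /= scalerBl /x !opprB !addrA !subrK.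
    by rewrite [RHS](ACl (1*4*6*(7*2)*(3*8)*(5*9)))/= !subrr !addr0.
  rewrite (le_trans (nrmD _ _))// addrC lerD// (le_trans (nrmB _ _))//.
  have h1 : nrm ((s / tau - i%:R / N%:R)%:C *: g) <= e / 4.
    rewrite nrmZ (le_trans _ (ltW Ng))// mulrC ler_wpM2l ?nrm_ge0//.
    have -> : s / tau - i%:R / N%:R = (s - i%:R * h) / tau.
      by rewrite /h; field; rewrite !gt_eqF.
    rewrite ger0_norm; last by rewrite divr_ge0 ?subr_ge0 ?(ltW tau0).
    by rewrite ler_pdivrMr// [_^-1 * _]mulrC ltW.
  have h2 : nrm (T s V - T (i%:R * h) V) <= e / 4.
    apply/ltW/dT => //; [exact: ltW|exact: ltW|by rewrite (le_trans ihs)// ltW|].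
    by rewrite ger0_norm ?subr_ge0// (lt_trans sih).
  have h3 : nrm (T (i%:R * h) (V - mean tau f N)) + nrm (V - mean tau f N) <= e / 4.
    apply: le_trans (ltW NV); rewrite mulrDl mul1r lerD2r TK//.
    by rewrite (le_trans ihs)// ltW.
  have := nrmB ((T s V - T (i%:R * h) V) + T (i%:R * h) (V - mean tau f N)) (V - mean tau f N).
  have := nrmD (T s V - T (i%:R * h) V) (T (i%:R * h) (V - mean tau f N)).
  by move: h1 h2 h3; lra.
apply/genP => e e0.
(* The tolerance [e * tau] compensates the factor [s / tau] in [key]. *)
have [|d d0 dT] := @sg_right0 _ _ _ hT g (e * tau); first by rewrite mulr_gt0.
exists (Num.min d tau); first by rewrite lt_min d0.
move=> t t0; rewrite lt_min => /andP[td ttau].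
have := key t (e * tau) t0 ttau; rewrite scalerA -rmorphM /=.
have -> : t / tau * (e * tau) = e * t by field; rewrite gt_eqF.
by apply=> s s0 st; apply/ltW/dT => //; rewrite (le_lt_trans st).
Qed.

Lemma gen0 : generator T (0, 0).
Proof.
apply/genP => e e0; exists 1 => // t t0 _.
by rewrite (lin0 (sg_lin hT (ltW t0))) scaler0 !subr0 nrm0 mulr_ge0 ?ltW.
Qed.

Lemma sg_average_near f e : 0 < e -> exists2 tau, 0 < tau &
  exists2 V, generator T (V, (tau^-1)%:C *: (T tau f - f)) & nrm (V - f) < e.
Proof.
move=> e0; have e20 : 0 < e / 2 by rewrite divr_gt0.
have [d d0 dT] := @sg_right0 _ _ _ hT f _ e20.
have d20 : 0 < d / 2 by rewrite divr_gt0.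
exists (d / 2) => //; have [V VT Vc] := sg_average f d20.
exists V => //; apply: (@le_lt_trans _ _ (e / 2)); last by lra.
by apply: Vc => s s0 sd; apply/ltW/dT => //; lra.
Qed.

Lemma gen_dense f e : 0 < e ->
  exists v g, generator T (v, g) /\ nrm (v - f) < e.
Proof. by move=> /(sg_average_near f)[tau _ [V VT Vf]]; exists V; eexists; split; eauto. Qed.

(** The average of an orbit starting at [f1] in the domain has image [(T tau f1 - f1) / tau], which
    is again in the domain. *)
Lemma gen2_dense f e : 0 < e ->
  exists v g k, [/\ generator T (v, g), generator T (g, k) & nrm (v - f) < e].
Proof.
move=> e0; have e20 : 0 < e / 2 by rewrite divr_gt0.
have [f1 [g1 [fg1 ff1]]] := gen_dense f e20.
have [tau tau0 [V VT Vf]] := sg_average_near f1 e20.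
exists V, ((tau^-1)%:C *: (T tau f1 - f1)), ((tau^-1)%:C *: (T tau g1 - g1)).
split => //; last by rewrite (le_lt_trans (nrm_tri f1 _ _))//; lra.
have := gen_lin (a := tau^-1) hT (gen_sg hT (ltW tau0) fg1)
  (gen_lin (a := - tau^-1) hT fg1 gen0).
by rewrite !addr0 rmorphN /= !scaleNr -!scalerBr.
Qed.

End semigroup_density.

(** * Chernoff's theorem for a family of contractions *)

Section chernoff.
Context {R : realType} {X : completeNormedModType R[i]}.
Variables (T : R -> X -> X) (hT : strongly_continuous_semigroup T).
Variables (F : R -> X -> X) (G : set (X * X)).
Hypothesis F_lin : forall t, 0 <= t -> linear (F t).
Hypothesis F_ctr : forall t, 0 <= t -> forall f, nrm (F t f) <= nrm f.
Hypothesis F_id : F 0 = id.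
Hypothesis G_deriv : forall v g, G (v, g) -> forall e : R, 0 < e ->
  exists2 d : R, 0 < d & forall t, 0 < t -> t < d ->
    nrm (F t v - v - t%:C *: g) <= e * t.
Hypothesis G_gen : closure G = generator T.

(* [u = (1 - A_h)^-1 w], where [A_h = (F h - 1) / h]. *)
Definition resolves (h : R) (u w : X) :=
  (1 + h)%:C *: u = F h u + h%:C *: w.

Lemma resolves_lin h (a : R) u w u' w' : 0 <= h ->
  resolves h u w -> resolves h u' w' ->
  resolves h (a%:C *: u + u') (a%:C *: w + w').
Proof.
move=> h0 uw uw'; rewrite /resolves (linD (F_lin h0)) (linZ (F_lin h0)).
rewrite !scalerDr uw' scalerA mulrC -scalerA uw scalerDr.
by rewrite !scalerA (mulrC a%:C) addrACA.
Qed.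

(** The contraction [F h] gives [(1 + h) nrm u <= nrm u + h nrm w], and [nrm u] cancels. *)
Lemma resolves_le h u w : 0 < h -> resolves h u w -> nrm u <= nrm w.
Proof.
move=> h0 uw; have : nrm ((1 + h)%:C *: u) <= nrm u + h * nrm w.
  rewrite uw (le_trans (nrmD _ _))// nrmZ gtr0_norm// lerD//.
  by rewrite F_ctr// ltW.
rewrite nrmZ ger0_norm ?addr_ge0 ?(ltW h0)// mulrDl mul1r lerD2l.
by rewrite ler_pM2l.
Qed.

Lemma resolvesB h u w u' w' : 0 < h -> resolves h u w -> resolves h u' w' ->
  nrm (u - u') <= nrm (w - w').
Proof.
move=> h0 uw uw'; have := resolves_lin (-1) (ltW h0) uw' uw.
rewrite rmorphN1 !scaleN1r addrC (addrC _ w) => /resolves_le; exact.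
Qed.

(** Banach's fixed point: [u = (F h u + h w) / (1 + h)] is an equation [u = S u] with [S]
    contracting by [q = 1 / (1 + h) < 1]. *)
Lemma resolvent_ex h w : 0 < h -> exists u, resolves h u w.
Proof.
move=> h0; pose q := (1 + h)^-1; have h1 : 0 < 1 + h by rewrite addr_gt0.
have q0 : 0 < q by rewrite invr_gt0.
have q1 : q < 1 by rewrite invf_lt1// ltrDl.
pose S u := q%:C *: (F h u + h%:C *: w); pose u n := iter n S 0.
have Sq x y : nrm (S x - S y) <= q * nrm (x - y).
  rewrite /S -scalerBr nrmZ (gtr0_norm q0) ler_pM2l// opprD addrACA subrr addr0.
  by rewrite -(linB (F_lin (ltW h0))) F_ctr// ltW.
have uw n : nrm (u n) <= nrm w.
  elim: n => [|n IH] /=; first by rewrite nrm0 nrm_ge0.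
  rewrite /S nrmZ (gtr0_norm q0) ler_pdivrMl// (le_trans (nrmD _ _))//.
  rewrite nrmZ (gtr0_norm h0) mulrDl mul1r lerD2r.
  by rewrite (le_trans (F_ctr (ltW h0) _)).
have uq n m k : nrm (u (k + n)%N - u (k + m)%N) <= q ^+ k * (2 * nrm w).
  elim: k => [|k IH].
    by rewrite expr0 mul1r (le_trans (nrmB _ _))// mulr_natl mulr2n lerD.
  by rewrite !addSn exprS (le_trans (Sq _ _))// -mulrA ler_pM2l.
have [e e0|x ux] := @nrm_cauchy_cvg _ X u.
  have w0 : 0 < 2 * nrm w + 1 by rewrite ltr_wpDl// mulr_ge0// nrm_ge0.
  have e' : 0 < e / (2 * nrm w + 1) by rewrite divr_gt0.
  have hq : `|q| < 1 by rewrite gtr0_norm.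
  have /cvgrPdist_lt/(_ _ e')[N _ NP] := cvg_expr hq.
  exists N => m n Nm Nn; rewrite -(subnKC Nm) -(subnKC Nn).
  rewrite (le_lt_trans (uq _ _ _))//.
  have := NP N (leqnn N); rewrite sub0r normrN ger0_norm ?exprn_ge0 ?(ltW q0)//.
  rewrite ltr_pdivlMr// => /le_lt_trans; apply.
  by rewrite ler_wpM2l ?exprn_ge0 ?(ltW q0)// lerDl.
exists x; apply/eqP; rewrite -subr_eq0; apply/eqP/nrm0_eq0/eqP.
rewrite eq_le nrm_ge0 andbT; apply/ler_addgt0Pr => e e0; rewrite add0r.
(* The residual of [x] is [(1 + h) (x - u_(N+1)) - F h (x - u_N)], whence the total factor
   [(1 + h) + 1]. *)
have e' : 0 < e / (2 + h) by rewrite divr_gt0// addr_gt0.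
have /nrm_cvgP/(_ _ e')[N _ NP] := ux.
have xN := NP N (leqnn N); have xN1 := NP N.+1 (leqnSn N).
have uN1 : (1 + h)%:C *: u N.+1 = F h (u N) + h%:C *: w.
  by rewrite /= /S scalerA -rmorphM /= mulfV ?gt_eqF// scale1r.
have -> : (1 + h)%:C *: x - (F h x + h%:C *: w) =
    (1 + h)%:C *: (x - u N.+1) - F h (x - u N).
  rewrite scalerBr uN1 (linB (F_lin (ltW h0))) -!addrA; congr (_ + _).
  by rewrite opprB !opprD !addrA [RHS](ACl (4*2*(1*3)))/= addNr addr0.
rewrite (le_trans (nrmB _ _))// nrmZ (gtr0_norm h1).
have := F_ctr (ltW h0) (x - u N) => FN.
apply: (@le_trans _ _ ((1 + h) * (e / (2 + h)) + e / (2 + h))).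
  by rewrite lerD//; [rewrite ler_pM2l// ltW|rewrite (le_trans FN)// ltW].
rewrite le_eqVlt; apply/orP; left; apply/eqP; field.
by rewrite gt_eqF// addr_gt0.
Qed.

(** The core hypothesis enters here. Approximate [(v, g)] by [(v', g')] in [G]; then [v'] solves the
    resolvent equation exactly for [v' - A_h v'], which is close to [v' - g'] and so to [v - g]. As
    [J_h] is a contraction, [u] is close to [v']. *)
Lemma resolvent_cvg v g e : generator T (v, g) -> 0 < e ->
  exists2 d : R, 0 < d & forall h u, 0 < h -> h < d ->
    resolves h u (v - g) -> nrm (u - v) <= e.
Proof.
rewrite -G_gen => /nrm_closureP vg e0.
have e40 : 0 < e / 4 by rewrite divr_gt0.
have [v' [g' [vg' vv gg]]] := vg _ e40.
have [d d0 dF] := G_deriv vg' e40; exists d => // h u h0 hd uvg.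
have rv : resolves h v' (v' - (h^-1)%:C *: (F h v' - v')).
  rewrite /resolves scalerBr scalerA -rmorphM /= mulfV ?gt_eqF// scale1r.
  rewrite opprB !addrA [RHS](ACl (3*2*(1*4)))/= subrr addr0.
  by rewrite rmorphD /= scalerDl scale1r.
have := resolvesB h0 uvg rv => uv.
rewrite (le_trans (nrm_tri v' _ _))// (nrmBC v').
have : nrm (v - g - (v' - (h^-1)%:C *: (F h v' - v'))) <= e / 4 + e / 4 + e / 4.
  have -> : v - g - (v' - (h^-1)%:C *: (F h v' - v')) =
     (v - v') - (g - g') + (h^-1)%:C *: (F h v' - v' - h%:C *: g').
    rewrite [in RHS]scalerBr [in RHS]scalerA -rmorphM /= mulVf ?gt_eqF// scale1r.
    rewrite !opprB !addrA [RHS](ACl (1*4*2*5*(3*6))) /= subrr addr0.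
    by rewrite [LHS](ACl (1*2*4*3)).
  rewrite (le_trans (nrmD _ _))// lerD//.
    by rewrite (le_trans (nrmB _ _))// lerD// ltW.
  rewrite nrmZ ger0_norm ?invr_ge0 ?(ltW h0)// ler_pdivrMl// mulrC.
  exact: dF.
by move: uv vv; lra.
Qed.

(** Uniformity in [s] is a compactness argument: one threshold serves for the finitely many points
    of a grid of mesh [r], and between them the orbits of [v] and [g] vary little while [J_h] is a
    contraction uniformly in [h]. *)
Lemma resolvent_cvg_orbit v g t0 e : generator T (v, g) -> 0 < e ->
  exists2 d : R, 0 < d & forall h u s, 0 < h -> h < d -> 0 <= s -> s <= t0 ->
    resolves h u (T s v - T s g) -> nrm (u - T s v) <= e.
Proof.
move=> vg e0; have e40 : 0 < e / 4 by rewrite divr_gt0.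
have [d1 d10 dv] := @sg_unif_cont _ _ _ hT v t0 _ e40.
have [d2 d20 dg] := @sg_unif_cont _ _ _ hT g t0 _ e40.
pose r := Num.min d1 d2 / 2.
have r0 : 0 < r by rewrite divr_gt0// lt_min d10.
have rd1 : r < d1.
  by rewrite ltr_pdivrMr// (le_lt_trans (y := d1))// ?ge_min ?lexx//; lra.
have rd2 : r < d2.
  by rewrite ltr_pdivrMr// (le_lt_trans (y := d2))// ?ge_min ?lexx ?orbT//; lra.
have [N NP] : exists N : nat, t0 / r < N%:R.
  by exists (Num.truncn (t0 / r)).+1; exact: truncnS_gt.
have [d d0 dP] : exists2 d : R, 0 < d & forall k h u, (k < N)%N -> 0 < h -> h < d ->
    resolves h u (T (k%:R * r) v - T (k%:R * r) g) -> nrm (u - T (k%:R * r) v) <= e / 4.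
  elim: N {NP} => [|N [d d0 IH]]; first by exists 1.
  have Nr : 0 <= N%:R * r by rewrite mulr_ge0// ltW.
  have [d' d'0 dP'] := resolvent_cvg (gen_sg hT Nr vg) e40.
  exists (Num.min d d'); first by rewrite lt_min d0.
  move=> k h u; rewrite ltnS leq_eqVlt => /predU1P[->|kN] h0;
    rewrite lt_min => /andP[hd hd']; first exact: dP'.
  exact: IH.
exists d => // h u s h0 hd s0 st uw.
have sr0 : 0 <= s / r by rewrite divr_ge0// ltW.
pose k := Num.truncn (s / r).
have krs : k%:R * r <= s by rewrite -ler_pdivlMr// truncn_le.
have skr : s - k%:R * r < r.
  rewrite ltrBlDr -{1}[r]mul1r -mulrDl -ltr_pdivrMr// addrC natr1.
  exact: truncnS_gt.
have kN : (k < N)%N.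
  rewrite -(ltr_nat R) (le_lt_trans _ NP)// ler_pdivlMr//.
  exact: le_trans st.
have kr0 : 0 <= k%:R * r by rewrite mulr_ge0// ltW.
have [u' uw'] := resolvent_ex (T (k%:R * r) v - T (k%:R * r) g) h0.
have uu := resolvesB h0 uw uw'.
have uk := dP _ _ _ kN h0 hd uw'.
have krt : k%:R * r <= t0 by rewrite (le_trans krs).
have sk : `|s - k%:R * r| < r by rewrite ger0_norm ?subr_ge0.
have hv := dv _ _ s0 st kr0 krt (lt_trans sk rd1).
have hg := dg _ _ s0 st kr0 krt (lt_trans sk rd2).
have hw : nrm (T s v - T s g - (T (k%:R * r) v - T (k%:R * r) g)) <= e / 4 + e / 4.
  have -> : T s v - T s g - (T (k%:R * r) v - T (k%:R * r) g) =
     T s v - T (k%:R * r) v - (T s g - T (k%:R * r) g).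
    by rewrite !opprB addrACA [RHS]addrACA [- T s g + _]addrC.
  by rewrite (le_trans (nrmB _ _))// lerD// ltW.
have := nrm_tri u' u (T s v); have := nrm_tri (T (k%:R * r) v) u' (T s v).
by move: hv; rewrite nrmBC; lra.
Qed.

(* For [f] in the domain of the square of the generator, [u s = J_h (T s (f - A f))]
   follows the orbit of [f] and is an approximate solution of the explicit
   scheme [u (s + h) = F h (u s)]. *)
Lemma chernoff_smooth f g k t0 e : 0 <= t0 -> 0 < e ->
  generator T (f, g) -> generator T (g, k) ->
  exists2 d : R, 0 < d & forall h n, 0 < h -> h < d -> n%:R * h <= t0 ->
    nrm (iter n (F h) f - T (n%:R * h) f) <= e.
Proof.
move=> t00 e0 fg gk; have [M M0 TM] := sg_locally_bounded hT t0.
(* The gaps between [u] and the orbit at both ends cost [eta / 3] each and the telescoping at most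
   [t0 * eta], which fits in [(t0 + 1) * eta = e / 3]. *)
pose eta := e / (3 * (t0 + 1)).
have t10 : 0 < t0 + 1 by rewrite ltr_wpDl.
have eta0 : 0 < eta by rewrite divr_gt0// mulr_gt0.
have eta3 : 0 < eta / 3 by rewrite divr_gt0.
have eta3M : 0 < eta / 3 / (M + 1) by rewrite divr_gt0// ltr_wpDl.
have [d1 d10 df] := resolvent_cvg_orbit t0 fg eta3.
have [d2 d20 dg] := resolvent_cvg_orbit t0 gk eta3.
(* This is the use of the square of the generator: [f - g] is itself in the domain, with image
   [g - k]. *)
have := gen_lin (a := -1) hT gk fg; rewrite rmorphN1 !scaleN1r addrC.
rewrite [- k + _]addrC => wgk; have /genP/(_ _ eta3M)[d3 d30 dw] := wgk.
exists (Num.min d1 (Num.min d2 d3)); first by rewrite !lt_min d10 d20.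
move=> h n h0; rewrite !lt_min => /and3P[hd1 hd2 hd3] nh.
have /choice[J JP] : forall w, exists u, resolves h u w.
  by move=> w; exact: resolvent_ex.
pose u s := J (T s (f - g)).
have uf s : 0 <= s -> s <= t0 -> nrm (u s - T s f) <= eta / 3.
  move=> s0 st; apply: (df h) => //.
  by rewrite -(linB (sg_lin hT s0)); exact: JP.
have step s : 0 <= s -> s <= t0 -> nrm (u (s + h) - F h (u s)) <= h * eta.
  move=> s0 st; pose w := f - g.
  have Fu : F h (u s) = u s + h%:C *: (u s - T s w).
    have := JP (T s w); rewrite /resolves -/(u s) rmorphD /= scalerDl scale1r => E.
    by rewrite scalerBr addrA E addrK.
  (* [z] approximates [T s g], the derivative of the orbit of [f] at time [s]. *)
  pose z := J (T s g - T s k).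
  have zg : nrm (z - T s g) <= eta / 3 by apply: (dg h) => //; exact: JP.
  (* By linearity this vector is [J_h] applied to [T s (T h w - w - h (g - k))], and [g - k] is the
     derivative at 0 of the orbit of [w]. *)
  have uz : nrm (u (s + h) - u s - h%:C *: z) <= h * (eta / 3).
    have r1 := resolves_lin (-1) (ltW h0) (JP (T s w)) (JP (T (s + h) w)).
    have r2 := resolves_lin (- h) (ltW h0) (JP (T s g - T s k)) r1.
    have := resolves_le h0 r2; rewrite !rmorphN /= !scaleNr !scale1r.
    rewrite addrC [- J _ + _]addrC => /le_trans; apply.
    rewrite addrC [- T s w + _]addrC -(linB (sg_lin hT s0)) (sgD hT _ s0 (ltW h0)).
    rewrite -(linB (sg_lin hT s0)) -(linZ (sg_lin hT s0)) -(linB (sg_lin hT s0)).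
    rewrite (le_trans (TM _ s0 st _))//.
    apply: (@le_trans _ _ (M * (eta / 3 / (M + 1) * h))).
      by rewrite ler_wpM2l// dw.
    have M1 : 0 < M + 1 by rewrite ltr_wpDl.
    have -> : M * (eta / 3 / (M + 1) * h) = h * (eta / 3) * (M / (M + 1)).
      by field; rewrite gt_eqF.
    rewrite ler_piMr//; first by rewrite mulr_ge0 ?(ltW h0)// ltW.
    by rewrite ler_pdivrMr// mul1r lerDl.
  have us := uf s s0 st.
  (* One step of [F h] adds [h (u s - T s w)], where [T s w = T s f - T s g]; it therefore differs
     from [h z] only through the two approximation errors already bounded. *)
  have -> : u (s + h) - F h (u s) = (u (s + h) - u s - h%:C *: z) +
      h%:C *: (z - T s g - (u s - T s f)).
    rewrite Fu /w (linB (sg_lin hT s0)) !scalerBr !(opprD, opprK) !addrA.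
    by rewrite [RHS](ACl (1*2*6*7*5*(3*4)))/= addNr addr0.
  rewrite (le_trans (nrmD _ _))// nrmZ (gtr0_norm h0).
  have : nrm (z - T s g - (u s - T s f)) <= eta / 3 + eta / 3.
    by rewrite (le_trans (nrmB _ _))// lerD.
  rewrite -(ler_pM2l h0) => hz.
  have -> : h * eta = h * (eta / 3) + h * (eta / 3 + eta / 3) by field.
  exact: lerD.
have Fiter m x y : nrm (iter m (F h) x - iter m (F h) y) <= nrm (x - y).
  elim: m => //= m IH; rewrite -(linB (F_lin (ltW h0))).
  by rewrite (le_trans (F_ctr (ltW h0) _)).
have tele m : (m <= n)%N -> nrm (u (m%:R * h) - iter m (F h) (u 0)) <= m%:R * h * eta.
  elim: m => [|m IH] mn; first by rewrite !mul0r subrr nrm0.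
  have mh0 : 0 <= m%:R * h by rewrite mulr_ge0// ltW.
  have mt : m%:R * h <= t0.
    by rewrite (le_trans _ nh)// ler_wpM2r ?(ltW h0)// ler_nat ltnW.
  have := IH (ltnW mn) => {}IH.
  rewrite -natr1 mulrDl mul1r iterS mulrDl.
  rewrite (le_trans (nrm_tri (F h (u (m%:R * h))) _ _))// addrC lerD ?step//.
  rewrite -(linB (F_lin (ltW h0))) (le_trans (F_ctr (ltW h0) _))//.
have nh0 : 0 <= n%:R * h by rewrite mulr_ge0// ltW.
have h1 := uf _ nh0 nh; have h2 := uf _ (lexx 0) t00.
rewrite (sg0 hT) nrmBC in h2.
have h3 := tele n (leqnn n); rewrite nrmBC in h3.
have h4 := Fiter n f (u 0).
have h5 : n%:R * h * eta <= t0 * eta by rewrite ler_wpM2r// ltW.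
have h6 : t0 * eta + eta = e / 3.
  by rewrite /eta; field; rewrite gt_eqF.
have := nrm_tri (iter n (F h) (u 0)) (iter n (F h) f) (T (n%:R * h) f).
have := nrm_tri (u (n%:R * h)) (iter n (F h) (u 0)) (T (n%:R * h) f).
by lra.
Qed.

(** Three epsilons: the iterates of [F] are contractions and [T] is bounded on [[0, t0]], so [f] may
    be replaced by a nearby [v] in the domain of the square. The rank depends on [t0] only, because
    [t / n <= t0 / n < d]. *)
Lemma chernoff_cvg f t0 e : 0 <= t0 -> 0 < e -> exists N : nat,
  forall n t, (N <= n)%N -> 0 <= t -> t <= t0 ->
    nrm (iter n (F (t / n%:R)) f - T t f) <= e.
Proof.
move=> t00 e0; have [M M0 TM] := sg_locally_bounded hT t0.
have e3 : 0 < e / 3 by rewrite divr_gt0.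
have e3M : 0 < e / 3 / (M + 1) by rewrite divr_gt0// ltr_wpDl.
have [v [g [k [vg gk vf]]]] := gen2_dense hT f e3M.
have [d d0 dP] := chernoff_smooth t00 e3 vg gk.
(* The successor gives [t0 / n < d] and also excludes [n = 0], where [t / n] has the default value
   0. *)
exists (Num.truncn (t0 / d)).+1 => n t Nn t0' tt.
have n0 : 0 < n%:R :> R by rewrite ltr0n (leq_trans _ Nn).
have h0 : 0 <= t / n%:R by rewrite divr_ge0// ltW.
have Fiter x y : nrm (iter n (F (t / n%:R)) x - iter n (F (t / n%:R)) y) <= nrm (x - y).
  elim: {1 3}n => //= m IH; rewrite -(linB (F_lin h0)).
  by rewrite (le_trans (F_ctr h0 _)).
have vfe : nrm (v - f) <= e / 3.
  rewrite (le_trans (ltW vf))// ler_pdivrMr ?ltr_wpDl// ler_peMr ?(ltW e3)//.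
  by rewrite lerDr.
have h1 : nrm (iter n (F (t / n%:R)) v - T t v) <= e / 3.
  (* At [t = 0] the step length vanishes and [chernoff_smooth], which asks for [0 < h], is replaced
     by [F 0 = id]. *)
  move: t0'; rewrite le_eqVlt => /predU1P[<-|t0'].
    rewrite mul0r F_id (sg0 hT) (_ : iter n id v = v) ?subrr ?nrm0 ?(ltW e3)//.
    by elim: n {Nn n0 h0 Fiter} => //= n ->.
  have -> : T t v = T (n%:R * (t / n%:R)) v by rewrite mulrC divfK ?gt_eqF.
  apply: dP; rewrite ?divr_gt0//; last by rewrite mulrC divfK ?gt_eqF.
  rewrite ltr_pdivrMr// mulrC -ltr_pdivrMr//.
  apply: (@le_lt_trans _ _ (t0 / d)); first by rewrite ler_pM2r// invr_gt0.
  by rewrite (lt_le_trans (truncnS_gt _))// ler_nat.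
have h2 : nrm (T t v - T t f) <= e / 3.
  rewrite -(linB (sg_lin hT t0')) (le_trans (TM _ t0' tt _))//.
  apply: (@le_trans _ _ ((M + 1) * nrm (v - f))).
    by rewrite ler_wpM2r ?nrm_ge0// lerDl.
  by rewrite -ler_pdivlMl ?ltr_wpDl// mulrC ltW.
have := Fiter f v; rewrite (nrmBC f) => h3.
have := nrm_tri (iter n (F (t / n%:R)) v) (iter n (F (t / n%:R)) f) (T t f).
have := nrm_tri (T t v) (iter n (F (t / n%:R)) v) (T t f).
by lra.
Qed.

End chernoff.

(** * Lebesgue integration on R^n *)

Section rV_borel.
Context {R : realType}.

(** Open sets are countable unions of rational boxes, and boxes belong to the coordinate
    sigma-algebra. *)
Lemma rV_open_measurable n (A : set 'rV[R]_n) : open A -> measurable A.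
Proof.
move=> oA; pose box (z : 'rV[rat]_n * rat) : set 'rV[R]_n :=
  \bigcap_(j in [set: 'I_n])
    (fun y : 'rV[R]_n => y ord0 j) @^-1`
      [set a | ratr (z.1 ord0 j) - ratr z.2 < a < ratr (z.1 ord0 j) + ratr z.2].
have mbox z : measurable (box z).
  apply: fin_bigcap_measurable => [|j _]; first exact: finite_finset.
  rewrite -[X in measurable X]setTI; apply: (@measurable_coord _ R) => //.
  rewrite (_ : [set a | _] = `]ratr (z.1 ord0 j) - ratr z.2, ratr (z.1 ord0 j) + ratr z.2[%classic)//.
(* The union runs over all rational centres and radii; boxes not contained in [A] are replaced by
   the empty set. *)
suff -> : A = \bigcup_z (if pselect (box z `<=` A) then box z else set0).
  apply: countable_bigcupT_measurable; first exact: countableP.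
  by move=> z; case: pselect => _ /=; [exact: mbox|exact: measurable0].
apply/seteqP; split=> [x Ax|x [z _]]; last by case: pselect => [bA /bA|_ []].
have /nbhs_ballP[e /= e0 xeA] : nbhs x A by exact: open_nbhs_nbhs.
have [r re] := rat_in_itvoo (divr_gt0 e0 (ltr0n _ 2)).
rewrite in_itv /= in re; case/andP: re => r0 re.
have /choice[q qP] : forall j, exists q : rat, `|ratr q - x ord0 j| < ratr r.
  move=> j; have [|q] := @rat_in_itvoo R (x ord0 j - ratr r) (x ord0 j + ratr r).
    by rewrite ltrD2l gtrN.
  by rewrite in_itv /= => qx; exists q; rewrite ltr_distl.
(* The centre is within [r] of [x] in each coordinate and the box has radius [r], so it stays within
   [2 r < e] of [x]. *)
have bA : box (\row_j q j, r) `<=` A.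
  move=> y yb; apply: xeA; split => // i j; rewrite ord1 /ball /=.
  have := yb j Logic.I; rewrite /= mxE -ltr_distl => yq.
  have := qP j; have := ler_distD (ratr (q j)) (x ord0 j) (y ord0 j).
  rewrite (distrC (x ord0 j) (ratr _)) (distrC (ratr _) (y ord0 j)).
  by move: yq re; lra.
exists (\row_j q j, r) => //; case: pselect => //= _ j _.
by rewrite /= mxE -ltr_distl distrC.
Qed.

Lemma rV_continuous_measurable n (f : 'rV[R]_n -> R) :
  continuous f -> measurable_fun setT f.
Proof.
move=> cf; apply: (measurability _ (RGenOpens.measurableE R)).
move=> _ [_ [a [b ->]] <-]; rewrite setTI; apply: rV_open_measurable.
by apply: open_comp => //; exact: interval_open.
Qed.

Lemma measurable_dotp_pair n :
  measurable_fun setT (fun z : 'rV[R]_n * 'rV[R]_n => dotp z.1 z.2).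
Proof.
apply: measurable_sum => i; apply: measurable_funM.
  exact: measurableT_comp (@measurable_coord _ _ n i) _.
exact: measurableT_comp (@measurable_coord _ _ n i) _.
Qed.

Lemma measurable_dotp n (x : 'rV[R]_n) : measurable_fun setT (dotp x).
Proof. exact: measurableT_comp (@measurable_dotp_pair n) (measurable_pair1 x). Qed.

End rV_borel.

Section lebesgue_rV_integral.
Context {R : realType}.
Local Notation mu := (@lebesgue_measure R).
Local Notation leb := (@lebesgue_rV R).
Local Open Scope ereal_scope.

Lemma integral_rV0 (f : 'rV[R]_0 -> \bar R) :
  measurable_fun setT f -> \int[leb 0]_x f x = f 0%R.
Proof. by move=> mf; rewrite /= integral_dirac// diracT mul1e. Qed.

Lemma integral_rVS n (f : 'rV[R]_n.+1 -> \bar R) :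
  measurable_fun setT f -> (forall x, 0 <= f x) ->
  \int[leb n.+1]_x f x = \int[mu \x leb n]_z f (rV_cons z).
Proof.
move=> mf f0.
transitivity (\int[pushforward (mu \x leb n)%E (@rV_cons R n)]_x f x) => //.
rewrite ge0_integral_pushforward//; exact: measurable_rV_cons.
Qed.

Lemma tonelli_rVS n (f : 'rV[R]_n.+1 -> \bar R) :
  measurable_fun setT f -> (forall x, 0 <= f x) ->
  \int[leb n.+1]_x f x = \int[mu]_a \int[leb n]_y f (rV_cons (a, y)).
Proof.
move=> mf f0; rewrite integral_rVS// fubini_tonelli1//.
exact: measurableT_comp mf (@measurable_rV_cons R n).
Qed.

Lemma tonelli_rVS2 n (f : 'rV[R]_n.+1 -> \bar R) :
  measurable_fun setT f -> (forall x, 0 <= f x) ->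
  \int[leb n.+1]_x f x = \int[leb n]_y \int[mu]_a f (rV_cons (a, y)).
Proof.
move=> mf f0; rewrite integral_rVS// fubini_tonelli2//.
exact: measurableT_comp mf (@measurable_rV_cons R n).
Qed.

Lemma measurable_affine1 (a b : R) :
  measurable_fun setT (fun x : measurableTypeR R => (a * x + b)%R : measurableTypeR R).
Proof. by apply: measurable_funD => //; exact: measurable_funM. Qed.

(** The image measure scaled by [a] agrees with Lebesgue measure on half-open intervals, hence
    everywhere by uniqueness. *)
Lemma lebesgue_affine (a b : R) (f : R -> \bar R) : (0 < a)%R ->
  measurable_fun setT f -> (forall x, 0 <= f x) ->
  \int[mu]_x f x = a%:E * \int[mu]_x f (a * x + b)%R.
Proof.
move=> a0 mf f0; pose phi (x : measurableTypeR R) : measurableTypeR R := (a * x + b)%R.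
have mphi : measurable_fun setT phi by exact: measurable_affine1.
pose nu := measure_function_pushforward__canonical__measure_function_Measure mu mphi.
have aS : (0 <= a)%R by exact: ltW.
transitivity (\int[mscale (NngNum aS) nu]_x f x).
  apply: eq_measure_integral => A mA _; apply: lebesgue_measure_unique => //.
  move=> _ [[u v] _ <-] /=; rewrite /mscale /= /pushforward.
  have -> : phi @^-1` [set` `]u, v]] = [set` `](u - b) / a, (v - b) / a]]%R.
    apply/seteqP; split => x /=; rewrite !in_itv /= /phi.
      by rewrite ltr_pdivrMr// ler_pdivlMr// ltrBlDr lerBrDr mulrC.
    by rewrite ltr_pdivrMr// ler_pdivlMr// ltrBlDr lerBrDr mulrC.
  rewrite !lebesgue_measure_itv /= !lte_fin ltr_pM2r ?invr_gt0// ltrD2r.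
  case: ifPn => uv; last by rewrite mule0.
  rewrite -!EFinB -EFinM; congr EFin.
  by field; rewrite gt_eqF.
rewrite ge0_integral_mscale// /=; congr (_ * _).
by rewrite ge0_integral_pushforward.
Qed.

Lemma measurable_affine_rV n (a : R) (v : 'rV[R]_n) :
  measurable_fun setT (fun x : 'rV[R]_n => (a *: x + v)%R).
Proof.
apply: measurable_fun_coordP => i.
rewrite (_ : (fun _ => _) = (fun x : 'rV[R]_n => a * x ord0 i + v ord0 i)%R).
  by apply: measurable_funD => //; apply: measurable_funM => //; exact: measurable_coord.
by apply/funext => x; rewrite !mxE.
Qed.

(** Induction on the dimension by Tonelli; each coordinate contributes one factor [a]. *)
Lemma lebesgue_rV_affine n (a : R) (v : 'rV[R]_n) (f : 'rV[R]_n -> \bar R) :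
  (0 < a)%R -> measurable_fun setT f -> (forall x, 0 <= f x) ->
  \int[leb n]_x f x = (a ^+ n)%:E * \int[leb n]_x f (a *: x + v)%R.
Proof.
move=> a0; elim: n v f => [|n IH] v f mf f0.
  rewrite !integral_rV0//; last exact: measurableT_comp mf (measurable_affine_rV a v).
  by rewrite expr0 mul1e; congr f; apply/rowP => -[].
have mfc : measurable_fun setT (f \o @rV_cons R n).
  exact: measurableT_comp mf (@measurable_rV_cons R n).
have maf : measurable_fun setT (fun x : 'rV[R]_n.+1 => f (a *: x + v)%R).
  exact: measurableT_comp mf (measurable_affine_rV a v).
have mF : measurable_fun setT (fun x => \int[leb n]_y f (rV_cons (x, y))).
  by apply: (measurable_fun_fubini_tonelli_F (f \o @rV_cons R n)) => // z; exact: f0.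
have mG : measurable_fun setT (fun x => \int[leb n]_y f (a *: rV_cons (x, y) + v)%R).
  apply: (measurable_fun_fubini_tonelli_F (fun z => f (a *: rV_cons z + v)%R)) => //.
  exact: measurableT_comp maf (@measurable_rV_cons R n).
rewrite !tonelli_rVS// (@lebesgue_affine a (v ord0 ord0))//; last first.
  by move=> x; exact: integral_ge0.
rewrite exprS EFinM -muleA; congr (_ * _).
rewrite -ge0_integralZl//; last 2 first.
- by move=> x _; exact: integral_ge0.
- by rewrite lee_fin exprn_ge0// ltW.
apply: eq_integral => x _.
rewrite (IH (rV_uncons v).2)//; last exact: measurableT_comp mfc (measurable_pair1 _).
congr (_ * _); apply: eq_integral => y _; congr f; apply/rowP => i.
rewrite !mxE; case: unliftP => [j ->|->] //=.
by rewrite !mxE.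
Qed.

End lebesgue_rV_integral.

(** * The Poisson kernel on the line *)

Section poisson_kernel.
Context {R : realType}.
Local Notation mu := (@lebesgue_measure R).

Lemma lebesgue_integralN (f : R -> \bar R) : measurable_fun setT f ->
  (forall x, 0 <= f x)%E -> (\int[mu]_x f (- x)%R = \int[mu]_x f x)%E.
Proof.
move=> mf f0.
have mN : measurable_fun setT (-%R : measurableTypeR R -> measurableTypeR R).
  exact: oppr_measurable.
pose nu := measure_function_pushforward__canonical__measure_function_Measure mu mN.
transitivity (\int[nu]_x f x)%E; first by rewrite ge0_integral_pushforward.
by apply: eq_measure_integral => A mA _; rewrite /= lebesgue_measureN.
Qed.

Lemma norm_cos_le1 (a : R) : `|cos a| <= 1.
Proof. by rewrite ler_norml cos_geN1 cos_le1. Qed.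

Lemma oneDcos_ge0 (c a : R) : `|c| <= 1 -> 0 <= 1 + c * cos a.
Proof.
move=> c1; have : `|c * cos a| <= 1 by rewrite normrM mulr_ile1// norm_cos_le1.
by rewrite ler_norml => /andP[]; lra.
Qed.

Let primitive (k x p : R) :=
  - expR (- p) + k / (1 + x ^+ 2) * (expR (- p) * (x * sin (p * x) - cos (p * x))).

Lemma is_derive_primitive k x (p : R) :
  is_derive p 1 (primitive k x) (expR (- p) * (1 + k * cos (p * x))).
Proof.
have x0 : 1 + x ^+ 2 != 0 by rewrite gt_eqF// ltr_pwDl// sqr_ge0.
rewrite /primitive; apply: is_derive_eq.
by rewrite /GRing.scale /=; field.
Qed.

Lemma primitive_cvg k x : primitive k x p @[p --> +oo] --> (0 : R).
Proof.
pose C := 1 + `|k / (1 + x ^+ 2)| * (`|x| + 1).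
have C0 : 0 < C by rewrite ltr_pwDl// mulr_ge0// addr_ge0.
apply/cvgrPdist_lt => e e0; near=> p; rewrite sub0r normrN.
apply: (@le_lt_trans _ _ (expR (- p) * C)).
  have -> : primitive k x p = expR (- p) *
      (-1 + k / (1 + x ^+ 2) * (x * sin (p * x) - cos (p * x))).
    by rewrite /primitive; ring.
  rewrite normrM ger0_norm ?expR_ge0// ler_wpM2l ?expR_ge0//.
  rewrite (le_trans (ler_normD _ _))// normrN1 lerD2l normrM ler_wpM2l//.
  rewrite (le_trans (ler_normB _ _))// normrM lerD//.
    by rewrite ler_piMr// ler_norml sin_geN1 sin_le1.
  by rewrite ler_norml cos_geN1 cos_le1.
rewrite -ltr_pdivlMr//; near: p.
have := @cvgr_expR R => /cvgrPdist_lt/(_ (e / C)); rewrite divr_gt0// => /(_ isT).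
by apply: filterS => p; rewrite sub0r normrN ger0_norm ?expR_ge0.
Unshelve. all: by end_near. Qed.

Let one_sided (k x p : R) := expR (- p) * (1 + k * cos (p * x)).

Lemma continuous_one_sided k x : continuous (one_sided k x).
Proof.
move=> p; rewrite /one_sided; apply: cvgM.
  by apply: continuous_comp; [exact: opp_continuous|exact: continuous_expR].
apply: cvgD; first exact: cvg_cst.
apply: cvgMl_tmp; apply: continuous_comp; last exact: continuous_cos.
exact: cvgMr_tmp cvg_id.
Qed.

Lemma integral_one_sided k x : `|k| <= 1 ->
  (\int[mu]_(p in `[0%R, +oo[) (one_sided k x p)%:E = (1 + k / (1 + x ^+ 2))%:E)%E.
Proof.
move=> k1; have x0 : 1 + x ^+ 2 != 0 by rewrite gt_eqF// ltr_pwDl// sqr_ge0.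
rewrite (@ge0_continuous_FTC2y _ _ (primitive k x) _ 0).
- rewrite /primitive -EFinB; congr EFin.
  by rewrite mul0r oppr0 expR0 sin0 cos0 mulr0 !mul1r sub0r; ring.
- by move=> p _; rewrite mulr_ge0 ?expR_ge0// oneDcos_ge0.
- exact/continuous_subspaceT/continuous_one_sided.
- exact: primitive_cvg.
- by move=> p _; have [] := is_derive_primitive k x p.
- apply: cvg_at_right_filter.
  apply: differentiable_continuous; apply/derivable1_diffP.
  by have [] := is_derive_primitive k x 0.
- by move=> p _; rewrite derive1E; have [_ ->] := is_derive_primitive k x p.
Qed.

Lemma continuous_expR_cos (k x th : R) :
  continuous (fun p : R => expR (- `|p|) * (1 + k * cos (p * x + th))).
Proof.
move=> p; apply: cvgM.
  apply: (@continuous_comp R R R (fun p => - `|p|) expR).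
    by apply: continuous_comp; [exact: norm_continuous|exact: opp_continuous].
  exact: continuous_expR.
apply: cvgD; first exact: cvg_cst.
apply: cvgMl_tmp; apply: (@continuous_comp R R R (fun p => p * x + th) cos).
  by apply: cvgD; [exact: cvgMr_tmp cvg_id|exact: cvg_cst].
exact: continuous_cos.
Qed.

Lemma measurable_expR_cos (k x th : R) : measurable_fun setT
  (fun p : R => expR (- `|p|) * (1 + k * cos (p * x + th))).
Proof. by apply: continuous_measurable_fun; exact: continuous_expR_cos. Qed.

Lemma measurable_inv_oneDsqr :
  measurable_fun setT (fun x : R => (1 + x ^+ 2)^-1).
Proof. by apply: continuous_measurable_fun; exact: continuous_oneDsqrV. Qed.

(** The factor [1 + k cos] with [k] in [[0, 1]] keeps the integrand nonnegative, so that the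
    theorems on nonnegative integrals apply. The pure cosine integral is recovered later as a
    difference of two values of [k]. *)
Lemma integral_expR_cos k x th : 0 <= k <= 1 ->
  (\int[mu]_p (expR (- `|p|) * (1 + k * cos (p * x + th)))%:E =
   (2 * (1 + k * (1 + x ^+ 2)^-1 * cos th))%:E)%E.
Proof.
move=> /andP[k0 k1]; pose c := k * cos th.
have nk : `|k| <= 1 by rewrite ger0_norm.
have c1 : `|c| <= 1 by rewrite /c normrM mulr_ile1// norm_cos_le1.
pose f (p : R) := expR (- `|p|) * (1 + k * cos (p * x + th)).
pose g (p : R) := expR (- `|p|) * (1 + c * cos (p * x)).
have cf : continuous f by exact: continuous_expR_cos.
have cg : continuous g.
  rewrite (_ : g = fun p => expR (- `|p|) * (1 + c * cos (p * x + 0))).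
    exact: continuous_expR_cos.
  by apply/funext => p; rewrite addr0.
have f0 p : 0 <= f p by rewrite mulr_ge0 ?expR_ge0// oneDcos_ge0.
have g0 p : 0 <= g p by rewrite mulr_ge0 ?expR_ge0// oneDcos_ge0.
have mf : measurable_fun setT (EFin \o f).
  by apply/measurable_EFinP; exact: continuous_measurable_fun.
have mfN : measurable_fun setT (fun p : R => (f (- p))%:E).
  exact: measurableT_comp mf (@oppr_measurable R setT).
have mg : measurable_fun setT (EFin \o g).
  by apply/measurable_EFinP; exact: continuous_measurable_fun.
have fg : (\int[mu]_p (f p)%:E = \int[mu]_p (g p)%:E)%E.
  (* Adding the values at [p] and [- p] removes the odd term in [sin th]; the even part has
     [c = k * cos th] in place of [k], possibly negative. *)
  have : (\int[mu]_p (f p)%:E + \int[mu]_p (f (- p))%:E =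
          2%:E * \int[mu]_p (g p)%:E)%E.
    rewrite -ge0_integralD//; last 2 first.
    - by move=> p _; rewrite lee_fin.
    - by move=> p _; rewrite lee_fin.
    rewrite -ge0_integralZl//; last by move=> p _; rewrite lee_fin.
    apply: eq_integral => p _; rewrite -EFinD -EFinM; congr EFin.
    rewrite /f /g normrN mulNr !cosD cosN sinN /c; ring.
  rewrite (lebesgue_integralN mf)//.
  rewrite -mule2n -mule_natl => /(congr1 (fun z => (2^-1)%:E * z)%E).
  by rewrite !muleA -!EFinM mulVf// !mul1e.
rewrite [LHS]fg ge0_symfun_integralT//; last first.
  by move=> p; rewrite /g /= normrN mulNr cosN.
transitivity (2%:E * \int[mu]_(p in `[0%R, +oo[) (one_sided c x p)%:E)%E.
  rewrite -set_itvcy; congr (_ * _)%E; apply: eq_integral => p.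
  rewrite inE /= in_itv /= andbT => p0.
  by rewrite /g /one_sided ger0_norm.
rewrite integral_one_sided// -EFinM; congr EFin.
by rewrite /c; ring.
Qed.

Lemma integral_inv_oneDsqr : (\int[mu]_x ((1 + x ^+ 2)^-1)%:E = pi%:E)%E.
Proof.
rewrite ge0_symfun_integralT.
- rewrite -set_itvcy integral0y_oneDsqr -EFinM; congr EFin.
  by field.
- by move=> x; rewrite invr_ge0 addr_ge0// sqr_ge0.
- exact: continuous_oneDsqrV.
- by move=> x /=; rewrite sqrrN.
Qed.

End poisson_kernel.

(** * Product weights and their cosine transforms *)

Section product_weights.
Context {R : realType}.
Local Notation mu := (@lebesgue_measure R).
Local Notation leb := (@lebesgue_rV R).

(** Transform of the damping weight [laplacew], up to the factor [2 ^ n], and integrable majorant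
    throughout. Both weights are products, so that their integrals are computed one coordinate at a
    time. *)
Definition cauchyw n (x : 'rV[R]_n) : R := \prod_(i < n) (1 + x ord0 i ^+ 2)^-1.

Definition laplacew n (x : 'rV[R]_n) : R := \prod_(i < n) expR (- `|x ord0 i|).

Lemma rV_cons0 n a (y : 'rV[R]_n) : rV_cons (a, y) ord0 ord0 = a.
Proof. by rewrite mxE unlift_none. Qed.

Lemma rV_consS n a (y : 'rV[R]_n) j : rV_cons (a, y) ord0 (lift ord0 j) = y ord0 j.
Proof. by rewrite mxE liftK. Qed.

Lemma cauchyw_cons n a (y : 'rV[R]_n) :
  cauchyw (rV_cons (a, y)) = (1 + a ^+ 2)^-1 * cauchyw y.
Proof.
rewrite /cauchyw big_ord_recl rV_cons0; congr (_ * _).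
by apply: eq_bigr => j _; rewrite rV_consS.
Qed.

Lemma laplacew_cons n a (y : 'rV[R]_n) :
  laplacew (rV_cons (a, y)) = expR (- `|a|) * laplacew y.
Proof.
rewrite /laplacew big_ord_recl rV_cons0; congr (_ * _).
by apply: eq_bigr => j _; rewrite rV_consS.
Qed.

Lemma cauchyw_gt0 n (x : 'rV[R]_n) : 0 < cauchyw x.
Proof.
by apply: prodr_gt0 => i _; rewrite invr_gt0 ltr_pwDl// sqr_ge0.
Qed.

Lemma laplacew_gt0 n (x : 'rV[R]_n) : 0 < laplacew x.
Proof. by apply: prodr_gt0 => i _; exact: expR_gt0. Qed.

Lemma laplacew_le1 n (x : 'rV[R]_n) : laplacew x <= 1.
Proof.
apply: prodr_ile1 => i _; rewrite expR_ge0/= -[leRHS]expR0 ler_expR.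
by rewrite oppr_le0.
Qed.

Lemma measurable_cauchyw n : measurable_fun setT (@cauchyw n).
Proof.
apply: measurable_prod => i _.
apply: (@measurableT_comp _ _ _ _ _ _ (fun a : R => (1 + a ^+ 2)^-1)).
  exact: measurable_inv_oneDsqr.
exact: measurable_coord.
Qed.

Lemma measurable_laplacew n : measurable_fun setT (@laplacew n).
Proof.
apply: measurable_prod => i _.
apply: (@measurableT_comp _ _ _ _ _ _ (fun a : R => expR (- `|a|))).
  apply: measurableT_comp; first exact: measurable_expR.
  by apply: measurableT_comp; [exact: oppr_measurable|exact: normr_measurable].
exact: measurable_coord.
Qed.

Lemma integral_cauchyw n : (\int[leb n]_x (cauchyw x)%:E = (pi ^+ n)%:E)%E.
Proof.
have nn k (x : 'rV[R]_k) : (0 <= (cauchyw x)%:E)%E by rewrite lee_fin ltW ?cauchyw_gt0.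
have mw k : measurable_fun setT (fun x : 'rV[R]_k => (cauchyw x)%:E).
  by apply/measurable_EFinP; exact: measurable_cauchyw.
elim: n => [|n IH].
  by rewrite integral_rV0// /cauchyw big_ord0 expr0.
rewrite tonelli_rVS//.
under eq_integral => a _.
  under eq_integral do rewrite cauchyw_cons EFinM.
  rewrite ge0_integralZl//; last 2 first.
  - exact: mw.
  - by rewrite lee_fin invr_ge0 addr_ge0// sqr_ge0.
  rewrite IH; over.
rewrite ge0_integralZr//.
- by rewrite integral_inv_oneDsqr -EFinM exprS.
- by apply/measurable_EFinP; exact: measurable_inv_oneDsqr.
- by move=> a _; rewrite lee_fin invr_ge0 addr_ge0// sqr_ge0.
- by rewrite lee_fin exprn_ge0// pi_ge0.
Qed.

(** Integrating out one coordinate reproduces the same shape: [k] is multiplied by a Cauchy factor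
    and stays in [[0, 1]], while the phase absorbs the contribution of the other coordinates. Hence
    the generality in [k] and [th]. *)
Lemma integral_laplacew_cos n k (x : 'rV[R]_n) th : 0 <= k <= 1 ->
  (\int[leb n]_p (laplacew p * (1 + k * cos (dotp p x + th)))%:E =
   (2 ^+ n * (1 + k * cauchyw x * cos th))%:E)%E.
Proof.
elim: n k x th => [|n IH] k x th k01.
  have m0 (f : 'rV[R]_0 -> \bar R) : measurable_fun setT f.
    rewrite (_ : f = cst (f 0)); first exact: measurable_cst.
    by apply/funext => y; rewrite /cst; congr f; apply/rowP => -[].
  by rewrite integral_rV0// /laplacew /cauchyw /dotp !big_ord0 expr0 !mul1r mulr1 add0r.
have nn (k' a : R) : 0 <= k' <= 1 -> 0 <= 1 + k' * cos a.
  by move=> /andP[k0 k1]; rewrite oneDcos_ge0// ger0_norm.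
have mcos m k' (z : 'rV[R]_m) : measurable_fun setT
    (fun p : 'rV[R]_m => (laplacew p * (1 + k' * cos (dotp p z + th)))%:E).
  apply/measurable_EFinP; apply: measurable_funM; first exact: measurable_laplacew.
  apply: measurable_funD => //; apply: measurable_funM => //.
  apply: (@measurableT_comp _ _ _ _ _ _ (@cos R)).
    by apply: continuous_measurable_fun; exact: continuous_cos.
  apply: measurable_funD => //.
  exact: measurableT_comp (@measurable_dotp_pair R m) (measurable_pair2 z).
rewrite tonelli_rVS2//; last first.
  by move=> p; rewrite lee_fin mulr_ge0 ?nn// ltW ?laplacew_gt0.
pose x0 := x ord0 ord0; pose x' := (rV_uncons x).2.
have -> : cauchyw x = (1 + x0 ^+ 2)^-1 * cauchyw x'.
  by rewrite -[x]rV_unconsK /rV_uncons cauchyw_cons.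
have k'01 : 0 <= k * (1 + x0 ^+ 2)^-1 <= 1.
  case/andP: k01 => k0 k1; rewrite mulr_ge0 ?invr_ge0 ?addr_ge0 ?sqr_ge0//=.
  rewrite mulr_ile1 ?invr_ge0 ?addr_ge0 ?sqr_ge0//.
  by rewrite invf_le1 ?lerDl ?sqr_ge0// ltr_pwDl// sqr_ge0.
under eq_integral => y _.
  under eq_integral => a _.
    rewrite laplacew_cons (_ : dotp (rV_cons (a, y)) x + th = a * x0 + (dotp y x' + th)); last first.
      rewrite /dotp big_ord_recl rV_cons0 -addrA; congr (_ + (_ + _)).
      by apply: eq_bigr => j _; rewrite rV_consS mxE.
    rewrite (mulrC (expR _)) -mulrA EFinM; over.
  rewrite ge0_integralZl//; last 3 first.
  - by apply/measurable_EFinP; exact: measurable_expR_cos.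
  - by move=> a _; rewrite lee_fin mulr_ge0 ?expR_ge0// nn.
  - by rewrite lee_fin ltW// laplacew_gt0.
  rewrite integral_expR_cos// -EFinM mulrCA EFinM; over.
rewrite ge0_integralZl//; last 2 first.
- exact: mcos.
- by move=> p _; rewrite lee_fin mulr_ge0 ?nn// ltW ?laplacew_gt0.
rewrite IH// -EFinM; congr EFin.
by rewrite [2 ^+ n.+1]exprS -!mulrA.
Qed.

End product_weights.

(** * Integrable real functions: domination and affine substitution *)

Section real_integrals.
Context {R : realType} {n : nat}.
Local Notation Rn := 'rV[R]_n.
Local Notation leb := (@lebesgue_rV R n).
Implicit Types f g : Rn -> R.

Definition L1 f := leb.-integrable setT (EFin \o f).

Lemma L1_measurable f : L1 f -> measurable_fun setT f.
Proof. by move=> /measurable_int/measurable_EFinP. Qed.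

Lemma L1_le f g : measurable_fun setT f -> (forall x, `|f x| <= g x) ->
  L1 g -> L1 f.
Proof.
move=> mf fg; apply: le_integrable => //; first exact/measurable_EFinP.
move=> x _ /=; rewrite lee_fin (le_trans (fg x))//; exact: ler_norm.
Qed.

Lemma L1D f g : L1 f -> L1 g -> L1 (fun x => f x + g x).
Proof. by move=> lf lg; have := integrableD measurableT lf lg. Qed.

Lemma L1B f g : L1 f -> L1 g -> L1 (fun x => f x - g x).
Proof. by move=> lf lg; have := integrableB measurableT lf lg. Qed.

Lemma L1Z k f : L1 f -> L1 (fun x => k * f x).
Proof. by move=> lf; have := integrableZl measurableT k lf. Qed.

Lemma L1_norm f : L1 f -> L1 (fun x => `|f x|).
Proof. exact: integrable_norm. Qed.

Lemma L1_mulb f g (C : R) : measurable_fun setT g -> (forall x, `|g x| <= C) ->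
  L1 f -> L1 (fun x => g x * f x).
Proof.
move=> mg gC lf; apply: (@L1_le _ (fun x => C * `|f x|)).
- by apply: measurable_funM => //; exact: L1_measurable.
- by move=> x; rewrite normrM ler_wpM2r.
- exact/L1Z/L1_norm.
Qed.

Lemma L1_cauchyw : L1 (@cauchyw R n).
Proof.
apply/integrableP; split; first by apply/measurable_EFinP; exact: measurable_cauchyw.
under eq_integral => x _ do rewrite /= ger0_norm ?ltW ?cauchyw_gt0//.
by rewrite integral_cauchyw ltry.
Qed.

Lemma L1_dom f (C : R) : measurable_fun setT f ->
  (forall x, `|f x| <= C * cauchyw x) -> L1 f.
Proof. by move=> mf fC; apply: L1_le mf fC _; exact/L1Z/L1_cauchyw. Qed.

Lemma rintD f g : L1 f -> L1 g ->
  \int[leb]_x (f x + g x) = \int[leb]_x f x + \int[leb]_x g x.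
Proof. by move=> lf lg; exact: (RintegralD measurableT lf lg). Qed.

Lemma rintB f g : L1 f -> L1 g ->
  \int[leb]_x (f x - g x) = \int[leb]_x f x - \int[leb]_x g x.
Proof. by move=> lf lg; exact: (RintegralB measurableT lf lg). Qed.

Lemma rintZ k f : L1 f -> \int[leb]_x (k * f x) = k * \int[leb]_x f x.
Proof. by move=> lf; exact: (RintegralZl k measurableT lf). Qed.

Lemma rint_norm_le f g : L1 f -> L1 g -> (forall x, `|f x| <= g x) ->
  `|\int[leb]_x f x| <= \int[leb]_x g x.
Proof.
move=> lf lg fg; rewrite (le_trans (le_normr_Rintegral _ _))//.
by apply: le_Rintegral => //; exact: L1_norm.
Qed.

Lemma rint_cvg (f_ : nat -> Rn -> R) f g :
  (forall k, measurable_fun setT (f_ k)) -> measurable_fun setT f ->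
  (forall x, f_ k x @[k --> \oo] --> f x) -> L1 g ->
  (forall k x, `|f_ k x| <= g x) ->
  \int[leb]_x f_ k x @[k --> \oo] --> \int[leb]_x f x.
Proof.
move=> mf_ mf ff lg fg.
have ffE x : (EFin \o f_ k) x @[k --> \oo] --> (EFin \o f) x.
  by apply: cvg_EFin; [exact: nearW|exact: ff].
have [||||lf _] := @dominated_convergence _ _ _ leb setT measurableT
  (fun k => EFin \o f_ k) (EFin \o f) (EFin \o g) _ _ _ lg.
- by move=> k; exact/measurable_EFinP.
- exact/measurable_EFinP.
- by apply: aeW => x _; exact: ffE.
- by apply: aeW => x k _ /=; rewrite lee_fin.
have If : (\int[leb]_x (f x)%:E)%E \is a fin_num by exact: integrable_fin_num.
by rewrite -(fineK If) => /fine_cvg.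
Qed.

Lemma L1_affine (a : R) (v : Rn) f : 0 < a -> L1 f -> L1 (fun x => f (a *: x + v)).
Proof.
move=> a0 lf; have mf := L1_measurable lf.
have maf : measurable_fun setT (fun x : Rn => f (a *: x + v)).
  exact: measurableT_comp mf (measurable_affine_rV a v).
apply/integrableP; split; first exact/measurable_EFinP.
have /integrableP[_] := lf; rewrite (@lebesgue_rV_affine _ _ a v)//; last first.
  by apply/measurable_EFinP; exact: measurableT_comp.
rewrite /=; set I := (\int[_]_x _)%E => aI; rewrite ltey; apply/eqP => Ioo.
by move: aI; rewrite Ioo gt0_muley// lte_fin exprn_gt0.
Qed.

Lemma rint_affine (a : R) (v : Rn) f : 0 < a -> L1 f ->
  \int[leb]_x f x = a ^+ n * \int[leb]_x f (a *: x + v).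
Proof.
move=> a0 lf; have mf := L1_measurable lf; have laf := L1_affine v a0 lf.
rewrite -[RHS]/(fine (a ^+ n)%:E * _) -fineM//; last exact: integrable_fin_num.
rewrite /Rintegral; congr fine; rewrite integralE [in RHS]integralE.
rewrite muleBr//; last first.
  by rewrite fin_num_adde_defl// fin_numN integrable_neg_fin_num.
have fin0 : (forall x, 0 <= (EFin \o f)^\+ x)%E by [].
have fin1 : (forall x, 0 <= (EFin \o f)^\- x)%E by [].
congr (_ - _)%E.
- rewrite (@lebesgue_rV_affine _ _ a v (EFin \o f)^\+%E)//; last first.
    exact: measurable_funepos (measurable_int _ lf).
  by congr (_ * _)%E; apply: eq_integral => x _; rewrite !funeposE.
- rewrite (@lebesgue_rV_affine _ _ a v (EFin \o f)^\-%E)//; last first.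
    exact: measurable_funeneg (measurable_int _ lf).
  by congr (_ * _)%E; apply: eq_integral => x _; rewrite !funenegE.
Qed.

End real_integrals.

(** * Fourier inversion *)

Section smooth_compact_support.
Context {R : realType} {n : nat}.
Local Notation Rn := 'rV[R]_n.
Local Notation leb := (@lebesgue_rV R n).
Local Notation e_ i := (delta_mx ord0 i : Rn).
Local Notation "''d_' i f" := (fun x : Rn => 'D_(e_ i) f x)
  (at level 10, i at level 0, f at level 9).
Implicit Types f g : Rn -> R.

Definition cpt_supp f := exists2 K : set Rn, compact K & forall x, ~ K x -> f x = 0.

Definition smooth_cpt f := (forall k, Ck k f) /\ cpt_supp f.

Lemma smooth_cpt_continuous f : smooth_cpt f -> continuous f.
Proof. by case=> /(_ 0%N). Qed.

Lemma smooth_cpt_derivable f i x : smooth_cpt f -> derivable f x (e_ i).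
Proof. by case=> /(_ 1%N) /= [_ /(_ i)[+ _] _]; exact. Qed.

Lemma cpt_supp_derive f v : cpt_supp f -> cpt_supp (fun x => 'D_v f x).
Proof.
move=> [K cK fK]; exists K => // x Kx.
have oK : open (~` K) by apply: closed_openC; exact: compact_closed (@norm_hausdorff _ _) cK.
rewrite (@near_eq_derive _ _ _ f (cst 0)) ?derive_cst//.
have : nbhs x (~` K) by exact: open_nbhs_nbhs.
by apply: filterS => y; exact: fK.
Qed.

Lemma smooth_cpt_derive f i : smooth_cpt f -> smooth_cpt ('d_ i f).
Proof.
move=> [kf sf]; split; last exact: cpt_supp_derive.
by move=> k; have [_ /(_ i)[]] := kf k.+1.
Qed.

Lemma coord_norm_le (x : Rn) i : `|x ord0 i| <= `|x|.
Proof.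
rewrite [leRHS]/Num.norm /= mx_normrE.
exact: (le_bigmax _ (fun ij => `|x ij.1 ij.2|) (ord0, i)).
Qed.

Lemma cpt_supp_bounded f : continuous f -> cpt_supp f ->
  exists2 B : R, 0 <= B & forall x, `|f x| <= B.
Proof.
move=> cf [K cK fK].
have : compact (f @` K).
  by apply: continuous_compact => //; exact: continuous_subspaceT.
move=> /compact_bounded[M [_ HM]].
exists `|M + 1| => // x; have [Kx|/fK ->] := pselect (K x); last by rewrite normr0.
rewrite (le_trans _ (ler_norm _))//; apply: (HM (M + 1)); first by rewrite ltrDl.
by exists x.
Qed.

Lemma cauchyw_lower (x : Rn) (M : R) : (forall i, `|x ord0 i| <= M) ->
  1 <= (1 + M ^+ 2) ^+ n * cauchyw x.
Proof.
move=> xM; have M0 : 0 < 1 + M ^+ 2 by rewrite ltr_pwDl// sqr_ge0.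
rewrite mulrC -ler_pdivrMr ?exprn_gt0// div1r -exprVn.
rewrite -[n in _ ^+ n]card_ord -prodr_const; apply: ler_prod => i _.
rewrite invr_ge0 ltW//= lef_pV2 ?posrE// ?ltr_pwDl ?sqr_ge0//.
by rewrite lerD2l -real_normK ?num_real// lerXn2r ?nnegrE// (le_trans _ (xM i)).
Qed.

(* The unit shift leaves room for the difference quotients of [f]. *)
Lemma cpt_supp_dom f : cpt_supp f -> exists2 C : R, 0 <= C &
  forall (x y : Rn) (B : R), 0 <= B -> (forall i, `|x ord0 i - y ord0 i| <= 1) ->
    f x = 0 \/ B <= B * C * cauchyw y.
Proof.
move=> [K /compact_bounded[M [_ HM]] fK].
(* One unit comes from the strict bound in [compact_bounded], the other from the distance between
   [x] and [y]. *)
exists ((1 + (`|M| + 2) ^+ 2) ^+ n).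
  by rewrite exprn_ge0// addr_ge0// sqr_ge0.
move=> x y B B0 xy; have [Kx|/fK ->] := pselect (K x); last by left.
right; rewrite -mulrA ler_peMr// cauchyw_lower// => i.
have xM : `|x ord0 i| <= `|M| + 1.
  rewrite (le_trans (coord_norm_le _ _))//; apply: HM Kx.
  by rewrite (le_lt_trans (ler_norm _))// ltrDl.
have := ler_normB (x ord0 i) (x ord0 i - y ord0 i).
rewrite opprB addrCA subrr addr0; have := xy i; lra.
Qed.

Lemma smooth_L1 f : continuous f -> cpt_supp f -> L1 f.
Proof.
move=> cf sf; have [B B0 fB] := cpt_supp_bounded cf sf.
have [C C0 fC] := cpt_supp_dom sf.
apply: (@L1_dom _ _ _ (B * C)); first exact: rV_continuous_measurable.
move=> x; have [|fx|BC] := fC x x B B0; first by move=> i; rewrite subrr normr0.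
  by rewrite fx normr0 !mulr_ge0// ltW ?cauchyw_gt0.
exact: le_trans (fB x) BC.
Qed.

Lemma line_is_derive f (x v : Rn) (s : R) : derivable f (x + s *: v) v ->
  is_derive s 1 (fun s => f (x + s *: v)) ('D_v f (x + s *: v)).
Proof.
have E : (fun h : R => h^-1 *: (((fun s => f (x + s *: v)) \o shift s) (h *: 1)
      - f (x + s *: v))) =
    (fun h => h^-1 *: ((f \o shift (x + s *: v)) (h *: v) - f (x + s *: v))).
  apply/funext => h /=; congr (_ *: (f _ - _)).
  by rewrite [h *: 1]mulr1 scalerDl addrCA.
by move=> df; split; rewrite /derivable /derive E.
Qed.

Lemma derive_lipschitz f v (B h : R) (x : Rn) : 0 <= h ->
  (forall x, derivable f x v) -> (forall x, `|'D_v f x| <= B) ->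
  `|f (x + h *: v) - f x| <= B * h.
Proof.
move=> h0 df fB; have dl s := line_is_derive (df (x + s *: v)).
have [|c _] := @MVT_segment _ (fun s => f (x + s *: v))
  (fun s => 'D_v f (x + s *: v)) 0 h h0 (fun s _ => dl s).
  apply: derivable_within_continuous => s _; exact: (@ex_derive _ _ _ _ _ _ _ (dl s)).
rewrite scale0r addr0 subr0 => ->; rewrite normrM (ger0_norm h0).
by rewrite ler_wpM2r.
Qed.

(** By translation invariance every difference quotient has integral 0, and dominated convergence
    passes to the derivative. *)
Lemma rint_derive f i : continuous f -> cpt_supp f ->
  (forall x, derivable f x (e_ i)) -> continuous ('d_ i f) ->
  \int[leb]_x 'D_(e_ i) f x = 0.
Proof.
move=> cf sf df cdf.
have [B B0 dfB] := cpt_supp_bounded cdf (cpt_supp_derive _ sf).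
have [C C0 fC] := cpt_supp_dom sf.
pose h (k : nat) : R := k.+1%:R^-1.
have h0 k : 0 < h k by rewrite invr_gt0.
have h1 k : h k <= 1 by rewrite invf_le1// ler1n.
pose q k x := (h k)^-1 * (f (x + h k *: e_ i) - f x).
have lf := smooth_L1 cf sf.
have lfs k : L1 (fun x => f (x + h k *: e_ i)).
  have := L1_affine (h k *: e_ i) ltr01 lf.
  by under eq_fun do rewrite scale1r.
have q0 k : \int[leb]_x q k x = 0.
  rewrite /q (rintZ _ (L1B (lfs k) lf)).
  have -> : \int[leb]_x (f (x + h k *: e_ i) - f x) =
      \int[leb]_x f (x + h k *: e_ i) - \int[leb]_x f x.
    exact: (rintB (lfs k) lf).
  have -> : \int[leb]_x f x = \int[leb]_x f (x + h k *: e_ i).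
    rewrite (rint_affine (h k *: e_ i) ltr01 lf) expr1n mul1r.
    by under eq_Rintegral do rewrite scale1r.
  by rewrite subrr mulr0.
have : \int[leb]_x q k x @[k --> \oo] --> \int[leb]_x 'D_(e_ i) f x.
  apply: (@rint_cvg _ _ _ _ (fun x => (B * C + B * C) * cauchyw x)).
  - by move=> k; apply: L1_measurable; exact/L1Z/L1B.
  - exact: rV_continuous_measurable.
  - move=> x; have := df x; rewrite /derivable /derive => /cvgrPdist_lt dx.
    apply/cvgrPdist_lt => e e0; have [d /= d0 dd] := dx e e0.
    near=> k.
    have hk : h k < d by near: k; exact: near_infty_natSinv_lt (PosNum d0).
    have := dd (h k); rewrite /= sub0r normrN gtr0_norm// gt_eqF//.
    by rewrite /q [x + _]addrC; exact.
  - exact/L1Z/L1_cauchyw.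
  (* The quotient vanishes unless [f] is nonzero at [x] or at [x + h e_i]; each of these is within 1
     of [x] in every coordinate, so [cpt_supp_dom] turns the constant bound into an integrable
     one. *)
  - move=> k x; have qB : `|q k x| <= B.
      rewrite normrM ger0_norm ?invr_ge0 ?(ltW (h0 k))// ler_pdivrMl// mulrC.
      by apply: derive_lipschitz => //; exact: ltW.
    have BC0 : 0 <= B * C * cauchyw x by rewrite !mulr_ge0// ltW ?cauchyw_gt0.
    rewrite mulrDl.
    have [|fx|BC] := fC x x B B0; first by move=> j; rewrite subrr normr0.
    + have [|fx'|BC] := fC (x + h k *: e_ i) x B B0.
      * move=> j; rewrite !mxE addrAC subrr add0r normrM (ger0_norm (ltW (h0 k))).
        rewrite mulr_ile1 ?(ltW (h0 k))//.
        by case: (_ && _); rewrite ?normr1 ?normr0.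
      * by rewrite /q fx fx' subrr mulr0 normr0 addr_ge0.
      * by rewrite (le_trans qB)// (le_trans BC)// lerDl.
    + by rewrite (le_trans qB)// (le_trans BC)// lerDl.
under eq_fun do rewrite q0.
by move=> /cvg_lim <- //; rewrite lim_cst.
Unshelve. all: by end_near. Qed.

End smooth_compact_support.

(** * Integrals with a parameter and Fubini under a product majorant *)

Section parametric_integrals.
Context {R : realType} {n : nat}.
Local Notation Rn := 'rV[R]_n.
Local Notation leb := (@lebesgue_rV R n).
Implicit Types F : Rn * Rn -> R.

Lemma measurable_rint F : measurable_fun setT F ->
  measurable_fun setT (fun x : Rn => \int[leb]_y F (x, y)).
Proof.
move=> mF; have mEF : measurable_fun setT (EFin \o F) by exact/measurable_EFinP.
rewrite /Rintegral; apply: measurableT_comp; first exact: fine_measurable.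
rewrite (_ : (fun x : Rn => _) = (fun x => \int[leb]_y (EFin \o F)^\+ (x, y) -
    \int[leb]_y (EFin \o F)^\- (x, y)))%E; last first.
  apply/funext => x; rewrite integralE; congr (_ - _)%E.
    by apply: eq_integral => y _; rewrite !funeposE.
  by apply: eq_integral => y _; rewrite !funenegE.
apply: emeasurable_funB.
  by apply: measurable_fun_fubini_tonelli_F => //; exact: measurable_funepos.
by apply: measurable_fun_fubini_tonelli_F => //; exact: measurable_funeneg.
Qed.

Lemma rint_fubini F (u v : Rn -> R) : measurable_fun setT F -> L1 u -> L1 v ->
  (forall x y, `|F (x, y)| <= u x * v y) ->
  \int[leb]_x \int[leb]_y F (x, y) = \int[leb]_y \int[leb]_x F (x, y).
Proof.
move=> mF lu lv Fuv; have mu := L1_measurable lu; have mv := L1_measurable lv.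
have mF1 x : measurable_fun setT (fun y : Rn => F (x, y)).
  exact: measurableT_comp mF (measurable_pair1 x).
have mF2 y : measurable_fun setT (fun x : Rn => F (x, y)).
  exact: measurableT_comp mF (measurable_pair2 y).
have L1F1 x : L1 (fun y => F (x, y)).
  by apply: L1_le (mF1 x) (Fuv x) _; exact: L1Z.
have L1F2 y : L1 (fun x => F (x, y)).
  apply: L1_le (mF2 y) (fun x => Fuv x y) _.
  by under eq_fun do rewrite mulrC; exact: L1Z.
have iF : (leb \x leb)%E.-integrable setT (EFin \o F).
  apply/integrable12ltyP; first exact/measurable_EFinP.
  have /integrableP[_ uoo] := lu; have /integrableP[_ voo] := lv.
  apply: (@le_lt_trans _ _ (\int[leb]_x (`|(u x)%:E| * \int[leb]_y `|(v y)%:E|))%E).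
    apply: ge0_le_integral => //.
    - by move=> x _; exact: integral_ge0.
    - apply: (measurable_fun_fubini_tonelli_F (abse \o (EFin \o F))).
        by apply: measurableT_comp => //; exact/measurable_EFinP.
      by move=> z; exact: abse_ge0.
    - apply: emeasurable_funM => //.
      by apply: measurableT_comp => //; exact/measurable_EFinP.
    - move=> x _; rewrite -ge0_integralZl//; last first.
        by apply: measurableT_comp => //; exact/measurable_EFinP.
      apply: ge0_le_integral => //.
      + by apply: measurableT_comp => //; exact/measurable_EFinP.
      + apply: measurable_funeM.
        by apply: measurableT_comp => //; exact/measurable_EFinP.
      + move=> y _ /=; rewrite -EFinM lee_fin (le_trans (Fuv x y))//.
        by rewrite -normrM ler_norm.
  rewrite ge0_integralZr//; last 2 first.
    by apply: measurableT_comp => //; exact/measurable_EFinP.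
    exact: integral_ge0.
  by rewrite lte_mul_pinfty// ?integral_ge0// ge0_fin_numE// integral_ge0.
rewrite /Rintegral; congr fine.
transitivity (\int[leb]_x \int[leb]_y (F (x, y))%:E)%E.
  by apply: eq_integral => x _; rewrite fineK//; exact: (integrable_fin_num measurableT (L1F1 x)).
rewrite (Fubini iF).
by apply: eq_integral => y _; rewrite fineK//; exact: (integrable_fin_num measurableT (L1F2 y)).
Qed.

End parametric_integrals.

Section dotp_lemmas.
Context {R : realType} {n : nat}.
Local Notation Rn := 'rV[R]_n.
Implicit Types p x y : Rn.

Lemma dotpC x y : dotp x y = dotp y x.
Proof. by apply: eq_bigr => i _; rewrite mulrC. Qed.

Lemma dotpDr p x y : dotp p (x + y) = dotp p x + dotp p y.
Proof. by rewrite /dotp -big_split /=; apply: eq_bigr => i _; rewrite mxE mulrDr. Qed.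

Lemma dotpZr p a x : dotp p (a *: x) = a * dotp p x.
Proof. by rewrite /dotp mulr_sumr; apply: eq_bigr => i _; rewrite mxE mulrCA. Qed.

Lemma dotpZl a p x : dotp (a *: p) x = a * dotp p x.
Proof. by rewrite dotpC dotpZr dotpC. Qed.

Lemma dotpBr p x y : dotp p (x - y) = dotp p x - dotp p y.
Proof. by rewrite dotpDr -scaleN1r dotpZr mulN1r. Qed.

Lemma dotp_delta p i : dotp p (delta_mx ord0 i) = p ord0 i.
Proof.
rewrite /dotp (bigD1 i)//= big1 => [|j ji]; first by rewrite mxE !eqxx mulr1 addr0.
by rewrite mxE (negbTE ji) andbF mulr0.
Qed.

Lemma continuous_dotp p : continuous (dotp p).
Proof.
have -> : dotp p = \sum_i (fun x : Rn => p ord0 i * x ord0 i).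
  by apply/funext => x; rewrite fct_sumE.
elim/big_ind : _ => [|f g cf cg|i _ x]; first exact: cst_continuous.
  by move=> x; apply: continuousD; [exact: cf|exact: cg].
by apply: continuousM; [exact: cst_continuous|exact: (@coord_continuous R 1 n ord0 i)].
Qed.

Lemma sqnorm_ge0 p : 0 <= sqnorm p.
Proof. by apply: sumr_ge0 => i _; rewrite -expr2 sqr_ge0. Qed.

Lemma oneD_sqnorm_ge1 p : 1 <= 1 + sqnorm p.
Proof. by rewrite lerDl sqnorm_ge0. Qed.

(** Converts [n] powers of polynomial decay into domination by the integrable weight; each factor of
    [cauchyw] is at least [1 / (1 + sqnorm p)]. *)
Lemma cauchyw_ge_sqnorm p : 1 <= (1 + sqnorm p) ^+ n * cauchyw p.
Proof.
have s0 : 0 < 1 + sqnorm p by rewrite (lt_le_trans ltr01)// oneD_sqnorm_ge1.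
rewrite mulrC -ler_pdivrMr ?exprn_gt0// div1r -exprVn.
rewrite -[n in _ ^+ n]card_ord -prodr_const; apply: ler_prod => i _.
rewrite invr_ge0 ltW//= lef_pV2 ?posrE// ?ltr_pwDl ?sqr_ge0//.
rewrite lerD2l /sqnorm /dotp (bigD1 i)//= expr2 lerDl.
by apply: sumr_ge0 => j _; rewrite -expr2 sqr_ge0.
Qed.

End dotp_lemmas.

(** * Cosine transforms with a phase and their decay *)

Section oscillatory_integrals.
Context {R : realType} {n : nat}.
Local Notation Rn := 'rV[R]_n.
Local Notation leb := (@lebesgue_rV R n).
Local Notation e_ i := (delta_mx ord0 i : Rn).
Local Notation "''d_' i f" := (fun x : Rn => 'D_(e_ i) f x)
  (at level 10, i at level 0, f at level 9).
Implicit Types (f : Rn -> R) (p q : Rn).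

(* [th = 0] and [th = - pi / 2] give the cosine and sine transforms. *)
Definition osc (th : R) f p : R := \int[leb]_y (cos (dotp p y + th) * f y).

Lemma measurable_cos_dotp p th : measurable_fun setT (fun y => cos (dotp p y + th)).
Proof.
apply: (@measurableT_comp _ _ _ _ _ _ (@cos R)).
  by apply: continuous_measurable_fun; exact: continuous_cos.
by apply: measurable_funD => //; exact: measurable_dotp.
Qed.

Lemma L1_osc th f p : L1 f -> L1 (fun y => cos (dotp p y + th) * f y).
Proof.
apply: (@L1_mulb _ _ _ _ 1); first exact: measurable_cos_dotp.
by move=> x; exact: norm_cos_le1.
Qed.

Lemma osc_le th f p : L1 f -> `|osc th f p| <= \int[leb]_y `|f y|.
Proof.
move=> lf; apply: rint_norm_le; [exact: L1_osc|exact: L1_norm|].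
by move=> x; rewrite normrM ler_piMl// norm_cos_le1.
Qed.

Lemma measurable_osc th f : measurable_fun setT f -> measurable_fun setT (osc th f).
Proof.
move=> mf.
apply: (@measurable_rint _ _ (fun z => cos (dotp z.1 z.2 + th) * f z.2)).
apply: measurable_funM; last exact: measurableT_comp.
apply: (@measurableT_comp _ _ _ _ _ _ (@cos R)).
  by apply: continuous_measurable_fun; exact: continuous_cos.
by apply: measurable_funD => //; exact: measurable_dotp_pair.
Qed.

Lemma is_derive_line0 f (x v : Rn) (d : R) :
  is_derive (0 : R) 1 (fun s => f (x + s *: v)) d -> is_derive x v f d.
Proof.
have E : (fun h : R => h^-1 *: (((fun s => f (x + s *: v)) \o shift 0) (h *: 1)
      - f (x + 0 *: v))) =
    (fun h => h^-1 *: ((f \o shift x) (h *: v) - f x)).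
  by apply/funext => h /=; rewrite scale0r !addr0 [h%:A]mulr1 [x + _]addrC.
by case; rewrite /derivable /derive E => d1 d2; split.
Qed.

Lemma is_derive_cos_dotp p a (y : Rn) i :
  is_derive y (e_ i) (fun y => cos (dotp p y + a)) (- (p ord0 i * sin (dotp p y + a))).
Proof.
apply: is_derive_line0.
rewrite (_ : (fun s => _) = (fun s : R => cos (s * p ord0 i + (dotp p y + a)))).
  apply: is_derive_eq.
  by rewrite /GRing.scale /= mul0r add0r; ring.
by apply/funext => s; rewrite dotpDr dotpZr dotp_delta -addrA addrCA.
Qed.

(** Integration by parts: the derivative of [cos (dotp p y + th + pi / 2) * f y] has integral 0, and
    the sine shifted by [pi / 2] is the original cosine. The sign is absorbed in the phase. *)
Lemma osc_derive th f p i : smooth_cpt f ->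
  p ord0 i * osc th f p = osc (th + pi / 2) ('d_ i f) p.
Proof.
move=> sf; pose a := th + pi / 2; pose g y := cos (dotp p y + a) * f y.
have cf := smooth_cpt_continuous sf.
have sdf := smooth_cpt_derive i sf.
have dg y : is_derive y (e_ i) g
    (cos (dotp p y + a) * 'd_ i f y - p ord0 i * (sin (dotp p y + a) * f y)).
  have df : is_derive y (e_ i) f ('d_ i f y) by apply: DeriveDef => //; exact: smooth_cpt_derivable.
  have := is_deriveM (is_derive_cos_dotp p a y i) df.
  rewrite -[(fun _ => _) * f]/g => h; apply: (is_derive_eq h).
  by rewrite /GRing.scale /=; ring.
have cos_c : continuous (fun y => cos (dotp p y + a)).
  move=> y; apply: (@continuous_comp Rn R R (fun y => dotp p y + a) cos).
    by apply: continuousD; [exact: continuous_dotp|exact: cst_continuous].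
  exact: continuous_cos.
have sin_c : continuous (fun y => sin (dotp p y + a)).
  move=> y; apply: (@continuous_comp Rn R R (fun y => dotp p y + a) sin).
    by apply: continuousD; [exact: continuous_dotp|exact: cst_continuous].
  exact: continuous_sin.
have dgE : 'd_ i g = (fun y => cos (dotp p y + a) * 'd_ i f y -
    p ord0 i * (sin (dotp p y + a) * f y)).
  by apply/funext => y; exact: derive_val.
have lf : L1 f by apply: smooth_L1 => //; exact: sf.2.
have ldf : L1 ('d_ i f).
  by apply: smooth_L1; [exact: smooth_cpt_continuous sdf|exact: sdf.2].
have sinE y : sin (dotp p y + a) = cos (dotp p y + th).
  by rewrite /a addrA sinD cos_pihalf sin_pihalf mulr0 add0r mulr1.
have : \int[leb]_y 'd_ i g y = 0.
  apply: rint_derive.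
  - by move=> y; apply: continuousM; [exact: cos_c|exact: cf].
  - by case: sf => _ [K cK fK]; exists K => // y /fK; rewrite /g => ->; rewrite mulr0.
  - by move=> y; have [] := dg y.
  - have cdf := smooth_cpt_continuous sdf.
    rewrite dgE => y.
    exact: (cvgB (cvgM (cos_c y) (cdf y)) (cvgMl_tmp (cvgM (sin_c y) (cf y)))).
rewrite dgE rintB; [|exact: L1_osc|]; last first.
  by under eq_fun do rewrite sinE; exact/L1Z/L1_osc.
rewrite -/(osc a ('d_ i f) p) => /eqP; rewrite subr_eq0 => /eqP ->.
rewrite -rintZ; last exact: L1_osc.
by apply: eq_Rintegral => y _; rewrite sinE.
Qed.

(** Multiplication by [1 + sqnorm p] amounts to applying the identity minus the Laplacian to [f],
    the sign being carried by a phase shift of [pi]. The bound is uniform in [th] because the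
    induction changes the phase. *)
Lemma osc_decay m f : smooth_cpt f ->
  exists C : R, forall th p, (1 + sqnorm p) ^+ m * `|osc th f p| <= C.
Proof.
elim: m f => [|m IH] f sf.
  exists (\int[leb]_y `|f y|) => th p; rewrite expr0 mul1r osc_le//.
  by apply: smooth_L1; [exact: smooth_cpt_continuous|exact: sf.2].
have [C0 HC0] := IH f sf.
have /choice[C HC] : forall i, exists C : R, forall th p,
    (1 + sqnorm p) ^+ m * `|osc th ('d_ i ('d_ i f)) p| <= C.
  by move=> i; apply/IH/smooth_cpt_derive/smooth_cpt_derive.
exists (C0 + \sum_i C i) => th p.
have s0 : 0 <= 1 + sqnorm p by rewrite (le_trans ler01)// oneD_sqnorm_ge1.
rewrite exprSr -mulrA -[1 + sqnorm p as X in _ * (X * _)]ger0_norm// -normrM.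
have -> : (1 + sqnorm p) * osc th f p =
    osc th f p + \sum_i osc (th + pi / 2 + pi / 2) ('d_ i ('d_ i f)) p.
  rewrite mulrDl mul1r /sqnorm /dotp mulr_suml; congr (_ + _).
  apply: eq_bigr => i _.
  by rewrite -mulrA osc_derive// osc_derive//; exact: smooth_cpt_derive.
apply: (@le_trans _ _ ((1 + sqnorm p) ^+ m * (`|osc th f p| +
    \sum_i `|osc (th + pi / 2 + pi / 2) ('d_ i ('d_ i f)) p|))).
  rewrite ler_wpM2l ?exprn_ge0// (le_trans (ler_normD _ _))// lerD2l.
  exact: ler_norm_sum.
rewrite mulrDr lerD// mulr_sumr; apply: ler_sum => i _; exact: HC.
Qed.

(** Of the [n + 2] powers of decay, [n] pay for [cauchyw]; the 2 that remain compensate the growth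
    of a squared symbol. *)
Lemma osc_dom f : smooth_cpt f -> exists2 C : R, 0 <= C &
  forall th p, (1 + sqnorm p) ^+ 2 * `|osc th f p| <= C * cauchyw p.
Proof.
move=> sf; have [C HC] := osc_decay (n + 2) sf.
have C0 : 0 <= C.
  apply: le_trans (HC 0 0); rewrite mulr_ge0// exprn_ge0//.
  by rewrite (le_trans ler01)// oneD_sqnorm_ge1.
exists C => // th p; have s0 : 0 <= 1 + sqnorm p.
  by rewrite (le_trans ler01)// oneD_sqnorm_ge1.
have w0 : 0 <= cauchyw p by rewrite ltW ?cauchyw_gt0.
apply: (@le_trans _ _ ((1 + sqnorm p) ^+ (n + 2) * `|osc th f p| * cauchyw p)).
  have -> : (1 + sqnorm p) ^+ (n + 2) * `|osc th f p| * cauchyw p =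
     (1 + sqnorm p) ^+ 2 * `|osc th f p| * ((1 + sqnorm p) ^+ n * cauchyw p).
    by rewrite exprD; ring.
  by rewrite ler_peMr ?mulr_ge0 ?exprn_ge0// cauchyw_ge_sqnorm.
by rewrite ler_wpM2r.
Qed.

End oscillatory_integrals.

(** * Abel summation of the inversion integral *)

Section fourier_inversion.
Context {R : realType} {n : nat}.
Local Notation Rn := 'rV[R]_n.
Local Notation leb := (@lebesgue_rV R n).
Implicit Types (f : Rn -> R) (p q x y : Rn).

Lemma L1_laplacew : L1 (@laplacew R n).
Proof.
apply/integrableP; split; first by apply/measurable_EFinP; exact: measurable_laplacew.
have := @integral_laplacew_cos R n 0 0 0; rewrite lexx ler01 => /(_ isT).
under eq_integral do rewrite mul0r addr0 mulr1.
under [in X in _ -> X]eq_integral do rewrite /= ger0_norm ?(ltW (laplacew_gt0 _))//.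
by move=> ->; rewrite ltry.
Qed.

Lemma L1_laplacew_cos x th : L1 (fun p => laplacew p * cos (dotp p x + th)).
Proof.
under eq_fun do rewrite mulrC dotpC.
apply: (@L1_mulb _ _ _ _ 1); [|by move=> p; exact: norm_cos_le1|exact: L1_laplacew].
exact: measurable_cos_dotp.
Qed.

(** The case [k = 1] of [integral_laplacew_cos] minus its case [k = 0]. *)
Lemma rint_laplacew_cos x th :
  \int[leb]_p (laplacew p * cos (dotp p x + th)) = 2 ^+ n * cauchyw x * cos th.
Proof.
have I k : 0 <= k <= 1 ->
    \int[leb]_p (laplacew p * (1 + k * cos (dotp p x + th))) =
    2 ^+ n * (1 + k * cauchyw x * cos th).
  by move=> k01; rewrite /Rintegral (integral_laplacew_cos x th k01).
have I0 : \int[leb]_p laplacew p = 2 ^+ n.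
  have := I 0; rewrite lexx ler01 => /(_ isT); rewrite !mul0r addr0 mulr1 => <-.
  by apply: eq_Rintegral => p _; rewrite mul0r addr0 mulr1.
have := I 1; rewrite lexx ler01 => /(_ isT).
have -> : \int[leb]_p (laplacew p * (1 + 1 * cos (dotp p x + th))) =
    \int[leb]_p (laplacew p + laplacew p * cos (dotp p x + th)).
  by apply: eq_Rintegral => p _; rewrite mul1r mulrDr mulr1.
rewrite (rintD L1_laplacew (L1_laplacew_cos x th)) I0 mul1r mulrDr mulr1.
by move=> /addrI ->; rewrite mulrA.
Qed.

Lemma laplacewZ (h : R) p : 0 <= h ->
  laplacew (h *: p) = expR (- (h * \sum_i `|p ord0 i|)).
Proof.
move=> h0; rewrite /laplacew mulr_sumr -sumrN expR_sum.
by apply: eq_bigr => i _; rewrite mxE normrM ger0_norm.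
Qed.

Lemma cauchywN x : cauchyw (- x) = cauchyw x.
Proof. by apply: eq_bigr => i _; rewrite mxE sqrrN. Qed.

Lemma rint_laplacew_scaled_cos k x th :
  \int[leb]_p (laplacew (k.+1%:R^-1 *: p) * cos (dotp p x + th)) =
  k.+1%:R ^+ n * (2 ^+ n * cauchyw (k.+1%:R *: x) * cos th).
Proof.
pose N : R := k.+1%:R; have N0 : 0 < N by [].
have lN : L1 (fun p => laplacew (N^-1 *: p) * cos (dotp p x + th)).
  have N0' : 0 < N^-1 by rewrite invr_gt0.
  have := L1_affine 0 N0' (L1_laplacew_cos (N *: x) th).
  congr (L1 _); apply/funext => p.
  by rewrite addr0 dotpZr dotpZl mulrA mulfV ?gt_eqF// mul1r.
rewrite (rint_affine 0 N0 lN) -rint_laplacew_cos; congr (_ * _).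
apply: eq_Rintegral => p _.
by rewrite addr0 scalerA mulVf ?gt_eqF// scale1r dotpZl dotpZr.
Qed.

(** For [th = 0] and [th = pi / 2] this is the real part and minus the imaginary part of the
    integral of [exp (i p.(q - y)) f(y)] in [y]. *)
Definition phase_int f q th p : R :=
  \int[leb]_y (cos (dotp p (q - y) + th) * f y).

(* Abel summation with the weight [exp (- |p| / N)], whose transform is a
   Poisson kernel. *)
Lemma phase_int_inversion f q th (B : R) : continuous f -> L1 f ->
  (forall x, `|f x| <= B) -> L1 (phase_int f q th) ->
  \int[leb]_p phase_int f q th p = (2 * pi) ^+ n * cos th * f q.
Proof.
move=> cf lf fB lI; have mf := L1_measurable lf.
pose N k : R := k.+1%:R; have N0 k : 0 < N k by [].
have Ni0 k : 0 < (N k)^-1 by rewrite invr_gt0.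
have Ni_cvg : (N k)^-1 @[k --> \oo] --> (0 : R) by exact: cvg_harmonic.
have lap_cvg : \int[leb]_p (laplacew ((N k)^-1 *: p) * phase_int f q th p)
    @[k --> \oo] --> \int[leb]_p phase_int f q th p.
  have mlap k : measurable_fun setT (fun p : Rn => laplacew ((N k)^-1 *: p)).
    have := L1_measurable (L1_affine 0 (Ni0 k) L1_laplacew).
    by under eq_fun do rewrite addr0.
  apply: (@rint_cvg _ _ _ _ (fun p => `|phase_int f q th p|)).
  - by move=> k; apply: measurable_funM => //; exact: L1_measurable.
  - exact: L1_measurable.
  - move=> p; rewrite -[X in _ --> X]mul1r; apply: cvgMr_tmp.
    pose S := \sum_i `|p ord0 i|.
    rewrite (_ : (fun k : nat => laplacew ((N k)^-1 *: p)) =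
        expR \o (fun k => - ((N k)^-1 * S))); last first.
      by apply/funext => k; rewrite /= laplacewZ// ltW.
    have NS : - ((N k)^-1 * S) @[k --> \oo] --> (0 : R).
      by rewrite -oppr0 -(mul0r S); apply: cvgN; exact: cvgMr_tmp.
    by rewrite -expR0; apply: (cvg_comp _ _ NS); exact: continuous_expR.
  - exact: L1_norm.
  - move=> k p; rewrite normrM ler_piMl// ger0_norm ?laplacew_le1//.
    by rewrite ltW ?laplacew_gt0.
(* Exchanging the integrals leaves [f] integrated against a Cauchy kernel of width [1 / N] centred
   at [q]. *)
have lap_eq k : \int[leb]_p (laplacew ((N k)^-1 *: p) * phase_int f q th p) =
    2 ^+ n * cos th * \int[leb]_z (f ((N k)^-1 *: z + q) * cauchyw z).
  have lw : L1 (fun p => laplacew ((N k)^-1 *: p)).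
    have := L1_affine 0 (Ni0 k) L1_laplacew.
    by under eq_fun do rewrite addr0.
  pose Phi (z : Rn * Rn) :=
    laplacew ((N k)^-1 *: z.1) * (cos (dotp z.1 (q - z.2) + th) * f z.2).
  have mPhi : measurable_fun setT Phi.
    apply: measurable_funM.
      exact: measurableT_comp (L1_measurable lw) _.
    apply: measurable_funM; last exact: measurableT_comp.
    apply: (@measurableT_comp _ _ _ _ _ _ (@cos R)).
      by apply: continuous_measurable_fun; exact: continuous_cos.
    apply: measurable_funD => //.
    rewrite (_ : (fun z => _) = (fun z : Rn * Rn => dotp q z.1 - dotp z.1 z.2)).
      apply: measurable_funB; last exact: measurable_dotp_pair.
      exact: measurableT_comp (measurable_dotp q) _.
    by apply/funext => z; rewrite dotpBr (dotpC z.1 q).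
  have cosL p : L1 (fun y => cos (dotp p (q - y) + th) * f y).
    apply: (@L1_mulb _ _ _ _ 1) => //; last by move=> z; exact: norm_cos_le1.
    rewrite (_ : (fun y => _) = (fun y => cos (dotp (- p) y + (dotp p q + th)))).
      exact: measurable_cos_dotp.
    apply/funext => z; rewrite dotpBr -[- p]scaleN1r dotpZl mulN1r; congr cos.
    by rewrite addrA [- _ + _]addrC.
  transitivity (\int[leb]_p \int[leb]_y Phi (p, y)).
    apply: eq_Rintegral => p _; rewrite /phase_int -rintZ//; exact: (cosL p).
  rewrite (@rint_fubini _ _ Phi (fun p => laplacew ((N k)^-1 *: p)) (fun y => `|f y|))//; last 2 first.
  - exact: L1_norm.
  - move=> p y; rewrite /Phi /= !normrM ger0_norm; last by rewrite ltW ?laplacew_gt0.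
    rewrite ler_wpM2l ?(ltW (laplacew_gt0 _))//.
    by rewrite ler_piMl// norm_cos_le1.
  pose g y := N k ^+ n * (2 ^+ n * cauchyw (N k *: (q - y)) * cos th) * f y.
  have gE y : \int[leb]_p Phi (p, y) = g y.
    rewrite /g -rint_laplacew_scaled_cos mulrC -rintZ.
      by apply: eq_Rintegral => p _; rewrite /Phi /= mulrA mulrC.
    under eq_fun do rewrite mulrC dotpC.
    apply: (@L1_mulb _ _ _ _ 1) => //; first exact: measurable_cos_dotp.
    by move=> p; exact: norm_cos_le1.
  under eq_Rintegral do rewrite gE.
  have cwq : L1 (fun y => cauchyw (N k *: (q - y)) * f y).
    apply: (@L1_mulb _ _ _ _ 1) => //.
      have := measurableT_comp (@measurable_cauchyw R n) (measurable_affine_rV (- N k) (N k *: q)).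
      congr (measurable_fun _ _); apply/funext => y /=.
      by rewrite scalerBr scaleNr addrC.
    move=> y; rewrite ger0_norm ?(ltW (cauchyw_gt0 _))//.
    by apply: prodr_ile1 => i _; rewrite invr_ge0 addr_ge0 ?sqr_ge0//= invf_le1 ?lerDl ?sqr_ge0// ltr_pwDl// sqr_ge0.
  have lg : L1 g.
    have := L1Z (N k ^+ n * 2 ^+ n * cos th) cwq.
    by congr (L1 _); apply/funext => y; rewrite /g; ring.
  (* The substitution [y = z / N + q] absorbs the factor [N ^ n] and moves the scaling from the
     kernel to [f]. *)
  rewrite (rint_affine q (Ni0 k) lg).
  have lfc : L1 (fun z => f ((N k)^-1 *: z + q) * cauchyw z).
    apply: (@L1_mulb _ _ _ _ B); last exact: L1_cauchyw.
    - exact: measurableT_comp mf (measurable_affine_rV _ _).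
    - by move=> z; exact: fB.
  rewrite -(rintZ _ lfc) -rintZ.
    apply: eq_Rintegral => z _; rewrite /g opprD addrCA subrr addr0.
    rewrite scalerN scalerA mulfV ?gt_eqF// scale1r cauchywN.
    rewrite exprVn -[N k ^+ n * _ * _]mulrA mulKf ?expf_neq0 ?gt_eqF//.
    by rewrite -!mulrA [cauchyw z * _]mulrC -!mulrA.
  exact: L1_affine.
have lim2 : 2 ^+ n * cos th * \int[leb]_z (f ((N k)^-1 *: z + q) * cauchyw z)
    @[k --> \oo] --> 2 ^+ n * cos th * \int[leb]_z (f q * cauchyw z).
  apply: cvgMl_tmp; apply: (@rint_cvg _ _ _ _ (fun z => B * cauchyw z)).
  - move=> k; apply: measurable_funM; last exact: measurable_cauchyw.
    exact: measurableT_comp mf (measurable_affine_rV _ _).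
  - by apply: measurable_funM => //; exact: measurable_cauchyw.
  - move=> z; apply: cvgMr_tmp.
    have Nz : (N k)^-1 *: z + q @[k --> \oo] --> q.
      rewrite -[q in X in _ --> X]add0r -(scale0r z).
      by apply: cvgD; [exact: cvgZr_tmp|exact: cvg_cst].
    by apply: (cvg_comp _ _ Nz); exact: cf.
  - exact/L1Z/L1_cauchyw.
  - move=> k z; rewrite normrM [`|cauchyw z|]ger0_norm ?(ltW (cauchyw_gt0 _))//.
    by rewrite ler_wpM2r ?fB// ltW ?cauchyw_gt0.
have -> : (2 * pi) ^+ n * cos th * f q = 2 ^+ n * cos th * \int[leb]_z (f q * cauchyw z).
  rewrite rintZ; last exact: L1_cauchyw.
  rewrite /Rintegral integral_cauchyw /= exprMn; ring.
move: lap_cvg; under eq_fun do rewrite lap_eq.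
by move=> /cvg_unique; apply.
Qed.

End fourier_inversion.

(** * Complex-valued integrals through real and imaginary parts *)

Section complex_integrals.
Context {R : realType} {n : nat}.
Local Notation Rn := 'rV[R]_n.
Local Notation leb := (@lebesgue_rV R n).
Local Notation Re := complex.Re.
Local Notation Im := complex.Im.
Implicit Types (f g : Rn -> R[i]) (z w : R[i]).

Lemma Re_le_norm z : `|Re z| <= Re `|z|.
Proof. by rewrite -lecR ReC_norm normc_ge_Re. Qed.

Lemma Im_le_norm z : `|Im z| <= Re `|z|.
Proof.
case: z => a b; rewrite normc_def /= -sqrtr_sqr ler_sqrt ?addr_ge0 ?sqr_ge0//.
by rewrite lerDr sqr_ge0.
Qed.

Lemma norm_le_ReIm z : Re `|z| <= `|Re z| + `|Im z|.
Proof.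
case: z => a b; rewrite normc_def /= -[leRHS]ger0_norm ?addr_ge0//.
rewrite -sqrtr_sqr ler_sqrt ?sqr_ge0//.
by rewrite sqrrD addrAC !real_normK ?num_real// lerDl mulrn_wge0// mulr_ge0.
Qed.

Lemma cReM z w : Re (z * w) = Re z * Re w - Im z * Im w.
Proof. by case: z => ? ?; case: w. Qed.

Lemma cImM z w : Im (z * w) = Re z * Im w + Im z * Re w.
Proof. by case: z => ? ?; case: w. Qed.

Lemma complex_split z : z = Re z +i* Im z.
Proof. by case: z. Qed.

Definition Cmeasurable f :=
  measurable_fun setT (fun x => Re (f x)) /\ measurable_fun setT (fun x => Im (f x)).

Definition CL1 f := L1 (fun x => Re (f x)) /\ L1 (fun x => Im (f x)).

Local Notation cint f := (Cintegral leb setT f).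

Lemma CmeasurableM f g : Cmeasurable f -> Cmeasurable g ->
  Cmeasurable (fun x => f x * g x).
Proof.
move=> [rf jf] [rg jg]; split.
  by under eq_fun do rewrite cReM; apply: measurable_funB; exact: measurable_funM.
by under eq_fun do rewrite cImM; apply: measurable_funD; exact: measurable_funM.
Qed.

Lemma CL1_dom f (C : R) : Cmeasurable f ->
  (forall x, Re `|f x| <= C * cauchyw x) -> CL1 f.
Proof.
move=> [rf jf] fC; split; apply: (@L1_dom _ _ _ C) => // x.
  exact: le_trans (Re_le_norm _) (fC x).
exact: le_trans (Im_le_norm _) (fC x).
Qed.

Lemma cintD f g : CL1 f -> CL1 g ->
  cint (fun x => f x + g x) = cint f + cint g.
Proof.
move=> [rf jf] [rg jg]; rewrite /Cintegral.
under eq_Rintegral do rewrite raddfD /=.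
under [in X in _ +i* X]eq_Rintegral do rewrite raddfD /=.
by rewrite (rintD rf rg) (rintD jf jg).
Qed.

Lemma cintZ a f : CL1 f -> cint (fun x => a * f x) = a * cint f.
Proof.
move=> [rf jf]; rewrite /Cintegral.
under eq_Rintegral do rewrite cReM.
under [in X in _ +i* X]eq_Rintegral do rewrite cImM.
rewrite (rintB (L1Z _ rf) (L1Z _ jf)) (rintD (L1Z _ jf) (L1Z _ rf)).
rewrite (rintZ _ rf) (rintZ _ jf) [in RHS](complex_split a) (rintZ _ jf) (rintZ _ rf).
by [].
Qed.

Lemma eq_cint f g : f =1 g -> cint f = cint g.
Proof. by move=> /funext ->. Qed.

Lemma CL1Z a f : CL1 f -> CL1 (fun x => a * f x).
Proof.
move=> [rf jf]; split.
  by under eq_fun do rewrite cReM; apply: L1B; exact: L1Z.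
by under eq_fun do rewrite cImM; apply: L1D; exact: L1Z.
Qed.

(** The factor 2 comes from bounding the real and the imaginary part separately. *)
Lemma cint_le f (g : Rn -> R) : CL1 f -> L1 g ->
  (forall x, Re `|f x| <= g x) -> Re `|cint f| <= 2 * \int[leb]_x g x.
Proof.
move=> [rf jf] lg fg; rewrite (le_trans (norm_le_ReIm _))// mulr_natl mulr2n /=.
by rewrite lerD//; apply: rint_norm_le => // x;
  [exact: le_trans (Re_le_norm _) (fg x)|exact: le_trans (Im_le_norm _) (fg x)].
Qed.

End complex_integrals.

(** * Taylor bounds for the exponential on the right half-plane *)

Section complex_exponential.
Context {R : realType}.
Local Notation Re := complex.Re.
Local Notation Im := complex.Im.
Implicit Types (z w : R[i]) (x b : R).

Lemma expCi x : expC ('i%C * x%:C) = cos x +i* sin x.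
Proof.
rewrite /expC cReM cImM /= !mul0r !mul1r subr0 add0r expR0.
by apply/eqP; rewrite eq_complex /= !mul0r subr0 !mul1r addr0 !eqxx.
Qed.

Lemma expCNi x : expC (- ('i%C * x%:C)) = cos x -i* sin x.
Proof.
by rewrite -mulrN -rmorphN /= expCi cosN sinN.
Qed.

Lemma expCD z w : expC (z + w) = expC z * expC w.
Proof.
case: z => a b; case: w => c d; rewrite /expC /= expRD cosD sinD.
apply/eqP; rewrite eq_complex /= !mul0r !subr0 !addr0.
by apply/andP; split; apply/eqP; ring.
Qed.

Lemma norm_expC z : Re `|expC z| = expR (Re z).
Proof.
rewrite /expC Re_normM !normc_def /= expr0n /= addr0 sqrtr_sqr ger0_norm ?expR_ge0//.
by rewrite cos2Dsin2 sqrtr1 mulr1.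
Qed.

Lemma norm_expCi x : Re `|expC ('i%C * x%:C)| = 1.
Proof. by rewrite norm_expC cReM /= mul0r mulr0 subrr expR0. Qed.

Lemma norm_expCNi x : Re `|expC (- ('i%C * x%:C))| = 1.
Proof. by rewrite -mulrN -rmorphN; exact: norm_expCi. Qed.

Lemma Re_normMr x z : 0 <= x -> Re `|x%:C * z| = x * Re `|z|.
Proof.
by move=> x0; rewrite Re_normM [`|x%:C|]normc_def /= expr0n /= addr0 sqrtr_sqr ger0_norm.
Qed.

Lemma abs_sin_le b : `|sin b| <= `|b|.
Proof.
wlog b0 : b / 0 <= b => [wl|].
  have [b0|b0] := leP 0 b; first exact: wl.
  by have := wl (- b); rewrite sinN !normrN; apply; rewrite oppr_ge0 ltW.
have [|c _] := @MVT_segment R sin cos 0 b b0 (fun x _ => is_derive_sin x).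
  by apply: continuous_subspaceT; exact: continuous_sin.
rewrite sin0 !subr0 => ->; rewrite normrM ler_piMl//.
exact: norm_cos_le1.
Qed.

Lemma abs_cos1_le b : `|1 - cos b| <= `|b|.
Proof.
wlog b0 : b / 0 <= b => [wl|].
  have [b0|b0] := leP 0 b; first exact: wl.
  by rewrite -(opprK b) cosN normrN wl// oppr_ge0 ltW.
have [|c _] := @MVT_segment R cos (fun x => - sin x) 0 b b0 (fun x _ => is_derive_cos x).
  by apply: continuous_subspaceT; exact: continuous_cos.
rewrite cos0 subr0 distrC => ->; rewrite normrM normrN ler_piMl//.
exact: sin_max.
Qed.

Lemma cos1_le_sqr b : `|1 - cos b| <= b ^+ 2.
Proof.
wlog b0 : b / 0 <= b => [wl|].
  have [b0|b0] := leP 0 b; first exact: wl.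
  by rewrite -(opprK b) cosN sqrrN wl// oppr_ge0 ltW.
have [|c] := @MVT_segment R cos (fun x => - sin x) 0 b b0 (fun x _ => is_derive_cos x).
  by apply: continuous_subspaceT; exact: continuous_cos.
rewrite in_itv /= => /andP[c0 cb]; rewrite cos0 subr0 distrC => ->.
rewrite normrM normrN (ger0_norm b0) expr2 ler_wpM2r//.
by rewrite (le_trans (abs_sin_le _))// ger0_norm.
Qed.

Lemma sin_id_le_sqr b : `|b - sin b| <= b ^+ 2.
Proof.
wlog b0 : b / 0 <= b => [wl|].
  have [b0|b0] := leP 0 b; first exact: wl.
  by rewrite -normrN opprB -[sin b]opprK -sinN addrC -sqrrN wl// oppr_ge0 ltW.
have [|c] := @MVT_segment R sin cos 0 b b0 (fun x _ => is_derive_sin x).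
  by apply: continuous_subspaceT; exact: continuous_sin.
rewrite in_itv /= => /andP[c0 cb]; rewrite sin0 !subr0 => ->.
rewrite -{1}[b]mul1r -mulrBl normrM (ger0_norm b0) expr2 ler_wpM2r//.
by rewrite (le_trans (abs_cos1_le _))// ger0_norm.
Qed.

Lemma abs_expRN1_le x : 0 <= x -> `|1 - expR (- x)| <= x.
Proof.
move=> x0; rewrite ger0_norm; last by rewrite subr_ge0 -expR0 ler_expR oppr_le0.
by have := expR_ge1Dx (- x); lra.
Qed.

Lemma expRN1D_le x : 0 <= x -> `|expR (- x) - 1 + x| <= x ^+ 2.
Proof.
move=> x0; rewrite ger0_norm; last by have := expR_ge1Dx (- x); lra.
have x1 : 0 < 1 + x by rewrite ltr_pwDl.
have : expR (- x) <= (1 + x)^-1 by rewrite expRN lef_pV2 ?posrE ?expR_gt0// expR_ge1Dx.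
have -> : (1 + x)^-1 = 1 - x + x ^+ 2 / (1 + x) by field; rewrite gt_eqF.
have : x ^+ 2 / (1 + x) <= x ^+ 2 by rewrite ler_pdivrMr// ler_peMr ?sqr_ge0// lerDl.
lra.
Qed.

(** With [z = a + i b], the real part is at most [a + |b|] and the imaginary part at most [|b|],
    thanks to [exp (- a) <= 1]. *)
Lemma norm_expCN1_le z : 0 <= Re z -> Re `|expC (- z) - 1| <= 3 * Re `|z|.
Proof.
case: z => a b; rewrite [Re (a +i* b)]/= => a0.
apply: (le_trans (norm_le_ReIm _)).
set N := Re `|a +i* b|.
have ha : a <= N by rewrite -(ger0_norm a0); exact: (Re_le_norm (a +i* b)).
have hb : `|b| <= N by exact: (Im_le_norm (a +i* b)).
have -> : Re (expC (- (a +i* b)) - 1) = expR (- a) * cos b - 1.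
  by rewrite /expC /= cosN mul0r subr0.
have -> : Im (expC (- (a +i* b)) - 1) = expR (- a) * - sin b.
  by rewrite /expC /= sinN mul0r addr0 oppr0 addr0.
have e1 : expR (- a) <= 1 by rewrite -expR0 ler_expR oppr_le0.
have h1 : `|expR (- a) * cos b - 1| <= a + `|b|.
  have -> : expR (- a) * cos b - 1 = - (1 - expR (- a)) * cos b - (1 - cos b) by ring.
  rewrite (le_trans (ler_normB _ _))// lerD ?abs_cos1_le// normrM normrN.
  by rewrite -[leRHS]mulr1 ler_pM// ?abs_expRN1_le// norm_cos_le1.
have h2 : `|expR (- a) * - sin b| <= `|b|.
  rewrite normrM normrN ger0_norm ?expR_ge0//.
  by rewrite -[leRHS]mul1r ler_pM// ?expR_ge0// abs_sin_le.
by move: h1 h2 ha hb; lra.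
Qed.

(** With [z = a + i b], the real part is at most [a^2 + b^2] and the imaginary part at most
    [b^2 + a |b|]: four terms, each below [|z|^2]. *)
Lemma norm_expCN1D_le z : 0 <= Re z ->
  Re `|expC (- z) - 1 + z| <= 4 * (Re `|z|) ^+ 2.
Proof.
case: z => a b; rewrite [Re (a +i* b)]/= => a0.
apply: (le_trans (norm_le_ReIm _)).
set N := Re `|a +i* b|.
have ha : a <= N by rewrite -(ger0_norm a0); exact: (Re_le_norm (a +i* b)).
have hb : `|b| <= N by exact: (Im_le_norm (a +i* b)).
have N0 : 0 <= N by exact: Re_norm_ge0.
have -> : Re (expC (- (a +i* b)) - 1 + (a +i* b)) = expR (- a) * cos b - 1 + a.
  by rewrite /expC /= cosN mul0r subr0.
have -> : Im (expC (- (a +i* b)) - 1 + (a +i* b)) = expR (- a) * - sin b + b.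
  by rewrite /expC /= sinN mul0r addr0 oppr0 addr0.
have e1 : expR (- a) <= 1 by rewrite -expR0 ler_expR oppr_le0.
have aN : a ^+ 2 <= N ^+ 2 by rewrite lerXn2r ?nnegrE.
have bN : b ^+ 2 <= N ^+ 2 by rewrite -real_normK ?num_real// lerXn2r ?nnegrE.
have abN : a * `|b| <= N ^+ 2 by rewrite expr2 ler_pM.
have h1 : `|expR (- a) * cos b - 1 + a| <= a ^+ 2 + b ^+ 2.
  have -> : expR (- a) * cos b - 1 + a = (expR (- a) - 1 + a) - expR (- a) * (1 - cos b) by ring.
  rewrite (le_trans (ler_normB _ _))// lerD ?expRN1D_le// normrM ger0_norm ?expR_ge0//.
  by rewrite -[leRHS]mul1r ler_pM ?expR_ge0// cos1_le_sqr.
have h2 : `|expR (- a) * - sin b + b| <= b ^+ 2 + a * `|b|.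
  have -> : expR (- a) * - sin b + b = (b - sin b) + (1 - expR (- a)) * sin b by ring.
  rewrite (le_trans (ler_normD _ _))// lerD ?sin_id_le_sqr// normrM.
  by rewrite ler_pM// ?abs_expRN1_le// abs_sin_le.
by move: h1 h2 aN bN abN; lra.
Qed.

End complex_exponential.

(** * Fourier transform of test functions and operators with a frozen symbol *)

Section fourier_transform.
Context {R : realType} {n : nat}.
Local Notation Rn := 'rV[R]_n.
Local Notation leb := (@lebesgue_rV R n).
Local Notation Re := complex.Re.
Local Notation Im := complex.Im.
Local Notation cint f := (Cintegral leb setT f).
Implicit Types (phi psi : Rn -> R[i]) (p q x y : Rn) (s : Rn -> R[i]).

Lemma Cc_smooth_Re phi : Cc_smooth phi -> smooth_cpt (fun x => Re (phi x)).
Proof.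
move=> [sm cK]; split; first by move=> k; case: (sm k).
exists (closure [set x | phi x != 0]) => // x Kx.
have [->//|x0] := eqVneq (phi x) 0.
by exfalso; apply: Kx; exact: subset_closure.
Qed.

Lemma Cc_smooth_Im phi : Cc_smooth phi -> smooth_cpt (fun x => Im (phi x)).
Proof.
move=> [sm cK]; split; first by move=> k; case: (sm k).
exists (closure [set x | phi x != 0]) => // x Kx.
have [->//|x0] := eqVneq (phi x) 0.
by exfalso; apply: Kx; exact: subset_closure.
Qed.

Lemma smooth_cpt_L1 (f : Rn -> R) : smooth_cpt f -> L1 f.
Proof.
by move=> sf; apply: smooth_L1; [exact: smooth_cpt_continuous|exact: sf.2].
Qed.

Lemma Cc_smooth_CL1 phi : Cc_smooth phi -> CL1 phi.
Proof.
move=> sphi; split; apply: smooth_cpt_L1.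
  exact: Cc_smooth_Re.
exact: Cc_smooth_Im.
Qed.

Lemma Cmeasurable_expCi q : Cmeasurable (fun p => expC ('i%C * (dotp p q)%:C)).
Proof.
split; under eq_fun do rewrite expCi /= dotpC.
  have := measurable_cos_dotp q 0.
  by under eq_fun do rewrite addr0.
apply: (@measurableT_comp _ _ _ _ _ _ (@sin R)); last exact: measurable_dotp.
by apply: continuous_measurable_fun; exact: continuous_sin.
Qed.

Lemma Cmeasurable_expCNi p : Cmeasurable (fun q => expC (- ('i%C * (dotp p q)%:C))).
Proof.
have := Cmeasurable_expCi (- p).
rewrite (_ : (fun q => expC ('i%C * _)) = fun q => expC (- ('i%C * (dotp p q)%:C)))//.
by apply/funext => q; rewrite dotpC -scaleN1r dotpZl mulN1r rmorphN mulrN.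
Qed.

Lemma fourier_CL1 phi p : Cc_smooth phi ->
  CL1 (fun q => expC (- ('i%C * (dotp p q)%:C)) * phi q).
Proof.
move=> /Cc_smooth_CL1[rf jf]; have [mr mi] := Cmeasurable_expCNi p.
have b1 q : `|Re (expC (- ('i%C * (dotp p q)%:C)))| <= 1.
  by rewrite (le_trans (Re_le_norm _))// norm_expCNi.
have b2 q : `|Im (expC (- ('i%C * (dotp p q)%:C)))| <= 1.
  by rewrite (le_trans (Im_le_norm _))// norm_expCNi.
split.
  under eq_fun do rewrite cReM; apply: L1B.
    exact: (L1_mulb mr b1 rf).
  exact: (L1_mulb mi b2 jf).
under eq_fun do rewrite cImM; apply: L1D.
  exact: (L1_mulb mr b1 jf).
exact: (L1_mulb mi b2 rf).
Qed.

Lemma fourier_linear (a : R[i]) phi psi p : Cc_smooth phi -> Cc_smooth psi ->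
  fourier (fun q => a * phi q + psi q) p = a * fourier phi p + fourier psi p.
Proof.
move=> sphi spsi; have l1 := fourier_CL1 p sphi; have l2 := fourier_CL1 p spsi.
rewrite /fourier mulrCA -mulrDr -(cintZ a l1) -(cintD (CL1Z a l1) l2).
by congr (_ * _); apply: eq_cint => q; rewrite mulrDr mulrCA.
Qed.

Let r : R := (2 * pi) `^ (- (n%:R / 2)).

Lemma fourier_scale_ge0 : 0 <= r. Proof. exact: powR_ge0. Qed.

Lemma fourier_scale_sqr : r * r * (2 * pi) ^+ n = 1.
Proof.
have p0 : 0 < 2 * pi :> R by rewrite mulr_gt0// pi_gt0.
rewrite /r -powRD ?(gt_eqF p0) ?implybT// -opprD -splitr powRN powR_mulrn ?(ltW p0)//.
by rewrite mulVf// expf_neq0// gt_eqF.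
Qed.

(** Reduces measurability and decay of the transform to those of [osc]. *)
Lemma fourierE phi p : Cc_smooth phi -> fourier phi p =
  r%:C * ((osc 0 (fun x => Re (phi x)) p + osc (- (pi / 2)) (fun x => Im (phi x)) p) +i*
          (osc 0 (fun x => Im (phi x)) p - osc (- (pi / 2)) (fun x => Re (phi x)) p)).
Proof.
move=> sphi; have lr := smooth_cpt_L1 (Cc_smooth_Re sphi).
have li := smooth_cpt_L1 (Cc_smooth_Im sphi).
have sinE (x : R) : sin x = cos (x + - (pi / 2)) :> R.
  by rewrite cosD cosN sinN cos_pihalf sin_pihalf mulr0 mulrN1 opprK add0r.
rewrite /fourier /fourier_const -/r; congr (_ * _); rewrite /Cintegral.
congr (_ +i* _).
  rewrite /osc -rintD; [|exact: L1_osc|exact: L1_osc].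
  apply: eq_Rintegral => y _; rewrite expCNi cReM /= mulNr opprK addr0.
  by rewrite -sinE.
rewrite /osc -rintB; [|exact: L1_osc|exact: L1_osc].
apply: eq_Rintegral => y _; rewrite expCNi cImM /= mulNr addr0.
by rewrite -sinE.
Qed.

Lemma Cmeasurable_fourier phi : Cc_smooth phi -> Cmeasurable (fourier phi).
Proof.
move=> sphi; have mr := L1_measurable (smooth_cpt_L1 (Cc_smooth_Re sphi)).
have mi := L1_measurable (smooth_cpt_L1 (Cc_smooth_Im sphi)).
split; under eq_fun do rewrite (fourierE _ sphi).
  under eq_fun do rewrite cReM /= mul0r subr0.
  apply: measurable_funM => //.
  by apply: measurable_funD; exact: measurable_osc.
under eq_fun do rewrite cImM /= mul0r addr0.
apply: measurable_funM => //.
by apply: measurable_funB; exact: measurable_osc.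
Qed.

Lemma fourier_dom phi : Cc_smooth phi -> exists2 C : R, 0 <= C &
  forall p, (1 + sqnorm p) ^+ 2 * Re `|fourier phi p| <= C * cauchyw p.
Proof.
move=> sphi; have [C1 C10 HC1] := osc_dom (Cc_smooth_Re sphi).
have [C2 C20 HC2] := osc_dom (Cc_smooth_Im sphi).
exists (r * (2 * (C1 + C2))); first by rewrite !mulr_ge0 ?addr_ge0 ?fourier_scale_ge0.
move=> p; rewrite (fourierE p sphi).
rewrite (Re_normMr _ fourier_scale_ge0).
rewrite mulrCA -mulrA ler_wpM2l ?fourier_scale_ge0//.
set A := osc 0 _ p; set B := osc _ _ p; set C := osc 0 _ p; set D := osc _ _ p.
have s0 : 0 <= (1 + sqnorm p) ^+ 2 by rewrite exprn_ge0// addr_ge0// sqnorm_ge0.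
have HA := HC1 0 p; have HD := HC1 (- (pi / 2)) p.
have HB := HC2 (- (pi / 2)) p; have HC := HC2 0 p.
rewrite -/A -/D in HA HD; rewrite -/B -/C in HB HC.
apply: (@le_trans _ _ ((1 + sqnorm p) ^+ 2 * (`|A| + `|B| + (`|C| + `|D|)))).
  rewrite ler_wpM2l// (le_trans (norm_le_ReIm _))//= lerD//.
    exact: ler_normD.
  exact: ler_normB.
move: HA HB HC HD; lra.
Qed.

(** The exponent 2 accommodates [|H|^2], the size of the second-order remainder. The constant is
    explicit because it carries the dependence on time. *)
Definition tame (b : R) s := [/\ 0 <= b, Cmeasurable s &
  forall p, Re `|s p| <= b * (1 + sqnorm p) ^+ 2].

(* The symbol is frozen at [q]: [pdo S phi q] unfolds to [pd (S q) phi q]. *)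
Definition pd s phi q : R[i] := fourier_const (R := R) (d := n) *
  cint (fun p => expC ('i%C * (dotp p q)%:C) * s p * fourier phi p).

Lemma pd_le_cauchyw s b phi q : tame b s -> Cc_smooth phi ->
  forall C, (forall p, (1 + sqnorm p) ^+ 2 * Re `|fourier phi p| <= C * cauchyw p) ->
  forall p, Re `|expC ('i%C * (dotp p q)%:C) * s p * fourier phi p| <= b * C * cauchyw p.
Proof.
move=> [b0 ms sb] sphi C HC p; rewrite 2!Re_normM norm_expCi mul1r.
rewrite -mulrA (le_trans (ler_wpM2r (Re_norm_ge0 _) (sb p)))//.
by rewrite -mulrA ler_wpM2l.
Qed.

Lemma pd_CL1 s b phi q : tame b s -> Cc_smooth phi ->
  CL1 (fun p => expC ('i%C * (dotp p q)%:C) * s p * fourier phi p).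
Proof.
move=> ts sphi; have [C C0 HC] := fourier_dom sphi.
apply: (@CL1_dom _ _ _ (b * C)); last exact: pd_le_cauchyw.
apply: CmeasurableM; last exact: Cmeasurable_fourier.
by apply: CmeasurableM; [exact: Cmeasurable_expCi|case: ts].
Qed.

(** The constant depends on [phi] alone: the bound is linear in [b] and uniform in [q] and in the
    symbol, so an estimate on symbols becomes an estimate in the supremum norm. *)
Lemma pd_le phi : Cc_smooth phi -> exists2 C : R, 0 <= C &
  forall s b q, tame b s -> Re `|pd s phi q| <= b * C.
Proof.
move=> sphi; have [C C0 HC] := fourier_dom sphi.
have I0 : 0 <= \int[leb]_p cauchyw p.
  by apply: Rintegral_ge0 => p _; rewrite ltW ?cauchyw_gt0.
exists (r * (2 * (C * \int[leb]_p cauchyw p))).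
  by rewrite !mulr_ge0 ?fourier_scale_ge0.
move=> s b q ts; rewrite /pd /fourier_const -/r (Re_normMr _ fourier_scale_ge0).
rewrite mulrCA ler_wpM2l ?fourier_scale_ge0//.
have := cint_le (pd_CL1 q ts sphi) (L1Z (b * C) (@L1_cauchyw R n)) (pd_le_cauchyw q ts sphi HC).
rewrite (rintZ _ (@L1_cauchyw R n)) => /le_trans; apply.
by rewrite le_eqVlt; apply/orP; left; apply/eqP; ring.
Qed.

Lemma pd_comb (a : R[i]) s s' b b' phi q : tame b s -> tame b' s' -> Cc_smooth phi ->
  pd (fun p => a * s p + s' p) phi q = a * pd s phi q + pd s' phi q.
Proof.
move=> ts ts' sphi; have l1 := pd_CL1 q ts sphi; have l2 := pd_CL1 q ts' sphi.
rewrite /pd mulrCA -mulrDr -(cintZ a l1) -(cintD (CL1Z a l1) l2).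
congr (_ * _); apply: eq_cint => p; rewrite mulrDr mulrDl; congr (_ + _).
by move: (expC _) (fourier _ _) => u v; ring.
Qed.

Lemma pd_linear (a : R[i]) s b phi psi q : tame b s -> Cc_smooth phi -> Cc_smooth psi ->
  pd s (fun x => a * phi x + psi x) q = a * pd s phi q + pd s psi q.
Proof.
move=> ts sphi spsi; have l1 := pd_CL1 q ts sphi; have l2 := pd_CL1 q ts spsi.
rewrite /pd mulrCA -mulrDr -(cintZ a l1) -(cintD (CL1Z a l1) l2).
congr (_ * _); apply: eq_cint => p.
by rewrite fourier_linear// mulrDr mulrCA.
Qed.

(** Expands the cosine of a difference, which expresses phase integrals by the same transforms as in
    [fourierE]. *)
Lemma phase_intE (f : Rn -> R) q th p : L1 f -> phase_int f q th p =
  cos (dotp p q + th) * osc 0 f p + sin (dotp p q + th) * osc (- (pi / 2)) f p.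
Proof.
move=> lf; rewrite /osc -!rintZ ?L1_osc// -rintD; last 2 first.
- exact/L1Z/L1_osc.
- exact/L1Z/L1_osc.
apply: eq_Rintegral => y _; rewrite !mulrA -mulrDl; congr (_ * _).
have -> : cos (dotp p y + - (pi / 2)) = sin (dotp p y) :> R.
  by rewrite cosD cosN sinN cos_pihalf sin_pihalf mulr0 mulrN1 opprK add0r.
by rewrite addr0 dotpBr addrAC cosB.
Qed.

Lemma L1_phase_int (f : Rn -> R) q th : smooth_cpt f -> L1 (phase_int f q th).
Proof.
move=> sf; have lf := smooth_cpt_L1 sf; have mf := L1_measurable lf.
have [C C0 HC] := osc_dom sf.
have osc_w t p : `|osc t f p| <= C * cauchyw p.
  apply: le_trans (HC t p); rewrite ler_peMl//.
  by rewrite exprn_ege1// oneD_sqnorm_ge1.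
apply: (@L1_dom _ _ _ (2 * C)).
  rewrite (_ : phase_int f q th = fun p => cos (dotp p q + th) * osc 0 f p +
      sin (dotp p q + th) * osc (- (pi / 2)) f p); last first.
    by apply/funext => p; exact: phase_intE.
  apply: measurable_funD; apply: measurable_funM; try exact: measurable_osc.
    by under eq_fun do rewrite dotpC; exact: measurable_cos_dotp.
  apply: (@measurableT_comp _ _ _ _ _ _ (@sin R)).
    by apply: continuous_measurable_fun; exact: continuous_sin.
  by apply: measurable_funD => //; under eq_fun do rewrite dotpC; exact: measurable_dotp.
move=> p; rewrite (phase_intE q th p lf) (le_trans (ler_normD _ _))//.
rewrite -mulrA mulr_natl mulr2n lerD// normrM.
  by rewrite (le_trans _ (osc_w 0 p))// ler_piMl// norm_cos_le1.
by rewrite (le_trans _ (osc_w (- (pi / 2)) p))// ler_piMl// sin_max.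
Qed.

Lemma smooth_cpt_inversion (f : Rn -> R) q th : smooth_cpt f ->
  \int[leb]_p phase_int f q th p = (2 * pi) ^+ n * cos th * f q.
Proof.
move=> sf; have cf := smooth_cpt_continuous sf.
have [B _ fB] := cpt_supp_bounded cf sf.2.
by apply: (phase_int_inversion cf (smooth_cpt_L1 sf) fB); exact: L1_phase_int.
Qed.

(** Both parts of the integrand are combinations of phase integrals with [th = 0] and [th = pi / 2].
    Inversion produces the factor [cos th], so the latter vanish and the former give [phi q]. *)
Lemma pd1 phi q : Cc_smooth phi -> pd (fun=> 1) phi q = phi q.
Proof.
move=> sphi; have sr := Cc_smooth_Re sphi; have si := Cc_smooth_Im sphi.
pose f x := Re (phi x); pose g x := Im (phi x).
have lf : L1 f by exact: smooth_cpt_L1.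
have lg : L1 g by exact: smooth_cpt_L1.
have integrandE p : expC ('i%C * (dotp p q)%:C) * 1 * fourier phi p =
    (r * (phase_int f q 0 p + phase_int g q (pi / 2) p)) +i*
    (r * (phase_int g q 0 p - phase_int f q (pi / 2) p)).
  rewrite mulr1 expCi (fourierE p sphi) -/f -/g.
  rewrite (phase_intE q 0 p lf) (phase_intE q 0 p lg).
  rewrite (phase_intE q (pi / 2) p lf) (phase_intE q (pi / 2) p lg).
  rewrite !addr0 cosD sinD cos_pihalf sin_pihalf.
  apply/eqP; rewrite eq_complex cReM cImM cReM cImM /=.
  by apply/andP; split; apply/eqP; ring.
rewrite /pd (eq_cint integrandE) /Cintegral /=.
rewrite (rintZ _ (L1D (L1_phase_int q 0 sr) (L1_phase_int q (pi / 2) si))).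
rewrite (rintD (L1_phase_int q 0 sr) (L1_phase_int q (pi / 2) si)).
rewrite (rintZ _ (L1B (L1_phase_int q 0 si) (L1_phase_int q (pi / 2) sr))).
rewrite (rintB (L1_phase_int q 0 si) (L1_phase_int q (pi / 2) sr)).
rewrite !smooth_cpt_inversion// cos0 cos_pihalf mulr1 mulr0 !mul0r addr0 subr0.
rewrite /fourier_const -/r [RHS]complex_split -[in RHS]/(f q) -[in RHS]/(g q).
apply/eqP; rewrite eq_complex cReM cImM /= !mul0r subr0 addr0 !mulrA fourier_scale_sqr !mul1r.
by rewrite !eqxx.
Qed.

End fourier_transform.

(** * The operators F(t) *)

Section symbols.
Context {R : realType} {n : nat}.
Local Notation Rn := 'rV[R]_n.
Local Notation Re := complex.Re.
Local Notation Im := complex.Im.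

(** In the representation the drift and the compensator are purely imaginary; what remains is [a],
    the quadratic form and the integral of [1 - cos]. *)
Lemma cnd_Re_ge0 (psi : Rn -> R[i]) p :
  continuous_negative_definite psi -> 0 <= Re (psi p).
Proof.
move=> [a [l [Q [N [a0 [_ Q0] _ _ ->]]]]].
have ReD (z w : R[i]) : Re (z + w) = Re z + Re w by case: z; case: w.
have Rei (x : R) : Re ('i%C * x%:C) = 0 by rewrite cReM /= mul0r mulr0 subrr.
rewrite !ReD Rei addr0 !addr_ge0//; first exact: Q0.
apply: Rintegral_ge0 => y _; rewrite !ReD Rei addr0 expCi /= subr_ge0.
exact: le_trans (ler_norm _) (norm_cos_le1 _).
Qed.

Lemma CmeasurableD (f g : Rn -> R[i]) : Cmeasurable f -> Cmeasurable g ->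
  Cmeasurable (fun x => f x + g x).
Proof.
by move=> [rf jf] [rg jg]; split; under eq_fun do rewrite raddfD /=;
  exact: measurable_funD.
Qed.

Lemma Cmeasurable_cst (a : R[i]) : Cmeasurable (fun _ : Rn => a).
Proof. by split; exact: measurable_cst. Qed.

Lemma Cmeasurable_expC (f : Rn -> R[i]) : Cmeasurable f ->
  Cmeasurable (fun x => expC (f x)).
Proof.
move=> [rf jf]; have me : measurable_fun setT (fun x : Rn => expR (Re (f x))).
  exact: (measurableT_comp (@measurable_expR R) rf).
split; rewrite /expC.
  under eq_fun do rewrite cReM /= mul0r subr0.
  apply: measurable_funM => //; apply: (measurableT_comp _ jf).
  by apply: continuous_measurable_fun; exact: continuous_cos.
under eq_fun do rewrite cImM /= mul0r addr0.
apply: measurable_funM => //; apply: (measurableT_comp _ jf).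
by apply: continuous_measurable_fun; exact: continuous_sin.
Qed.

Section one_symbol.
Variables (psi : Rn -> R[i]) (k : R).
Hypothesis k0 : 0 <= k.
Hypothesis psi_m : Cmeasurable psi.
Hypothesis psi_ge0 : forall p, 0 <= Re (psi p).
Hypothesis psi_le : forall p, Re `|psi p| <= k * (1 + sqnorm p).

Local Notation E t := (fun p => expC (- (t%:C * psi p))).

Lemma le_tame (b : R) (s : Rn -> R[i]) : 0 <= b -> Cmeasurable s ->
  (forall p, Re `|s p| <= b * (1 + sqnorm p)) -> tame b s.
Proof.
move=> b0 ms sb; split=> // p; rewrite (le_trans (sb p))// ler_wpM2l//.
by rewrite ler_eXnr// oneD_sqnorm_ge1.
Qed.

Lemma bounded_tame (b : R) (s : Rn -> R[i]) : 0 <= b -> Cmeasurable s ->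
  (forall p, Re `|s p| <= b) -> tame b s.
Proof.
move=> b0 ms sb; apply: le_tame => // p; rewrite (le_trans (sb p))// ler_peMr//.
exact: oneD_sqnorm_ge1.
Qed.

Lemma tame_lin (a : R[i]) (b c : R) (s u : Rn -> R[i]) : tame b s -> tame c u ->
  tame (Re `|a| * b + c) (fun p => a * s p + u p).
Proof.
move=> [b0 ms sb] [c0 mu uc]; split.
- by rewrite addr_ge0// mulr_ge0// Re_norm_ge0.
- by apply: CmeasurableD => //; apply: CmeasurableM => //; exact: Cmeasurable_cst.
move=> p; rewrite (le_trans (Re_normD _ _))// mulrDl lerD// Re_normM -mulrA.
by rewrite ler_wpM2l ?Re_norm_ge0.
Qed.

Lemma tame1 : tame 1 (fun _ : Rn => 1).
Proof.
by apply: bounded_tame => // p; rewrite normr1.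
Qed.

Lemma tame_symbol : tame k psi.
Proof. exact: le_tame. Qed.

Lemma Cmeasurable_expC_symbol (t : R) : Cmeasurable (E t).
Proof.
apply: Cmeasurable_expC.
have : Cmeasurable (fun p => (- t%:C) * psi p).
  by apply: CmeasurableM => //; exact: Cmeasurable_cst.
by rewrite (_ : (fun p => - t%:C * psi p) = fun p => - (t%:C * psi p))//;
  apply/funext => p; rewrite mulNr.
Qed.

Lemma Re_symbolZ_ge0 (t : R) p : 0 <= t -> 0 <= Re (t%:C * psi p).
Proof. by move=> t0; rewrite cReM /= mul0r subr0 mulr_ge0. Qed.

Lemma norm_expC_symbol (t : R) p : 0 <= t -> Re `|expC (- (t%:C * psi p))| <= 1.
Proof.
by move=> t0; rewrite norm_expC raddfN /= -expR0 ler_expR oppr_le0 Re_symbolZ_ge0.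
Qed.

Lemma tame_expC (t : R) : 0 <= t -> tame 1 (E t).
Proof.
move=> t0; apply: bounded_tame => //; first exact: Cmeasurable_expC_symbol.
by move=> p; exact: norm_expC_symbol.
Qed.

(** The difference factors as [exp (- s psi)], of modulus at most 1, times
    [exp (- (t - s) psi) - 1]. It is written as a linear combination to match [pd_comb]. *)
Lemma tame_expC_diff (s t : R) : 0 <= s -> s <= t ->
  tame (3 * (t - s) * k) (fun p => -1 * E s p + E t p).
Proof.
move=> s0 st; have ts : 0 <= t - s by rewrite subr_ge0.
apply: le_tame.
- by rewrite !mulr_ge0.
- apply: CmeasurableD; last exact: Cmeasurable_expC_symbol.
  by apply: CmeasurableM; [exact: Cmeasurable_cst|exact: Cmeasurable_expC_symbol].
move=> p; rewrite (_ : -1 * _ + _ = E s p * (expC (- ((t - s)%:C * psi p)) - 1)).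
  rewrite Re_normM -[leRHS]mul1r ler_pM ?Re_norm_ge0 ?norm_expC_symbol//.
  rewrite (le_trans (norm_expCN1_le (Re_symbolZ_ge0 p ts)))// -!mulrA ler_wpM2l//.
  by rewrite Re_normMr// ler_wpM2l.
rewrite mulrBr mulr1 -expCD mulN1r addrC; congr (expC _ - _).
by rewrite rmorphB /=; ring.
Qed.

(** The second-order remainder is bounded by [4 t^2 |psi|^2]; this is where the squared growth
    appears. The nesting follows the two uses of [pd_comb] in [F_deriv]. *)
Lemma tame_expC_rem (t : R) : 0 <= t ->
  tame (4 * (t * k) ^+ 2) (fun p => t%:C * psi p + (-1 * 1 + E t p)).
Proof.
move=> t0; split.
- by rewrite mulr_ge0// sqr_ge0.
- apply: CmeasurableD.
    by apply: CmeasurableM => //; exact: Cmeasurable_cst.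
  by apply: CmeasurableD; [exact: Cmeasurable_cst|exact: Cmeasurable_expC_symbol].
move=> p; rewrite (addrC (t%:C * _)) (addrC (-1 * 1)) mulr1.
rewrite (le_trans (norm_expCN1D_le (Re_symbolZ_ge0 p t0)))//.
rewrite -mulrA ler_wpM2l// -exprMn lerXn2r ?nnegrE ?Re_norm_ge0//.
  by rewrite !mulr_ge0// (le_trans ler01)// oneD_sqnorm_ge1.
by rewrite Re_normMr// -mulrA ler_wpM2l.
Qed.

End one_symbol.
End symbols.

(** * Linear combinations of test functions *)

Section test_functions.
Context {R : realType} {n : nat}.
Local Notation Rn := 'rV[R]_n.
Local Notation Re := complex.Re.
Local Notation Im := complex.Im.

Lemma Ck_lin k (a : R) (f g : Rn -> R) : Ck k f -> Ck k g ->
  Ck k (fun x => a * f x + g x).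
Proof.
have c1 (u v : Rn -> R) : continuous u -> continuous v ->
    continuous (fun x => a * u x + v x).
  by move=> cu cv x; exact: (cvgD (cvgZl_tmp (cu x)) (cv x)).
elim: k f g => [|k IH] f g /=; first exact: c1.
move=> [cf df] [cg dg]; split; first exact: c1.
move=> i; have [ff Df] := df i; have [gg Dg] := dg i; split.
  move=> x; apply: derivableD => //; exact: derivableZ.
rewrite (_ : (fun x => _) = fun x => a * 'D_(delta_mx ord0 i) f x + 'D_(delta_mx ord0 i) g x).
  exact: IH.
apply/funext => x.
have fx : derivable (a *: f) x (delta_mx ord0 i) by exact: derivableZ.
apply: etrans (deriveD fx (gg x)) _; congr (_ + _).
exact: deriveZ.
Qed.

Lemma Cc_smooth_lin (a : R[i]) (phi psi : Rn -> R[i]) :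
  Cc_smooth phi -> Cc_smooth psi -> Cc_smooth (fun x => a * phi x + psi x).
Proof.
move=> [sphi cphi] [spsi cpsi]; split.
  move=> k; have [rphi iphi] := sphi k; have [rpsi ipsi] := spsi k; split.
    rewrite (_ : (fun x => _) = fun x => Re a * Re (phi x) + (- Im a * Im (phi x) + Re (psi x))).
      by do 2!apply: Ck_lin => //.
    by apply/funext => x; rewrite raddfD /= cReM addrA mulNr.
  rewrite (_ : (fun x => _) = fun x => Re a * Im (phi x) + (Im a * Re (phi x) + Im (psi x))).
    by do 2!apply: Ck_lin => //.
  by apply/funext => x; rewrite raddfD /= cImM addrA.
set K := closure [set x | phi x != 0] `|` closure [set x | psi x != 0].
have cK : closed K by apply: closedU; exact: closed_closure.
apply: (@subclosed_compact _ _ K); [exact: closed_closure|exact: compactU|].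
rewrite [X in _ `<=` X]((closure_id K).1 cK); apply: closure_subset => x /= nz.
have [phi0|phi0] := eqVneq (phi x) 0; last by left; exact: subset_closure.
right; apply: subset_closure => /=; apply: contraNneq nz => psi0.
by rewrite phi0 psi0 mulr0 addr0.
Qed.

End test_functions.

Section nrm_Cinfty.
Context {R : realType} {d : nat}.
Local Notation X := (Cinfty R d).

Lemma nrm_le (f : X) (M : R) : (forall q, complex.Re `|f q| <= M) -> nrm f <= M.
Proof. by rewrite /nrm Cinfty_normE; exact: supnorm_le. Qed.

End nrm_Cinfty.

(** * Chernoff equivalence and the Feynman formula *)

Section feynman_formula.
Context {R : realType} {d : nat}.
Local Notation X := (Cinfty R d).
Local Notation Re := complex.Re.
Local Notation Im := complex.Im.
Variables (H : 'rV[R]_d -> 'rV[R]_d -> R[i]) (k : R).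
Hypothesis k0 : 0 <= k.
Hypothesis H_m : forall q, Cmeasurable (H q).
Hypothesis H_ge0 : forall q p, 0 <= Re (H q p).
Hypothesis H_le : forall q p, Re `|H q p| <= k * (1 + sqnorm p).
Variables (T : R -> X -> X) (hT : strongly_continuous_semigroup T).
Hypothesis H_gen : closure (opp_pdo_graph H) = generator T.
Variable F : R -> X -> X.
Hypothesis F_pdo : forall t : R, 0 <= t ->
  contraction_extension (fun q p => expC (- (t%:C * H q p))) (F t).

Lemma F_linear (t : R) : 0 <= t -> linear (F t).
Proof. by case/F_pdo. Qed.

Lemma F_contraction (t : R) : 0 <= t -> forall f, nrm (F t f) <= nrm f.
Proof. by case/F_pdo => _ Fle _ f; have := Fle f; rewrite !nrmE lecR. Qed.

Lemma F_contractionB (t : R) f g : 0 <= t -> nrm (F t f - F t g) <= nrm (f - g).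
Proof. by move=> t0; rewrite -(linB (F_linear t0)) F_contraction. Qed.

Lemma F_pd (t : R) (phi : X) q : 0 <= t -> Cc_smooth phi ->
  F t phi q = pd (fun p => expC (- (t%:C * H q p))) phi q.
Proof. by move=> /F_pdo[_ _ FE] /FE. Qed.

Lemma opp_pdo_graph_dense (f : X) e : 0 < e ->
  exists v g, opp_pdo_graph H (v, g) /\ nrm (f - v) < e.
Proof.
move=> e0; have e20 : 0 < e / 2 by rewrite divr_gt0.
have [v [g [vg vf]]] := gen_dense hT f e20.
move: vg; rewrite -H_gen => /nrm_closureP/(_ _ e20)[v' [g' [vg' vv' _]]].
exists v', g'; split=> //; rewrite (le_lt_trans (nrm_tri v _ _))//.
by rewrite [e]splitr ltrD// nrmBC.
Qed.

Lemma F_lipschitz (phi : X) : Cc_smooth phi -> exists2 C : R, 0 <= C &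
  forall s t : R, 0 <= s -> s <= t -> nrm (F t phi - F s phi) <= C * (t - s).
Proof.
move=> sphi; have [C C0 HC] := pd_le sphi.
exists (3 * k * C); first by rewrite !mulr_ge0.
move=> s t s0 st; have t0 := le_trans s0 st; apply: nrm_le => q.
have := HC _ _ q (tame_expC_diff k0 (H_m q) (H_ge0 q) (H_le q) s0 st).
rewrite (pd_comb _ _ (tame_expC (H_m q) (H_ge0 q) s0)
  (tame_expC (H_m q) (H_ge0 q) t0) sphi).
rewrite -(F_pd _ s0 sphi) -(F_pd _ t0 sphi) mulN1r addrC.
by move=> /le_trans; apply; rewrite le_eqVlt; apply/orP; left; apply/eqP; ring.
Qed.

Lemma F0 : F 0 = id.
Proof.
have z0 : (0 : R) <= 0 by [].
have E0 q : (fun p => expC (- (0%:C * H q p))) = fun=> 1.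
  by apply/funext => p; rewrite mul0r oppr0 /expC /= expR0 cos0 sin0 mul1r.
(* The symbol at time 0 is 1, so on test functions this is Fourier inversion; density and the
   contraction property do the rest. *)
have F0phi (phi : X) : Cc_smooth phi -> F 0 phi = phi.
  move=> sphi; apply/val_inj/funext => q /=.
  by have := F_pd q z0 sphi; rewrite E0 pd1.
apply/funext => f; apply/eqP; rewrite -subr_eq0; apply/eqP/nrm0_eq0.
apply/eqP; rewrite eq_le nrm_ge0 andbT; apply/ler_addgt0Pl => e e0.
have e20 : 0 < e / 2 by rewrite divr_gt0.
have [v [g [[sv _] fv]]] := opp_pdo_graph_dense f e20.
rewrite addr0 (le_trans (nrm_tri v _ _))// [leRHS]splitr lerD//; last first.
  by rewrite nrmBC ltW.
by rewrite -{1}(F0phi v sv) (le_trans (F_contractionB _ _ z0))// ltW.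
Qed.

Lemma F_deriv (v g : X) : opp_pdo_graph H (v, g) -> forall e : R, 0 < e ->
  exists2 d : R, 0 < d & forall t : R, 0 < t -> t < d ->
    nrm (F t v - v - t%:C *: g) <= e * t.
Proof.
move=> [sv gE] e e0; rewrite /= in sv gE; have [C C0 HC] := pd_le sv.
have D0 : 0 < 4 * k ^+ 2 * C + 1 by rewrite ltr_wpDl// !mulr_ge0// sqr_ge0.
(* The error is at most [4 (t k)^2 C], which is below [e t] once [4 k^2 C t <= e]. *)
exists (e / (4 * k ^+ 2 * C + 1)); first by rewrite divr_gt0.
move=> t t0; rewrite ltr_pdivlMr// => te; have t0' := ltW t0.
apply: (@le_trans _ _ (4 * (t * k) ^+ 2 * C)); last first.
  have -> : 4 * (t * k) ^+ 2 * C = t * (4 * k ^+ 2 * C) * t by ring.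
  by rewrite ler_wpM2r// (le_trans _ (ltW te))// ler_wpM2l// lerDl.
apply: nrm_le => q.
have := HC _ _ q (tame_expC_rem k0 (H_m q) (H_ge0 q) (H_le q) t0').
have tE := tame_expC (H_m q) (H_ge0 q) t0'.
have tD := tame_lin (-1) tame1 tE.
rewrite (pd_comb _ _ (tame_symbol k0 (H_m q) (H_le q)) tD sv).
rewrite (pd_comb _ _ tame1 tE sv) (pd1 _ sv) -(F_pd _ t0' sv).
rewrite (_ : pd (H q) v q = - g q); last by rewrite gE opprK.
rewrite (_ : t%:C * - g q + (-1 * v q + F t v q) = (F t v - v - t%:C *: g) q)//.
by transitivity (F t v q - v q - t%:C * g q); first ring.
Qed.

Lemma F_strongly_continuous f : {within `[0, +oo[, continuous (fun t => F t f)}.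
Proof.
apply/subspace_continuousP => s; rewrite /= in_itv /= andbT => s0.
apply/nrm_cvgP => e e0; rewrite near_withinE.
have e30 : 0 < e / 3 by rewrite divr_gt0.
have [v [g [[sv _] fv]]] := opp_pdo_graph_dense f e30.
have [C C0 HC] := F_lipschitz sv.
have C10 : 0 < C + 1 by rewrite ltr_wpDl.
exists (e / 3 / (C + 1)); first by rewrite /= divr_gt0.
move=> t; rewrite /ball_ /= in_itv /= andbT ltr_pdivlMr// => st t0.
have Fst : nrm (F s v - F t v) < e / 3.
  apply: le_lt_trans st; apply: (@le_trans _ _ (C * `|s - t|)); last first.
    by rewrite mulrC ler_wpM2l// lerDl.
  have [ts|ts] := leP t s; first by rewrite ger0_norm ?subr_ge0// HC.
  by rewrite nrmBC distrC gtr0_norm ?subr_gt0// HC// ltW.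
have h1 := le_lt_trans (F_contractionB f v s0) fv.
have h2 := le_lt_trans (F_contractionB f v t0) fv; rewrite nrmBC in h2.
have eE : e = e / 3 + (e / 3 + e / 3) by field.
rewrite (le_lt_trans (nrm_tri (F s v) _ _))// eE ltrD//.
by rewrite (le_lt_trans (nrm_tri (F t v) _ _))// ltrD.
Qed.

Definition opp_pdo_domain : set X := operator_domain (opp_pdo_graph H).

Lemma opp_pdo_domain_linear : linear_subspace opp_pdo_domain.
Proof.
have lin (a : R[i]) f g : opp_pdo_domain f -> opp_pdo_domain g ->
    opp_pdo_domain (a *: f + g).
  move=> [f' [/= sf fE]] [g' [/= sg gE]]; exists (a *: f' + g'); split => /=.
    exact: (Cc_smooth_lin a sf sg).
  move=> q; rewrite -[LHS]/(a * f' q + g' q) fE gE.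
  have E : pdo H (a *: f + g) q = a * pdo H f q + pdo H g q.
    exact: (pd_linear a q (tame_symbol k0 (H_m q) (H_le q)) sf sg).
  by rewrite E opprD mulrN.
(* Density provides some [v] in the domain, and then [0 = - v + v]. *)
split=> //; have [v [g [vg _]]] := opp_pdo_graph_dense 0 ltr01.
have Dv : opp_pdo_domain v by exists g.
by have := lin (-1) _ _ Dv Dv; rewrite scaleN1r addNr.
Qed.

Lemma derivative_at_zero_generator : derivative_at_zero F = generator F.
Proof. by rewrite /derivative_at_zero F0. Qed.

(** One inclusion is [F_deriv]; the other is uniqueness of the limit defining [F'(0)]. *)
Lemma derivative_opp_pdo :
  operator_restrict (derivative_at_zero F) opp_pdo_domain = opp_pdo_graph H.
Proof.
have der v g : opp_pdo_graph H (v, g) -> derivative_at_zero F (v, g).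
  by rewrite derivative_at_zero_generator => vg; apply/genP; exact: F_deriv.
apply/seteqP; split => [[v g] /= [Fg [g' vg']]|[v g] vg].
  by rewrite (_ : g = g')//; exact: nrm_cvg_unique Fg (der _ _ vg').
by split; [exact: der|exists g].
Qed.

Lemma F_chernoff_equivalent : closable (opp_pdo_graph H) -> chernoff_equivalent F T.
Proof.
move=> Hc; split.
- move=> t t0; split; first exact: F_linear.
  by exists 1 => f; rewrite !nrmE -rmorphM lecR mul1r F_contraction.
- exact: F_strongly_continuous.
- exact: F0.
- exists 0 => // t t0 f.
  by rewrite mul0r expR0 !nrmE -rmorphM lecR mul1r F_contraction.
exists opp_pdo_domain; rewrite derivative_opp_pdo.
split; [exact: opp_pdo_domain_linear| |exact: Hc|exact: H_gen].
by move=> v [g]; rewrite -derivative_opp_pdo => -[Fg _]; exists g.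
Qed.

Lemma F_iter_cvg (f : X) t0 : 0 <= t0 ->
  {uniform `[0, t0],
    (fun (n : nat) (t : R) => iter n (F (t / n%:R)) f) @ \oo -->
    (fun t : R => T t f)}.
Proof.
move=> t00 P /uniform_nbhs[E [+ EP]]; rewrite -entourage_from_ballE.
move=> [_ /gt0_RReP[e e0 ->] eE].
have e20 : 0 < e / 2 by rewrite divr_gt0.
have [N HN] := chernoff_cvg hT F_linear F_contraction F0 F_deriv H_gen f t00 e20.
exists N => // m /= Nm; apply: EP => t /=; rewrite in_itv /= => /andP[t0' tt0].
apply: eE; rewrite -ball_normE /ball_ /= nrmE ltcR nrmBC.
by rewrite (le_lt_trans (HN m t Nm t0' tt0))//; lra.
Qed.

End feynman_formula.

Theorem theorem3p1 (R : realType) (d : nat)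
  (H : 'rV[R]_d -> 'rV[R]_d -> R[i])
  (H_measurable :
    measurable_fun setT (fun z : 'rV[R]_d * 'rV[R]_d => complex.Re (H z.1 z.2))
    /\
    measurable_fun setT (fun z : 'rV[R]_d * 'rV[R]_d => complex.Im (H z.1 z.2)))
  (H_locally_bounded : forall z : 'rV[R]_d * 'rV[R]_d,
    exists M : R, \forall w \near z, `|H w.1 w.2| <= M%:C)
  (H_cnd : forall q, continuous_negative_definite (H q))
  (H_growth : exists2 kappa : R, 0 < kappa &
    forall q p, `|H q p| <= (kappa * (1 + sqnorm p))%:C)
  (H_unif : forall e : R, 0 < e ->
    \forall p \near (0 : 'rV[R]_d), forall q, `|H q p - H q 0| < e%:C)
  (H_cont : forall p, continuous (fun q => H q p))
  (T : R -> Cinfty R d -> Cinfty R d)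
  (T_semigroup : strongly_continuous_semigroup T)
  (HD_closable : closable (opp_pdo_graph H))
  (HD_generator : closure (opp_pdo_graph H) = generator T)
  (HD_core : operator_core (generator T) Ccinfty)
  (F : R -> Cinfty R d -> Cinfty R d)
  (F_pdo : forall t : R, 0 <= t ->
    contraction_extension (fun q p => expC (- (t%:C * H q p))) (F t)) :
  chernoff_equivalent F T /\
  forall (f : Cinfty R d) (t0 : R), 0 <= t0 ->
    {uniform `[0, t0],
      (fun (n : nat) (t : R) => iter n (F (t / n%:R)) f) @ \oo -->
      (fun t : R => T t f)}.
Proof.
have [k k0 Hk] := H_growth; have k0' := ltW k0.
have Hm q : Cmeasurable (H q).
  case: H_measurable => mr mi; split.
    exact: (measurableT_comp mr (pair1_measurable q)).
  exact: (measurableT_comp mi (pair1_measurable q)).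
have H0 q p : 0 <= complex.Re (H q p) by exact: cnd_Re_ge0.
have Hle q p : complex.Re `|H q p| <= k * (1 + sqnorm p) by rewrite -normC_leE.
split; first exact: (F_chernoff_equivalent k0' Hm H0 Hle T_semigroup).
by move=> f t0; exact: (F_iter_cvg k0' Hm H0 Hle T_semigroup).
Qed.
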